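(* Let $0<p<1$ be such that $2(1/p-1)$ is an integer greater than $2$. For every $\epsilon>0$ with $2(1/p-1)-\epsilon>0$ there is a bounded domain $D\subset\mathbb{R}^2$ with $C^{2(1/p-1)-\epsilon}$ boundary such that the operators $f\mapsto\dfrac{\partial^2G(f)}{\partial x_i\,\partial x_j}$, $1\le i,j\le2$, are not all bounded from $h^p_z(D)$ to $h^p_r(D)$.
   Context: Boundary regularity: for real $\lambda=m+\theta$ with $m$ an integer and $0\le\theta<1$, $C^\lambda$ boundary means that $\partial D$ is locally the graph of a $C^{m,\theta}$ function ($C^m$ if $\theta=0$). Hardy spaces (here $n=2$): $h^p(\mathbb{R}^n)$ is Goldberg's local Hardy space, i.e. the tempered distributions $F$ with $\sup_{0<t<1}|\phi_t*F|\in L^p(\mathbb{R}^n)$, where $\phi\in C_0^\infty$ of the unit ball, $\phi\ge0$, $\int\phi=1$, $\phi_t(x)=t^{-n}\phi(x/t)$; its quasi-norm is the $L^p$ quasi-norm of this maximal function. A distribution $f$ on $D$ lies in $h^p_r(D)$ if it has an extension $E(f)\in h^p(\mathbb{R}^n)$; it lies in $h^p_z(D)$ if it has an extension $E_z(f)\in h^p(\mathbb{R}^n)$ with $E_z(f)=0$ on $\mathbb{R}^n\setminus\overline D$. The quasi-norms are the infima of the $h^p(\mathbb{R}^n)$ quasi-norms over such extensions. $G(f)(x)=\int_D G(x,y)f(y)\,dy$ is the solution of $\Delta u=f$ in $D$, $u=0$ on $\partial D$, where $G(x,y)$ is the Dirichlet Green's function of $D$. Boundedness means an inequality $\|\partial^2G(f)/\partial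 x_i\partial x_j\|_{h^p_r(D)}\le C\|f\|_{h^p_z(D)}$. *)

(* Defs.v *)
From HB Require Import structures.
From mathcomp Require Import all_boot all_order all_algebra.
From mathcomp Require Import all_classical all_reals all_analysis.

Set Implicit Arguments.
Unset Strict Implicit.
Unset Printing Implicit Defensive.

Import Order.TTheory GRing.Theory Num.Theory.
Import numFieldNormedType.Exports.

Local Open Scope classical_set_scope.
Local Open Scope ring_scope.

(** * Calculus on the plane [R * R] *)

(* The library norm of [R * R] is the sup norm; [dot] and [enorm] are the
   Euclidean structure. *)
Definition dot (R : realType) (x y : R * R) : R := x.1 * y.1 + x.2 * y.2.

Definition enorm (R : realType) (x : R * R) : R := Num.sqrt (dot x x).

Definition mu2 (R : realType) :
    {measure set (measurableTypeR R * measurableTypeR R) -> \bar R} :=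
  (@lebesgue_measure R \x @lebesgue_measure R)%E.

Definition basis2 (R : realType) (i : 'I_2) : R * R :=
  if i == 0 then (1, 0) else (0, 1).

Definition pderiv (R : realType) (i : 'I_2) (f : R * R -> R) : R * R -> R :=
  fun x => 'D_(basis2 R i) f x.

Definition pderivs (R : realType) (s : seq 'I_2) (f : R * R -> R) :
  R * R -> R := foldr (@pderiv R) f s.

Definition Ck_on (R : realType) (k : nat) (O : set (R * R))
    (f : R * R -> R) : Prop :=
  (forall s i x, (size s < k)%N -> O x ->
     derivable (pderivs s f) x (basis2 R i)) /\
  (forall s x, (size s <= k)%N -> O x -> {for x, continuous (pderivs s f)}).

Definition smooth (R : realType) (f : R * R -> R) : Prop :=
  forall k, Ck_on k setT f.

Definition laplacian (R : realType) (f : R * R -> R) : R * R -> R :=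
  fun x => \sum_(i < 2) pderivs [:: i; i] f x.

Definition harmonic_on (R : realType) (O : set (R * R))
    (f : R * R -> R) : Prop :=
  Ck_on 2 O f /\ forall x, O x -> laplacian f x = 0.

Definition test_function (R : realType) (O : set (R * R))
    (f : R * R -> R) : Prop :=
  smooth f /\
  exists K : set (R * R),
    [/\ compact K, K `<=` O & forall x, ~ K x -> f x = 0].

(** * Domains with [C^lambda] boundary and their Green's functions *)

Definition boundary (R : realType) (D : set (R * R)) : set (R * R) :=
  closure D `\` interior D.

Definition bounded_domain (R : realType) (D : set (R * R)) : Prop :=
  [/\ open D, connected D, D !=set0 & bounded_set D].

(* [C^{m,theta}] on [I], read as [C^m] when [theta = 0]. *)
Definition Cholder_on (R : realType) (m : nat) (theta : R) (I : set R)
    (g : R -> R) : Prop :=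
  [/\ forall j s, (j < m)%N -> I s -> derivable (derive1n j g) s 1,
      forall s, I s -> {for s, continuous (derive1n m g)} &
      theta != 0 -> exists C : R, forall s t, I s -> I t ->
        `|derive1n m g s - derive1n m g t| <= C * `|s - t| `^ theta].

(* Near each boundary point [x0], in Cartesian coordinates [(s, t)] centred at
   [x0] with orthonormal axes [tau], [nu], the boundary is the graph
   [t = g s] and [D] is the side [t > g s] of it.  For [lambda >= 0],
   [lambda = m + theta] with [m = truncn lambda]. *)
Definition C_boundary (R : realType) (lambda : R) (D : set (R * R)) : Prop :=
  forall x0, boundary D x0 ->
  exists (tau nu : R * R) (r : R) (g : R -> R),
    [/\ dot tau tau = 1, dot nu nu = 1 & dot tau nu = 0] /\
    [/\ 0 < r,
        Cholder_on (Num.truncn lambda) (lambda - (Num.truncn lambda)%:R)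
          `](- r), r[ g,
        (forall s t : R, `|s| < r -> `|t| < r ->
           D (x0 + s *: tau + t *: nu) <-> g s < t) &
        (forall s t : R, `|s| < r -> `|t| < r ->
           boundary D (x0 + s *: tau + t *: nu) <-> t = g s)].

(* Normalised by [Delta_x G(x, y) = delta_y], so that [Delta (G f) = f].  The
   two conditions determine [G x y] for distinct [x], [y] in [D]. *)
Definition green_function (R : realType) (D : set (R * R))
    (G : R * R -> R * R -> R) : Prop :=
  forall y, D y ->
    (exists2 h : R * R -> R, harmonic_on D h &
       forall x, D x -> x != y ->
         G x y = (2 * pi)^-1 * ln (enorm (x - y)) + h x) /\
    (forall x0, boundary D x0 ->
       (fun x => G x y) @ within D (nbhs x0) --> (0 : R)).

Definition green_op (R : realType) (D : set (R * R))
    (G : R * R -> R * R -> R) (f : R * R -> R) : R * R -> R :=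
  fun x => \int[@mu2 R]_(y in D) (G x y * f y).

(** * Distributions

   A distribution is a functional on all functions [R * R -> R], of which only
   the values on the relevant test functions matter. *)

Definition schwartz_norm (R : realType) (N : nat) (f : R * R -> R) : \bar R :=
  ereal_sup [set z | exists (s : seq 'I_2) (x : R * R), (size s <= N)%N /\
                       z = ((1 + enorm x) ^+ N * `|pderivs s f x|)%:E].

Definition schwartz (R : realType) (f : R * R -> R) : Prop :=
  smooth f /\ forall N, (schwartz_norm N f < +oo)%E.

Definition tempered (R : realType) (F : (R * R -> R) -> R) : Prop :=
  (forall (a : R) f g, schwartz f -> schwartz g ->
     F (fun x => a * f x + g x) = a * F f + F g) /\
  (exists (C : R) (N : nat), forall f, schwartz f ->
     (`|F f|%:E <= C%:E * schwartz_norm N f)%E).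

Definition distr_of (R : realType) (D : set (R * R)) (f : R * R -> R) :
  (R * R -> R) -> R := fun g => \int[@mu2 R]_(x in D) (f x * g x).

Definition ddistr (R : realType) (i : 'I_2) (T : (R * R -> R) -> R) :
  (R * R -> R) -> R := fun g => - T (pderiv i g).

Definition eq_distr_on (R : realType) (O : set (R * R))
    (T T' : (R * R -> R) -> R) : Prop :=
  forall g, test_function O g -> T g = T' g.

(** * Local Hardy spaces *)

Definition mollifier (R : realType) (phi : R * R -> R) : Prop :=
  [/\ test_function [set x | enorm x < 1] phi,
      forall x, 0 <= phi x &
      \int[@mu2 R]_x phi x = 1].

(* [phi_t * F], with [phi_t x = t^-2 phi (x / t)]. *)
Definition mollify (R : realType) (phi : R * R -> R) (t : R)
    (F : (R * R -> R) -> R) : R * R -> R :=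
  fun x => F (fun y => t ^- 2 * phi (t^-1 *: (x - y))).

Definition local_maximal (R : realType) (phi : R * R -> R)
    (F : (R * R -> R) -> R) : R * R -> \bar R :=
  fun x => ereal_sup [set `|mollify phi t F x|%:E | t in `]0, 1[].

(* A tempered distribution [F] is in [h^p(R^2)] iff this is finite. *)
Definition hp_norm (R : realType) (phi : R * R -> R) (p : R)
    (F : (R * R -> R) -> R) : \bar R :=
  Lnorm (@mu2 R) p%:E (local_maximal phi F).

(* [T] is in [h^p_r(D)], resp. [h^p_z(D)], iff the following infimum is finite:
   there is no extension in [h^p(R^2)] exactly when it is [+oo]. *)
Definition hpr_norm (R : realType) (phi : R * R -> R) (p : R)
    (D : set (R * R)) (T : (R * R -> R) -> R) : \bar R :=
  ereal_inf [set hp_norm phi p E | E in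
    [set E | tempered E /\ eq_distr_on D E T]].

Definition hpz_norm (R : realType) (phi : R * R -> R) (p : R)
    (D : set (R * R)) (T : (R * R -> R) -> R) : \bar R :=
  ereal_inf [set hp_norm phi p E | E in
    [set E | [/\ tempered E, eq_distr_on D E T &
                 eq_distr_on (~` closure D) E (fun=> 0)]]].

(* For [p < 1] the integral defining [G f] has no meaning for a general
   distribution [f] in [h^p_z(D)]: boundedness is the inequality on the test
   functions of [D], a dense subspace of [h^p_z(D)] when [C_boundary] holds. *)
Definition hpz_hpr_bounded (R : realType) (phi : R * R -> R) (p : R)
    (D : set (R * R)) (A : (R * R -> R) -> ((R * R -> R) -> R)) : Prop :=
  exists2 C : R, 0 <= C &
    forall f, test_function D f ->
      (hpz_norm phi p D (distr_of D f) < +oo)%E ->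
      (hpr_norm phi p D (A f) <=
         C%:E * hpz_norm phi p D (distr_of D f))%E.

Definition d2green (R : realType) (D : set (R * R))
    (G : R * R -> R * R -> R) (i j : 'I_2) (f : R * R -> R) :
  (R * R -> R) -> R := ddistr i (ddistr j (distr_of D (green_op D G f))).

(* Main.v *)
Require Import Defs.
From HB Require Import structures.
From mathcomp Require Import all_boot all_order all_algebra.
From mathcomp Require Import all_classical all_reals all_analysis.
From mathcomp Require Import measurable_realfun.
From mathcomp Require Import complex ring lra zify.

Set Implicit Arguments.
Unset Strict Implicit.
Unset Printing Implicit Defensive.

Import Order.TTheory GRing.Theory Num.Theory.
Import numFieldNormedType.Exports.
Import Normc.

Local Open Scope classical_set_scope.
Local Open Scope ring_scope.

Local Notation Re := complex.Re.
Local Notation Im := complex.Im.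

(** Write N = 2 (1/p - 1), an integer, so that p (N + 2) = 2.  The domain is the
    preimage of the disc |w - 1| < 1 under Phi z = z + c z ^ alpha, with
    alpha = N - 2 ^ -k and c small; its boundary is of class C^alpha, and is
    singular only at 0.  Its Green's function is explicit, and for x near 1/2
    and y near 0
      2 pi G(x, y) = (smooth in y) + kappa x * Re (c y ^ alpha) + (smaller),
    where kappa x = 1 - 2 Re (1 / Phi x).

    Apply G to a K-th difference f, K = 2 N + 2, with step d, of a bump of width
    d centred at (d, 0).  The h^p_z quasi-norm of f is O(d ^ (N + 2)): the
    maximal function of f decays like (1 + |x| / d) ^ - (K + 2).  Moving the
    difference onto the kernel kills its smooth part up to O(d ^ K), but only
    reduces Re (c y ^ alpha) to size d ^ alpha, because alpha is not an integer.
    Hence G f = kappa I + O(d ^ (N + 2)) near 1/2 with |I| of order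
    d ^ (alpha + 2), and the strict concavity of kappa along the first axis makes the
    second derivative of G f at least of order d ^ (alpha + 2) in h^p_r.  As
    alpha < N, no inequality can hold as d -> 0.

    Taking the exponent alpha dyadic allows z ^ alpha to be defined by iterated
    principal square roots, and d = w ^ (2 ^ k) makes d ^ alpha a polynomial. *)

(** * Complex numbers in the plane *)

(** The branch point 0 lies on the boundary, so z ^ alpha must be controlled up to it. The means is
    the divided difference: (z ^ alpha - w ^ alpha) / (z - w) is an explicit quotient of polynomials
    in the roots ([pq]), continuous up to 0. From it come the divided difference [PQ] of [Phi],
    whose nonvanishing isolates the logarithmic pole of G, and the slope of the boundary graph.

    The numbers are tied by p (N + 2) = 2. With K + 2 = 2 (N + 2), the p-th power of the maximal
    function of the atom decays like |x| ^ -4, which is integrable, and its integral, of order d ^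
    2, has p-th root of order d ^ (N + 2). With d = w ^ (2 ^ k) and a = N 2 ^ k - 1, the lower bound
    is of order w ^ a d ^ 2, while d ^ (N + 2) is w ^ (a + 1) d ^ 2: the contradiction rests on a
    single factor w. The same a leaves the last derivative of the boundary with Hoelder exponent 1 -
    2 ^ -k, so k is chosen from the fractional part of lambda.

    Near 1/2, Phi is close to the identity and kappa to 1 - 2 / x, whose second derivative - 4 / x ^
    3 is about - 32: hence the concavity. *)

Section complex_numbers.
Variable R : realType.
Implicit Types (z w : R[i]) (x y : R * R).

Definition cx x : R[i] := Complex x.1 x.2.

Lemma normc_sqr z : normc z ^+ 2 = Re z ^+ 2 + Im z ^+ 2.
Proof. by case: z => a b /=; rewrite sqr_sqrtr// addr_ge0// sqr_ge0. Qed.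

Lemma normc_ge0 z : 0 <= normc z.
Proof. by case: z => a b; exact: sqrtr_ge0. Qed.

Lemma Re_le_normc z : `|Re z| <= normc z.
Proof.
rewrite -(@ler_pXn2r _ 2)// ?nnegrE ?normr_ge0 ?normc_ge0//.
by rewrite normc_sqr real_normK ?num_real// lerDl sqr_ge0.
Qed.

Lemma Im_le_normc z : `|Im z| <= normc z.
Proof.
rewrite -(@ler_pXn2r _ 2)// ?nnegrE ?normr_ge0 ?normc_ge0//.
by rewrite normc_sqr real_normK ?num_real// lerDr sqr_ge0.
Qed.

Lemma normc_le_ReIm z : normc z <= `|Re z| + `|Im z|.
Proof.
rewrite -(@ler_pXn2r _ 2)// ?nnegrE ?normc_ge0 ?addr_ge0//.
rewrite normc_sqr -[Re z ^+ 2]real_normK ?num_real// -[Im z ^+ 2]real_normK ?num_real//.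
have := normr_ge0 (Re z); have := normr_ge0 (Im z); nra.
Qed.

Lemma normc_gt0 z : (0 < normc z) = (z != 0).
Proof.
rewrite lt_def normc_ge0 andbT; congr negb; apply/eqP/eqP => [/eq0_normc//|->].
exact: normc0.
Qed.

Lemma normcB_sym z w : normc (z - w) = normc (w - z).
Proof. by rewrite -normcN opprB. Qed.

Lemma normcX z n : normc (z ^+ n) = normc z ^+ n.
Proof. by elim: n => [|n ih]; rewrite ?expr0 ?normc1// !exprS normcM ih. Qed.

Lemma le_normcB z w : normc z - normc w <= normc (z - w).
Proof. by rewrite lerBlDr; apply: le_trans (le_normcD _ _); rewrite subrK. Qed.

Lemma normc_dist z w : `|normc z - normc w| <= normc (z - w).
Proof.
rewrite ler_norml le_normcB andbT lerNl opprB normcB_sym; exact: le_normcB.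
Qed.

Lemma normc_conj z : normc (conjc z) = normc z.
Proof. by case: z => a b /=; rewrite sqrrN. Qed.

Lemma normc_real (r : R) : normc (r%:C)%C = `|r|.
Proof. by rewrite /= expr0n addr0 sqrtr_sqr. Qed.

Lemma Re_mulr_real (r : R) z : Re ((r%:C)%C * z) = r * Re z.
Proof. by case: z => a b /=; rewrite mul0r subr0. Qed.

Lemma Im_mulr_real (r : R) z : Im ((r%:C)%C * z) = r * Im z.
Proof. by case: z => a b /=; rewrite mul0r addr0. Qed.

Lemma cReD z w : Re (z + w) = Re z + Re w. Proof. by case: z w => ? ? []. Qed.
Lemma cImD z w : Im (z + w) = Im z + Im w. Proof. by case: z w => ? ? []. Qed.
Lemma cReN z : Re (- z) = - Re z. Proof. by case: z. Qed.
Lemma cImN z : Im (- z) = - Im z. Proof. by case: z. Qed.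
Lemma cReM z w : Re (z * w) = Re z * Re w - Im z * Im w.
Proof. by case: z w => ? ? []. Qed.
Lemma cImM z w : Im (z * w) = Re z * Im w + Im z * Re w.
Proof. by case: z w => ? ? []. Qed.
Lemma cRe_conj z : Re (conjc z) = Re z. Proof. by case: z. Qed.
Lemma cIm_conj z : Im (conjc z) = - Im z. Proof. by case: z. Qed.
Lemma cReV z : Re z^-1 = Re z / (Re z ^+ 2 + Im z ^+ 2). Proof. by case: z. Qed.
Lemma cImV z : Im z^-1 = - Im z / (Re z ^+ 2 + Im z ^+ 2).
Proof. by case: z => a b /=; rewrite mulNr. Qed.

Lemma eq_ReIm z w : Re z = Re w -> Im z = Im w -> z = w.
Proof. by case: z w => a b [c d] /= -> ->. Qed.

Lemma cxD x y : cx (x + y) = cx x + cx y. Proof. by []. Qed.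
Lemma cxB x y : cx (x - y) = cx x - cx y. Proof. by []. Qed.
Lemma cxZ (r : R) x : cx (r *: x) = (r%:C)%C * cx x.
Proof. by apply: eq_ReIm; rewrite ?Re_mulr_real ?Im_mulr_real. Qed.

Lemma cx_inj : injective cx.
Proof. by move=> [a b] [c d] [-> ->]. Qed.

Lemma enormE x : enorm x = normc (cx x).
Proof. by rewrite /enorm /dot -!expr2. Qed.

Lemma enorm_ge_norm x : `|x| <= enorm x.
Proof.
rewrite enormE prod_normE ge_max; apply/andP; split.
  exact: (Re_le_normc (cx x)).
exact: (Im_le_normc (cx x)).
Qed.

Lemma enorm_le_norm x : enorm x <= 2 * `|x|.
Proof.
rewrite enormE (le_trans (normc_le_ReIm _))// mulr_natl mulr2n lerD//.
  by rewrite prod_normE le_max lexx.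
by rewrite prod_normE le_max lexx orbT.
Qed.

End complex_numbers.

Section complex_limits.
Variables (R : realType) (T : Type) (F : set_system T).
Context {FF : Filter F}.
Implicit Types (f g : T -> R[i]) (l m : R[i]).

(** Convergence is tested on the two coordinates, which reduces every complex limit below to limits
    of real functions. *)
Definition cvgc f l :=
  ((fun t => Re (f t)) @ F --> Re l) /\ ((fun t => Im (f t)) @ F --> Im l).

Lemma cvgc_cst l : cvgc (fun=> l) l.
Proof. by split; exact: cvg_cst. Qed.

Lemma cvgc_real (u : T -> R) (l : R) :
  u @ F --> l -> cvgc (fun t => (u t)%:C)%C (l%:C)%C.
Proof. by move=> ul; split=> //; exact: cvg_cst. Qed.

Lemma cvgcD f g l m : cvgc f l -> cvgc g m -> cvgc (fun t => f t + g t) (l + m).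
Proof.
move=> [f1 f2] [g1 g2]; split.
  by under eq_fun do rewrite cReD; rewrite cReD; exact: cvgD.
by under eq_fun do rewrite cImD; rewrite cImD; exact: cvgD.
Qed.

Lemma cvgcN f l : cvgc f l -> cvgc (fun t => - f t) (- l).
Proof.
move=> [f1 f2]; split.
  by under eq_fun do rewrite cReN; rewrite cReN; exact: cvgN.
by under eq_fun do rewrite cImN; rewrite cImN; exact: cvgN.
Qed.

Lemma cvgcB f g l m : cvgc f l -> cvgc g m -> cvgc (fun t => f t - g t) (l - m).
Proof. by move=> fl gm; exact/cvgcD/cvgcN. Qed.

Lemma cvgcM f g l m : cvgc f l -> cvgc g m -> cvgc (fun t => f t * g t) (l * m).
Proof.
move=> [f1 f2] [g1 g2]; split.
  under eq_fun do rewrite cReM; rewrite cReM.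
  by apply: cvgB; exact: cvgM.
under eq_fun do rewrite cImM; rewrite cImM.
by apply: cvgD; exact: cvgM.
Qed.

Lemma cvgcX f l n : cvgc f l -> cvgc (fun t => f t ^+ n) (l ^+ n).
Proof.
move=> fl; elim: n => [|n ih]; first exact: cvgc_cst.
under eq_fun do rewrite exprS; rewrite exprS.
exact: cvgcM.
Qed.

Lemma cvgc_sum (I : Type) (r : seq I) (P : pred I) (f : I -> T -> R[i]) (l : I -> R[i]) :
  (forall i, P i -> cvgc (f i) (l i)) ->
  cvgc (fun t => \sum_(i <- r | P i) f i t) (\sum_(i <- r | P i) l i).
Proof.
move=> fl; elim: r => [|i r ih].
  by under eq_fun do rewrite big_nil; rewrite big_nil; exact: cvgc_cst.
under eq_fun do rewrite big_cons; rewrite big_cons.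
by case: ifP => // Pi; apply: cvgcD => //; exact: fl.
Qed.

Lemma cvgc_prod (I : Type) (r : seq I) (P : pred I) (f : I -> T -> R[i]) (l : I -> R[i]) :
  (forall i, P i -> cvgc (f i) (l i)) ->
  cvgc (fun t => \prod_(i <- r | P i) f i t) (\prod_(i <- r | P i) l i).
Proof.
move=> fl; elim: r => [|i r ih].
  by under eq_fun do rewrite big_nil; rewrite big_nil; exact: cvgc_cst.
under eq_fun do rewrite big_cons; rewrite big_cons.
by case: ifP => // Pi; apply: cvgcM => //; exact: fl.
Qed.

Lemma cvgc_conj f l : cvgc f l -> cvgc (fun t => conjc (f t)) (conjc l).
Proof.
move=> [f1 f2]; split.
  by under eq_fun do rewrite cRe_conj; rewrite cRe_conj.
by under eq_fun do rewrite cIm_conj; rewrite cIm_conj; exact: cvgN.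
Qed.

Lemma cvgcV f l : l != 0 -> cvgc f l -> cvgc (fun t => (f t)^-1) l^-1.
Proof.
move=> l0 [f1 f2].
have n0 : Re l ^+ 2 + Im l ^+ 2 != 0.
  by rewrite -normc_sqr sqrf_eq0 gt_eqF// normc_gt0.
have h : (fun t => Re (f t) ^+ 2 + Im (f t) ^+ 2) @ F --> Re l ^+ 2 + Im l ^+ 2.
  by apply: cvgD; under eq_fun do rewrite expr2; rewrite expr2; exact: cvgM.
split.
  under eq_fun do rewrite cReV; rewrite cReV.
  by apply: cvgM => //; exact: cvgV.
under eq_fun do rewrite cImV; rewrite cImV.
by apply: cvgM; [exact: cvgN|exact: cvgV].
Qed.

Lemma cvgc_normc f l : cvgc f l -> (fun t => normc (f t)) @ F --> normc l.
Proof.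
move=> [f1 f2].
have E z : normc z = Num.sqrt (Re z ^+ 2 + Im z ^+ 2) by case: z.
under eq_fun do rewrite E; rewrite E.
apply: continuous_cvg; first exact: sqrt_continuous.
by apply: cvgD; under eq_fun do rewrite expr2; rewrite expr2; exact: cvgM.
Qed.

Lemma cvgc_squeeze f l (e : T -> R) : e @ F --> 0 ->
  (\forall t \near F, normc (f t - l) <= e t) -> cvgc f l.
Proof.
move=> e0 fe.
have aux (u : T -> R) (v : R) :
    (\forall t \near F, `|u t - v| <= e t) -> u @ F --> v.
  move=> uv; apply/cvgrPdist_le => eps eps0.
  have : \forall t \near F, `|0 - e t| <= eps by move/cvgrPdist_le: e0; apply.
  move=> h; near=> t.
  have /= h1 : `|u t - v| <= e t by near: t.
  have /= : `|0 - e t| <= eps by near: t.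
  rewrite sub0r normrN distrC => h2; exact: le_trans h1 (le_trans (ler_norm _) h2).
split; apply: aux; apply: filterS fe => t; apply: le_trans.
  by rewrite -cReN -cReD; exact: Re_le_normc.
by rewrite -cImN -cImD; exact: Im_le_normc.
Unshelve. all: by end_near. Qed.

Lemma cvgc_dist f l : cvgc f l -> (fun t => normc (f t - l)) @ F --> (0:R).
Proof.
move=> fl; rewrite -(normc0 R) -(subrr l); apply: cvgc_normc.
by apply: cvgcB => //; exact: cvgc_cst.
Qed.

Lemma near_eq_cvgc f g l : (\forall t \near F, f t = g t) -> cvgc f l -> cvgc g l.
Proof.
move=> fg [f1 f2]; split; [apply: cvg_trans f1|apply: cvg_trans f2];
  by apply: near_eq_cvg; apply: filterS fg => t /= ->.
Qed.

End complex_limits.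

Lemma cvgc_cx (R : realType) (x : R * R) : cvgc (nbhs x) (@cx R) (cx x).
Proof. by split; [exact: cvg_fst|exact: cvg_snd]. Qed.

(** * Iterated square roots *)

Section roots.
Variable R : realType.
Implicit Types (z w : R[i]).

Definition rt k z : R[i] := iter k (@sqrtc R) z.

Lemma rtX k z : rt k z ^+ (2 ^ k) = z.
Proof.
elim: k => [|k ih]; first by rewrite expn0 expr1.
by rewrite /rt iterS expnS exprM sqr_sqrtc.
Qed.

Lemma normc_rt k z : normc (rt k z) ^+ (2 ^ k) = normc z.
Proof. by rewrite -normcX rtX. Qed.

Lemma rt0 k : rt k 0 = 0.
Proof. by elim: k => [//|k ih]; rewrite /rt iterS -/(rt k 0) ih sqrtc0. Qed.

Lemma rt_eq0 k z : (rt k z == 0) = (z == 0).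
Proof.
by apply/eqP/eqP => [h|->]; [rewrite -(rtX k z) h expr0n expn_eq0|exact: rt0].
Qed.

Lemma Re_sqrtc z : Re (sqrtc z) = Num.sqrt ((normc z + Re z) / 2).
Proof. by case: z. Qed.

(* The closed sector |arg z| <= 2 pi / 3, on which all the roots [rt j],
   [j > 0], have argument at most pi / 3. *)
Definition sect z : bool := - (normc z / 2) <= Re z.

Lemma sectP z : reflect (- (normc z / 2) <= Re z) (sect z).
Proof. exact: idP. Qed.

Lemma sect0 : sect 0.
Proof. by rewrite /sect normc0 mul0r oppr0. Qed.

(** Half-angle formula: Re (sqrt z) ^ 2 = (|z| + Re z) / 2, and this is at least |z| / 4 on the
    sector. *)
Lemma Re_sqrtc_ge z : sect z -> normc (sqrtc z) / 2 <= Re (sqrtc z).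
Proof.
move=> /sectP sz; rewrite Re_sqrtc.
have h : normc (sqrtc z) = Num.sqrt (normc z).
  rewrite -[in RHS](sqr_sqrtc z) normcX sqrtr_sqr ger0_norm//.
  exact: normc_ge0.
have -> : normc (sqrtc z) / 2 = Num.sqrt (normc z / 4).
  rewrite h sqrtrM ?normc_ge0//; congr (_ * _).
  have -> : (4^-1 : R) = 2^-1 ^+ 2 by field.
  by rewrite sqrtr_sqr ger0_norm// invr_ge0.
by apply: ler_wsqrtr; have := normc_ge0 z; lra.
Qed.

Lemma sect_Re_ge0 z : 0 <= Re z -> sect z.
Proof. by move=> h; apply/sectP; have := normc_ge0 z; lra. Qed.

Lemma sect_rt k z : sect z -> sect (rt k z).
Proof.
case: k => [//|k] _; rewrite /rt iterS; apply: sect_Re_ge0.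
by rewrite Re_sqrtc sqrtr_ge0.
Qed.

Lemma Re_rt_ge k z : sect z -> normc (rt k.+1 z) / 2 <= Re (rt k.+1 z).
Proof. by move=> sz; rewrite /rt iterS; exact/Re_sqrtc_ge/sect_rt. Qed.

Lemma rt_rtX j k z : (j <= k)%N -> rt k z ^+ (2 ^ j) = rt (k - j) z.
Proof.
move=> jk; rewrite -{1}(subnKC jk) /rt iterD -/(rt (k - j) z).
exact: rtX.
Qed.

(** The cofactor of z - w in z ^ (2 ^ k) - w ^ (2 ^ k), kept as a product so that each factor can be
    bounded below on its own. *)
Definition rtden k z w : R[i] :=
  \prod_(i < k) (z ^+ (2 ^ i) + w ^+ (2 ^ i)).

Lemma rtdenE k z w : z ^+ (2 ^ k) - w ^+ (2 ^ k) = (z - w) * rtden k z w.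
Proof.
rewrite /rtden; elim: k => [|k ih]; first by rewrite big_ord0 mulr1 !expr1.
by rewrite big_ord_recr /= mulrA -ih expnS mulnC !exprM subr_sqr.
Qed.

Lemma rtden_diag k z :
  rtden k z z = (2 ^ k)%:R * z ^+ (2 ^ k - 1).
Proof.
rewrite /rtden; elim: k => [|k ih]; first by rewrite big_ord0 mulr1.
rewrite big_ord_recr /= ih expnS mul2n -addnn natrD.
have -> : (2 ^ k + 2 ^ k - 1 = (2 ^ k - 1) + 2 ^ k)%N.
  by have := expn_gt0 2 k; lia.
by rewrite exprD; ring.
Qed.

Lemma prod_expr_expn2 k (M : R) : M ^+ (2 ^ k - 1) = \prod_(i < k) M ^+ (2 ^ i).
Proof.
elim: k => [|k ih]; first by rewrite big_ord0.
rewrite big_ord_recr /= -ih -exprD; congr (_ ^+ _).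
by rewrite expnS; have := expn_gt0 2 k; lia.
Qed.

(** There is no cancellation: each factor is a sum of two numbers whose real parts are at least half
    their moduli, hence is at least half the larger modulus. *)
Lemma rtden_ge k z w : sect z -> sect w ->
  (2^-1) ^+ k * Num.max (normc (rt k z)) (normc (rt k w)) ^+ (2 ^ k - 1)
    <= normc (rtden k (rt k z) (rt k w)).
Proof.
move=> sz sw; set a := rt k z; set b := rt k w.
set M := Num.max _ _.
have M0 : 0 <= M by rewrite le_max normc_ge0.
have factor (i : 'I_k) :
    2^-1 * M ^+ (2 ^ i) <= normc (a ^+ (2 ^ i) + b ^+ (2 ^ i)).
  have ik := ltn_ord i.
  (* The i-th factor is a sum of roots of order k - i >= 1, never of z and w themselves, so the
     half-angle bound applies to it. *)
  have ki : (k - i = (k - i.+1).+1)%N by rewrite subnSK.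
  have h x : sect x -> normc (rt k x ^+ (2 ^ i)) / 2 <= Re (rt k x ^+ (2 ^ i)).
    by move=> sx; rewrite (rt_rtX x (ltnW ik)) ki; exact: Re_rt_ge.
  have ha := h _ sz; have hb := h _ sw.
  have := Re_le_normc (a ^+ (2 ^ i) + b ^+ (2 ^ i)).
  rewrite cReD => /(le_trans (ler_norm _)).
  have na := normc_ge0 (a ^+ (2 ^ i)); have nb := normc_ge0 (b ^+ (2 ^ i)).
  move: ha hb; rewrite -/a -/b; rewrite /M /Num.max; case: ifP => _;
    rewrite -normcX; lra.
have -> : normc (rtden k a b) = \prod_(i < k) normc (a ^+ (2 ^ i) + b ^+ (2 ^ i)).
  rewrite /rtden; apply: (big_morph (@normc R)); first exact: normcM.
  exact: normc1.
have -> : (2^-1) ^+ k * M ^+ (2 ^ k - 1) = \prod_(i < k) (2^-1 * M ^+ (2 ^ i)).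
  rewrite big_split /= prodr_const card_ord; congr (_ * _).
  exact: prod_expr_expn2.
by apply: ler_prod => i _; rewrite factor mulr_ge0// ?invr_ge0// exprn_ge0.
Qed.

End roots.

Section power_quotients.
Variable R : realType.
Implicit Types (z w : R[i]) (k m : nat).

Lemma rtden_neq0 k z w : sect z -> sect w -> (z != 0) || (w != 0) ->
  rtden k (rt k z) (rt k w) != 0.
Proof.
move=> sz sw zw; rewrite -normc_gt0; apply: lt_le_trans (rtden_ge k sz sw).
rewrite mulr_gt0 ?exprn_gt0 ?invr_gt0// lt_max !normc_gt0.
by rewrite !rt_eq0.
Qed.

(* The junk value of the quotient at z = w = 0 is the correct one for
   [2 ^ k < m], [0 < k]. *)
Definition pq k m z w : R[i] :=
  (\sum_(i < m) rt k z ^+ (m.-1 - i) * rt k w ^+ i) / rtden k (rt k z) (rt k w).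

(** Writing z - w as the difference of the roots times [rtden] makes [pq k m] the divided difference
    of z ^ (m / 2 ^ k). On the sector [rtden] vanishes only at z = w = 0, where both sides are 0. *)
Lemma pqE k m z w : sect z -> sect w ->
  rt k z ^+ m - rt k w ^+ m = (z - w) * pq k m z w.
Proof.
move=> sz sw; have [zw|/negbTE zw] := boolP ((z != 0) || (w != 0)).
  have d0 := rtden_neq0 k sz sw zw.
  rewrite -{2}(rtX k z) -{2}(rtX k w) rtdenE /pq.
  rewrite subrXX; set S := \sum_(i < m) _; set a := rt k z; set b := rt k w.
  suff -> : a - b = (a - b) * rtden k a b / rtden k a b by field.
  by rewrite mulfK.
move: zw; rewrite -negb_and => /negbFE /andP[/eqP -> /eqP ->].
by rewrite !subrr mul0r.
Qed.

Lemma normc_sum_le (I : Type) (r : seq I) (P : pred I) (F : I -> R[i]) :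
  normc (\sum_(i <- r | P i) F i) <= \sum_(i <- r | P i) normc (F i).
Proof.
elim/big_rec2 : _ => [|i y z _ h]; first by rewrite normc0.
by rewrite (le_trans (le_normcD _ _))// lerD2l.
Qed.

(** The numerator is homogeneous of degree m - 1 in the roots, and the denominator is at least 2 ^
    -k times the power 2 ^ k - 1 of the larger modulus; the surplus degree is m - 2 ^ k. *)
Lemma normc_pq_le k m z w : sect z -> sect w -> (0 < k)%N -> (2 ^ k <= m)%N ->
  normc (pq k m z w) <= m%:R * 2 ^+ k *
    Num.max (normc (rt k z)) (normc (rt k w)) ^+ (m - 2 ^ k).
Proof.
move=> sz sw k0 km; set M := Num.max _ _.
have M0 : 0 <= M by rewrite le_max normc_ge0.
have k2 := expn_gt0 2 k.
have num : normc (\sum_(i < m) rt k z ^+ (m.-1 - i) * rt k w ^+ i) <=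
    m%:R * M ^+ m.-1.
  apply: le_trans (normc_sum_le _ _ _) _.
  rewrite [leRHS](_ : _ = \sum_(i < m) M ^+ m.-1); last first.
    by rewrite sumr_const card_ord mulr_natl.
  apply: ler_sum => i _; rewrite normcM !normcX.
  have -> : m.-1 = ((m.-1 - i) + i)%N by have := ltn_ord i; lia.
  rewrite exprD addnK; apply: ler_pM; rewrite ?exprn_ge0 ?normc_ge0//.
    by apply: lerXn2r; rewrite ?nnegrE ?normc_ge0// le_max lexx.
  by apply: lerXn2r; rewrite ?nnegrE ?normc_ge0// le_max lexx orbT.
have [zw|/negbTE zw] := boolP ((z != 0) || (w != 0)); last first.
  move: zw; rewrite -negb_and => /negbFE /andP[/eqP z0 /eqP w0].
  rewrite /pq z0 w0 !rt0 (_ : rtden k 0 0 = 0).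
    by rewrite invr0 mulr0 normc0 mulr_ge0// ?exprn_ge0// mulr_ge0// exprn_ge0.
  by case: k k0 {km M M0 k2 num} => // k _; rewrite /rtden big_ord_recl /= !expr1 addr0 mul0r.
have den := rtden_ge k sz sw; rewrite -/M in den.
have Mp : 0 < M.
  by rewrite lt_max !normc_gt0 !rt_eq0.
rewrite /pq normcM normcV ler_pdivrMr ?normc_gt0 ?rtden_neq0//.
apply: le_trans num _.
have -> : m%:R * M ^+ m.-1 = m%:R * 2 ^+ k * M ^+ (m - 2 ^ k) *
    (2^-1 ^+ k * M ^+ (2 ^ k - 1)).
  have -> : m.-1 = ((m - 2 ^ k) + (2 ^ k - 1))%N by lia.
  have : (2 ^+ k : R) != 0 by rewrite expf_neq0.
  by rewrite exprD exprVn => h; field.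
by rewrite ler_wpM2l// !mulr_ge0// ?exprn_ge0.
Qed.

(** On the diagonal the divided difference is the derivative of z ^ (m / 2 ^ k). *)
Lemma pq_diag k m z : (0 < m)%N -> (0 < k)%N -> (2 ^ k < m)%N ->
  pq k m z z = m%:R / (2 ^ k)%:R * rt k z ^+ (m - 2 ^ k).
Proof.
move=> m0 k0 km; have k2 := expn_gt0 2 k.
rewrite /pq rtden_diag.
under eq_bigr => i _.
  rewrite -exprD subnK; last by have := ltn_ord i; lia.
  over.
rewrite sumr_const card_ord.
have n0 : ((2 ^ k)%:R : R[i]) != 0 by rewrite pnatr_eq0 -lt0n.
(* At 0 the quotient is a division by zero, with value 0; the right-hand side is 0 as well because m
   > 2 ^ k. *)
have [->|z0] := eqVneq (rt k z) 0.
  have m1 : (m - 2 ^ k)%N != 0 by lia.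
  have n1 : (2 ^ k - 1 != 0)%N by have := ltn_expl k (isT : 1 < 2)%N; lia.
  by rewrite !expr0n (negbTE m1) (negbTE n1) !mulr0 invr0 mulr0.
have -> : m.-1 = ((m - 2 ^ k) + (2 ^ k - 1))%N by lia.
rewrite exprD -mulr_natl; field.
by rewrite n0 expf_neq0.
Qed.

Lemma normc_rt_iter k z : normc (rt k z) = iter k Num.sqrt (normc z).
Proof.
elim: k => [//|k ih]; rewrite /rt !iterS -/(rt k z) -ih.
by rewrite -[in RHS](sqr_sqrtc (rt k z)) normcX sqrtr_sqr ger0_norm ?normc_ge0.
Qed.

Section limits.
Variables (T : Type) (F : set_system T).
Context {FF : Filter F}.

(** At the branch point the modulus of the root is an iterated real square root, which tends to 0.
    Elsewhere the difference of the roots is f t - l divided by [rtden], which is bounded below by a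
    constant depending on l alone. *)
Lemma cvgc_rt k (f : T -> R[i]) l : sect l -> (\forall t \near F, sect (f t)) ->
  cvgc F f l -> cvgc F (fun t => rt k (f t)) (rt k l).
Proof.
move=> sl sf fl.
have [l0|l0] := eqVneq l 0.
  rewrite l0 rt0; apply: (@cvgc_squeeze _ _ F _ _ _ (fun t => iter k Num.sqrt (normc (f t)))).
    have /(_ FF) h := cvgc_normc fl; rewrite l0 normc0 in h.
    elim: k => [|k ih] /=; first exact: h.
    have := @continuous_cvg _ _ _ F _ _ Num.sqrt 0 (@sqrt_continuous R 0) ih.
    by rewrite sqrtr0 => h'; exact: h'.
  by apply: nearW => t; rewrite subr0 normc_rt_iter.
pose C := 2^-1 ^+ k * normc (rt k l) ^+ (2 ^ k - 1).
have C0 : 0 < C by rewrite mulr_gt0 ?exprn_gt0 ?invr_gt0// normc_gt0 rt_eq0.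
apply: (@cvgc_squeeze _ _ F _ _ _ (fun t => C^-1 * normc (f t - l))).
  by rewrite -(mulr0 C^-1); apply: cvgMr => //; exact: cvgc_dist.
apply: filterS sf => t st.
rewrite ler_pdivlMl//.
have -> : f t - l = (rt k (f t) - rt k l) * rtden k (rt k (f t)) (rt k l).
  by rewrite -rtdenE !rtX.
rewrite normcM mulrC ler_wpM2l ?normc_ge0//.
apply: le_trans (rtden_ge k st sl).
rewrite ler_wpM2l ?exprn_ge0 ?invr_ge0//.
by apply: lerXn2r; rewrite ?nnegrE ?le_max ?normc_ge0 ?lexx ?orbT.
Qed.

(** Joint continuity up to the branch point. Away from (0, 0) the quotient is continuous by
    composition; at (0, 0) it is squeezed by [normc_pq_le], with a positive exponent m - 2 ^ k. *)
Lemma cvgc_pq k m (f g : T -> R[i]) l l' : (0 < k)%N -> (2 ^ k < m)%N ->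
  sect l -> (\forall t \near F, sect (f t)) -> cvgc F f l ->
  sect l' -> (\forall t \near F, sect (g t)) -> cvgc F g l' ->
  cvgc F (fun t => pq k m (f t) (g t)) (pq k m l l').
Proof.
move=> k0 km sl sf fl sl' sg gl.
have cf := cvgc_rt k sl sf fl; have cg := cvgc_rt k sl' sg gl.
have [ll|/negbTE ll] := boolP ((l != 0) || (l' != 0)).
  apply: cvgcM.
    by apply: cvgc_sum => i _; apply: cvgcM; exact: cvgcX.
  apply: cvgcV; first exact: rtden_neq0.
  by apply: cvgc_prod => i _; apply: cvgcD; exact: cvgcX.
move: ll; rewrite -negb_and => /negbFE /andP[/eqP l0 /eqP l0'].
move: cf cg; rewrite l0 l0' rt0 => cf cg.
have m0 : (0 < m)%N by lia.
have mk : (m - 2 ^ k)%N != 0 by lia.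
rewrite pq_diag// rt0 expr0n (negbTE mk) mulr0.
apply: (@cvgc_squeeze _ _ F _ _ _ (fun t => m%:R * 2 ^+ k *
  (normc (rt k (f t)) + normc (rt k (g t))) ^+ (m - 2 ^ k))).
  rewrite -(mulr0 (m%:R * 2 ^+ k)); apply: cvgMr => //.
  have h : (fun t => normc (rt k (f t)) + normc (rt k (g t))) @ F --> (0:R).
    by rewrite -[X in _ --> X]addr0; apply: cvgD; rewrite -(normc0 R); exact: cvgc_normc.
  have := @continuous_cvg _ _ _ F _ _ (fun x : R => x ^+ (m - 2 ^ k)) 0
    (@exprn_continuous R (m - 2 ^ k) 0) h.
  by rewrite expr0n (negbTE mk) => h'; exact: h'.
near=> t; rewrite subr0.
have sft : sect (f t) by near: t.
have sgt : sect (g t) by near: t.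
apply: le_trans (normc_pq_le sft sgt k0 (ltnW km)) _.
rewrite ler_wpM2l ?mulr_ge0 ?exprn_ge0//.
have na := normc_ge0 (rt k (f t)); have nb := normc_ge0 (rt k (g t)).
apply: lerXn2r; rewrite ?nnegrE ?le_max ?na ?addr_ge0// ge_max.
by rewrite lerDl lerDr na nb.
Unshelve. all: by end_near. Qed.

End limits.

End power_quotients.

(** * Directional derivatives and finite differences *)

Section directional_derivatives.
Variables (R : realType) (V W : normedModType R).

Lemma is_derive_quotP (x v : V) (f : V -> W) (d : W) :
  is_derive x v f d <->
  (fun h : R => h^-1 *: (f (h *: v + x) - f x)) @ 0^' --> d.
Proof.
split=> [[fv <-]|fd]; first exact: fv.
by split; [exact: (cvgP _ fd)|exact/cvg_lim].
Qed.

End directional_derivatives.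

Section directional_derivatives_along.
Variables (R : realType) (V W : normedModType R).

Lemma is_derive_line (x v : V) (f : V -> W) (d : W) :
  is_derive x v f d <-> is_derive (0:R) 1 (fun h => f (h *: v + x)) d.
Proof.
rewrite !is_derive_quotP.
have -> : (fun h : R => h^-1 *: (f (h *: v + x) - f x)) =
    (fun h : R => h^-1 *: (f ((h * 1 + 0 : R) *: v + x) - f (0 *: v + x))).
  by rewrite funeqE => h; rewrite addr0 scale0r add0r mulr1.
exact: iff_refl.
Qed.

Lemma is_derive_along (x v : V) (f : V -> W) (t : R) (d : W) :
  is_derive (t *: v + x) v f d -> is_derive t 1 (fun h => f (h *: v + x)) d.
Proof.
move=> /is_derive_quotP h; apply/is_derive_quotP; apply: cvg_trans h.
apply: near_eq_cvg; apply: nearW => h /=.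
by rewrite scalerDl addrA [_%:A]mulr1.
Qed.

Lemma is_derive_caratheodory (x v : V) (f : V -> W) (q : R -> W) (d : W) :
  (\forall h \near (0:R), f (h *: v + x) - f x = h *: q h) ->
  q @ (0:R) --> d -> is_derive x v f d.
Proof.
move=> fq qd; apply/is_derive_quotP.
have : q @ 0^' --> d by apply: cvg_trans qd; apply: cvg_app; exact: cvg_within.
apply: cvg_trans; apply: near_eq_cvg; rewrite /nbhs/=.
near=> h; rewrite (_ : f _ - _ = h *: q h); last by near: h; exact: cvg_within.
rewrite scalerA mulVf ?scale1r//; near: h; exact: nbhs_dnbhs_neq.
Unshelve. all: by end_near. Qed.

Lemma cvg_line (x v : V) : (fun h : R => h *: v + x) @ (0:R) --> x.
Proof.
rewrite -[X in _ --> X]add0r -(scale0r v); apply: cvgD; last exact: cvg_cst.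
by apply: cvgZ; [exact: cvg_id|exact: cvg_cst].
Qed.

End directional_derivatives_along.

Lemma is_derive_chain (R : realType) (V : normedModType R) (x v : V)
    (f : V -> R) (g : R -> R) (d d' : R) :
  is_derive x v f d -> is_derive (f x) 1 g d' ->
  is_derive x v (g \o f) (d' * d).
Proof.
move=> /is_derive_line df dg; apply/is_derive_line.
have dg' : is_derive ((fun h => f (h *: v + x)) 0) 1 g d'.
  by rewrite scale0r add0r.
have d1 := @ex_derive _ _ _ _ _ _ _ df; have d2 := @ex_derive _ _ _ _ _ _ _ dg'.
split.
  have e1 := (derivable1_diffP _ _).1 d1; have e2 := (derivable1_diffP _ _).1 d2.
  apply: (derivable1_diffP _ _).2.
  exact: (@differentiable_comp _ _ _ _ _ _ _ e1 e2).
rewrite -derive1E derive1_comp// !derive1E.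
by rewrite (@derive_val _ _ _ _ _ _ _ df) (@derive_val _ _ _ _ _ _ _ dg').
Qed.

Section finite_differences.
Variables (R : realType) (V : normedModType R) (v : V).
Implicit Types (f : V -> R) (h : R) (x : V).

Definition dif h f : V -> R := fun x => f (h *: v + x) - f x.

Lemma mean_value_along f f' h x : 0 <= h ->
  (forall t, 0 <= t <= h -> is_derive (t *: v + x) v f (f' (t *: v + x))) ->
  exists2 t, 0 <= t <= h & f (h *: v + x) - f x = f' (t *: v + x) * h.
Proof.
move=> h0 df; pose g (t : R) := f (t *: v + x).
have dg t : t \in `[0, h] -> is_derive t 1 g (f' (t *: v + x)).
  by rewrite in_itv /= => th; apply: is_derive_along; exact: df.
have cg : {within `[0, h], continuous g}.
  apply: derivable_within_continuous => t th.
  exact: (@ex_derive _ _ _ _ _ _ _ (dg t th)).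
have dg' t : t \in `]0, h[ -> is_derive t 1 g (f' (t *: v + x)).
  by move=> th; apply: dg; exact: subset_itv_oo_cc th.
have [t] := MVT_segment h0 dg' cg.
rewrite in_itv /= subr0 /g scale0r add0r => th e.
by exists t.
Qed.

Lemma iter_dif_bounds (K : nat) (r : nat -> V -> R) x h (m M : R) : 0 <= h ->
  (forall j t, (j < K)%N -> 0 <= t <= K%:R * h ->
     is_derive (t *: v + x) v (r j) (r j.+1 (t *: v + x))) ->
  (forall t, 0 <= t <= K%:R * h -> m <= r K (t *: v + x) <= M) ->
  m * h ^+ K <= iter K (dif h) (r 0) x <= M * h ^+ K.
Proof.
move=> h0; elim: K r x m M => [|K ih] r x m M dr br.
  have := br 0; rewrite scale0r add0r mul0r lexx => /(_ isT).
  by rewrite !expr0 !mulr1.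
have Kh t : 0 <= t <= K%:R * h -> 0 <= t + h <= K.+1%:R * h.
  by rewrite -natr1 mulrDl mul1r; lra.
have Kt t : 0 <= t <= K%:R * h -> 0 <= t <= K.+1%:R * h.
  by rewrite -natr1 mulrDl mul1r; lra.
rewrite iterSr exprS !mulrA.
apply: (ih (fun j => dif h (r j)) x (m * h) (M * h)) => [j t jK tK|t tK].
  have d0 : is_derive (t *: v + x) v (r j) (r j.+1 (t *: v + x)).
    by apply: dr; [exact: ltnW|exact: Kt].
  have dj : is_derive ((t + h) *: v + x) v (r j) (r j.+1 ((t + h) *: v + x)).
    by apply: dr; [exact: ltnW|exact: Kh].
  suff d1 : is_derive (t *: v + x) v (fun y => r j (h *: v + y))
      (r j.+1 (h *: v + (t *: v + x))) by exact: is_deriveB d1 d0.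
  apply/is_derive_line; move/is_derive_line: dj.
  rewrite (_ : (fun k => r j (h *: v + (k *: v + (t *: v + x)))) =
    (fun k => r j (k *: v + ((t + h) *: v + x)))); last first.
    by apply/funext => k; congr (r j _); rewrite scalerDl addrCA -!addrA [h *: v + _]addrCA.
  by rewrite scalerDl -addrA [h *: v + _]addrCA.
have [|s sh e] := @mean_value_along (r K) (r K.+1) h (t *: v + x) h0.
  move=> s sh; rewrite addrA -scalerDl; apply: dr => //.
  by move: (Kt _ tK) (Kh _ tK); lra.
rewrite /dif e addrA -scalerDl.
have /br : 0 <= s + t <= K.+1%:R * h by move: (Kt _ tK) (Kh _ tK); lra.
by move=> /andP[b1 b2]; rewrite !ler_wpM2r.
Qed.

Lemma iter_dif_le (K : nat) (r : nat -> V -> R) x h (M : R) : 0 <= h ->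
  (forall j t, (j < K)%N -> 0 <= t <= K%:R * h ->
     is_derive (t *: v + x) v (r j) (r j.+1 (t *: v + x))) ->
  (forall t, 0 <= t <= K%:R * h -> `|r K (t *: v + x)| <= M) ->
  `|iter K (dif h) (r 0) x| <= M * h ^+ K.
Proof.
move=> h0 dr br; rewrite ler_norml -mulNr; apply: iter_dif_bounds => //.
by move=> t /br; rewrite ler_norml.
Qed.

Lemma eq_iter_dif (K : nat) f g x h :
  (forall j, (j <= K)%N -> f ((j%:R * h) *: v + x) = g ((j%:R * h) *: v + x)) ->
  iter K (dif h) f x = iter K (dif h) g x.
Proof.
elim: K x => [|K ih] x fg.
  by have := fg 0%N isT; rewrite mul0r scale0r add0r.
rewrite !iterS /dif; congr (_ - _); apply: ih => j jK.
  have := fg j.+1 jK; rewrite -natr1 mulrDl mul1r scalerDl -addrA.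
  by [].
exact/fg/ltnW.
Qed.

Lemma iter_difD (K : nat) f g x h :
  iter K (dif h) (fun y => f y + g y) x = iter K (dif h) f x + iter K (dif h) g x.
Proof.
elim: K x => [//|K ih] x; rewrite !iterS /dif !ih; ring.
Qed.

Lemma iter_difZ (K : nat) (c : R) f x h :
  iter K (dif h) (fun y => c * f y) x = c * iter K (dif h) f x.
Proof. by elim: K x => [//|K ih] x; rewrite !iterS /dif !ih mulrBr. Qed.

Lemma iter_dif_sup (K : nat) f x h (M : R) :
  (forall j, (j <= K)%N -> `|f ((j%:R * h) *: v + x)| <= M) ->
  `|iter K (dif h) f x| <= 2 ^+ K * M.
Proof.
elim: K x => [|K ih] x fM.
  by have := fM 0%N isT; rewrite mul0r scale0r add0r expr0 mul1r.
rewrite iterS /dif exprS -mulrA mulr_natl mulr2n.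
apply: le_trans (ler_normB _ _) _; apply: lerD; apply: ih => j jK.
  have := fM j.+1 jK; rewrite -natr1 mulrDl mul1r scalerDl -addrA.
  by [].
exact/fM/ltnW.
Qed.

End finite_differences.

Lemma cvgc_neq0 (R : realType) (T : Type) (F : set_system T) (FF : Filter F)
    (f : T -> R[i]) l :
  cvgc F f l -> l != 0 -> \forall t \near F, f t != 0.
Proof.
move=> fl l0.
have h : (fun t => normc (f t)) @ F --> normc l by exact: cvgc_normc.
have : \forall t \near F, normc (f t) != 0.
  by apply: cvgr_neq0 h _; rewrite gt_eqF ?normc_gt0.
apply: filterS => t.
by apply: contraNneq => ->; rewrite normc0.
Qed.

(** * Complex derivatives of functions on the plane *)

Section complex_derivative.
Variable R : realType.
Implicit Types (f g : R * R -> R[i]) (x v : R * R).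

(** Caratheodory's form: the difference quotient is a function continuous at x. The rules for
    products and inverses become identities between quotients. *)
Definition cderiv f x (l : R[i]) := exists Q : R * R -> R[i],
  (\forall y \near x, f y - f x = cx (y - x) * Q y) /\ cvgc (nbhs x) Q l.

Lemma cderiv_cvg f x l : cderiv f x l -> cvgc (nbhs x) f (f x).
Proof.
move=> [Q [fQ Ql]].
apply: (@near_eq_cvgc _ _ _ _ (fun y => f x + cx (y - x) * Q y)).
  by apply: filterS fQ => y <-; rewrite addrC subrK.
rewrite -[X in cvgc _ _ X]addr0 -(mul0r l); apply: cvgcD; first exact: cvgc_cst.
apply: cvgcM => //; rewrite -(subrr (cx x)).
exact: (cvgcB (cvgc_cx x) (cvgc_cst (cx x))).
Qed.

Lemma cderiv_cst c x : cderiv (fun=> c) x 0.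
Proof.
exists (fun=> 0); split; last exact: cvgc_cst.
by apply: (@filterE _ (nbhs x)) => y; rewrite subrr mulr0.
Qed.

Lemma cderiv_cx x : cderiv (@cx R) x 1.
Proof.
exists (fun=> 1); split; last exact: cvgc_cst.
by apply: (@filterE _ (nbhs x)) => y; rewrite mulr1 cxB.
Qed.

Lemma cderivD f g x l m :
  cderiv f x l -> cderiv g x m -> cderiv (fun y => f y + g y) x (l + m).
Proof.
move=> [P [fP Pl]] [Q [gQ Qm]]; exists (fun y => P y + Q y); split.
  by apply: filterS2 fP gQ => y fP gQ; rewrite mulrDr -fP -gQ; ring.
exact: cvgcD.
Qed.

Lemma cderivM f g x l m : cderiv f x l -> cderiv g x m ->
  cderiv (fun y => f y * g y) x (l * g x + f x * m).
Proof.
move=> df [Q [gQ Qm]]; have fx := cderiv_cvg df; move: df => [P [fP Pl]].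
exists (fun y => P y * g x + f y * Q y); split.
  apply: filterS2 fP gQ => y fP gQ; rewrite mulrDr mulrA -fP mulrCA -gQ; ring.
apply: cvgcD; last exact: cvgcM.
by apply: cvgcM => //; exact: cvgc_cst.
Qed.

Lemma cderivN f x l : cderiv f x l -> cderiv (fun y => - f y) x (- l).
Proof.
move=> [P [fP Pl]]; exists (fun y => - P y); split; last exact: cvgcN.
by apply: filterS fP => y fP; rewrite mulrN -fP opprB opprK addrC.
Qed.

Lemma cderivB f g x l m :
  cderiv f x l -> cderiv g x m -> cderiv (fun y => f y - g y) x (l - m).
Proof. by move=> df dg; apply: cderivD => //; exact: cderivN. Qed.

Lemma cderivZ c f x l : cderiv f x l -> cderiv (fun y => c * f y) x (c * l).
Proof.
by move=> df; have := cderivM (cderiv_cst c x) df; rewrite mul0r add0r.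
Qed.

Lemma cderivX f x l n : cderiv f x l ->
  cderiv (fun y => f y ^+ n) x (n%:R * f x ^+ n.-1 * l).
Proof.
move=> df; elim: n => [|n ih].
  by rewrite mul0r mul0r; exact: cderiv_cst.
have := cderivM df ih.
rewrite (_ : l * f x ^+ n + _ = n.+1%:R * f x ^+ n.+1.-1 * l).
  suff -> : (fun y => f y * f y ^+ n) = (fun y => f y ^+ n.+1) by [].
  by apply/funext => y; rewrite exprS.
case: n {ih} => [|n] /=; first by rewrite expr0; ring.
by rewrite -[n.+2%:R]natr1 !exprS; ring.
Qed.

Lemma cderivV f x l : f x != 0 -> cderiv f x l ->
  cderiv (fun y => (f y)^-1) x (- l / f x ^+ 2).
Proof.
move=> fx0 df; have fx := cderiv_cvg df; case: df => P [fP Pl].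
have fy0 : \forall y \near x, f y != 0 by exact: cvgc_neq0 fx fx0.
exists (fun y => - P y / (f y * f x)); split.
  apply: filterS (filterI fP fy0) => y [{}fP {}fy0].
  rewrite mulrA mulrN -fP; field.
  by rewrite fx0.
rewrite expr2; apply: cvgcM; first exact: cvgcN.
apply: cvgcV; first by rewrite mulf_neq0.
by apply: cvgcM => //; exact: cvgc_cst.
Qed.

Lemma cderiv_Re f x v l : cderiv f x l ->
  is_derive x v (fun y => Re (f y)) (Re (cx v * l)).
Proof.
move=> [Q [fQ Ql]].
apply: (@is_derive_caratheodory _ _ _ _ _ _ (fun h => Re (cx v * Q (h *: v + x)))).
  have fQ' : \forall h \near (0:R),
      f (h *: v + x) - f x = cx (h *: v + x - x) * Q (h *: v + x).
    exact: (@cvg_line _ _ x v _ fQ).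
  apply: filterS fQ' => h e.
  rewrite -cReN -cReD e addrK cxZ -mulrA Re_mulr_real.
  by [].
have [h _] : cvgc (nbhs x) (fun y => cx v * Q y) (cx v * l).
  by apply: cvgcM => //; exact: cvgc_cst.
exact: (cvg_comp _ _ (@cvg_line _ _ x v) h).
Qed.

Lemma cderiv_Im f x v l : cderiv f x l ->
  is_derive x v (fun y => Im (f y)) (Im (cx v * l)).
Proof.
move=> df; have := cderiv_Re v (cderivZ (Complex 0 (-1)) df).
have E (z : R[i]) : Re (Complex 0 (-1) * z) = Im z by case: z => a b /=; ring.
by under eq_fun do rewrite E; rewrite mulrCA E.
Qed.

(** This is the real part of f' / f along v. Differentiating half of ln (u ^ 2 + w ^ 2), with f = u
    + i w, avoids choosing a branch of the logarithm. *)
Lemma is_derive_ln_normc f x v l : f x != 0 -> cderiv f x l ->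
  is_derive x v (fun y => ln (normc (f y))) (Re (cx v * (l / f x))).
Proof.
move=> fx0 df.
have n0 : 0 < normc (f x) ^+ 2 by rewrite exprn_gt0// normc_gt0.
have d1 := cderiv_Re v df; have d2 := cderiv_Im v df.
pose u y := Re (f y); pose w y := Im (f y).
have E : (fun y => ln (normc (f y))) = 2^-1 \*: (@ln R \o (u ^+ 2 + w ^+ 2)).
  apply/funext => y; rewrite -[RHS]/(2^-1 * ln (u y ^+ 2 + w y ^+ 2)) /u /w.
  (* The identity holds at zeros of f too, since [ln 0] is 0. *)
  rewrite -normc_sqr; have [->|fy0] := eqVneq (f y) 0.
    by rewrite normc0 expr0n /= !ln0// mulr0.
  by rewrite lnXn ?normc_gt0// mulr2n; field.
have nn : u x ^+ 2 + w x ^+ 2 != 0 by rewrite /u /w -normc_sqr gt_eqF.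
have du : is_derive x v (u ^+ 2 + w ^+ 2)
    (2 * u x * Re (cx v * l) + 2 * w x * Im (cx v * l)).
  have e1 := @is_deriveX _ _ u 2 x v _ d1; have e2 := @is_deriveX _ _ w 2 x v _ d2.
  by have e3 := is_deriveD e1 e2; apply: is_derive_eq e3 _; rewrite /= !expr1.
have dln : is_derive ((u ^+ 2 + w ^+ 2) x) 1 (@ln R) (u x ^+ 2 + w x ^+ 2)^-1.
  by apply: is_derive1_ln; rewrite -[X in _ < X]/(u x ^+ 2 + w x ^+ 2) /u /w -normc_sqr.
have d3 := @is_deriveZ _ _ _ _ 2^-1 _ _ _ (is_derive_chain du dln).
rewrite E; apply: is_derive_eq d3 _.
rewrite !cReM !cImM cReV cImV /GRing.scale /=.
rewrite -/(u x) -/(w x); field.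
exact: nn.
Qed.

End complex_derivative.

(** * Holomorphic functions *)

Section holomorphic.
Variables (R : realType) (O : set (R * R)).
Implicit Types (f g : R * R -> R[i]) (n : nat).

(** Continuous complex differentiability of order n: the order is carried along explicitly, and two
    orders give a harmonic logarithm. *)
Fixpoint holo n f : Prop :=
  if n is n'.+1 then
    exists2 f', (forall x, O x -> cderiv f x (f' x)) & holo n' f'
  else forall x, O x -> cvgc (nbhs x) f (f x).

Lemma holo0 n f : holo n f -> forall x, O x -> cvgc (nbhs x) f (f x).
Proof. by case: n => [//|n] [f' ff' _] x Ox; exact/cderiv_cvg/ff'. Qed.

Lemma holoW n f : holo n.+1 f -> holo n f.
Proof.
elim: n f => [|n ih] f hf; first exact: holo0 hf.
by case: hf => f' ff' /ih hf'; exists f'.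
Qed.

Lemma holo_cst n c : holo n (fun=> c).
Proof.
elim: n c => [|n ih] c /=; first by move=> x _; exact: cvgc_cst.
by exists (fun=> 0) => // x _; exact: cderiv_cst.
Qed.

Lemma holo_cx n : holo n (@cx R).
Proof.
case: n => [|n] /=; first by move=> x _; exact: cvgc_cx.
by exists (fun=> 1); [move=> x _; exact: cderiv_cx|exact: holo_cst].
Qed.

Lemma holoD n f g : holo n f -> holo n g -> holo n (fun y => f y + g y).
Proof.
elim: n f g => [|n ih] f g.
  by move=> hf hg x Ox; apply: cvgcD; [exact: hf|exact: hg].
move=> [f' ff' hf'] [g' gg' hg']; exists (fun y => f' y + g' y); last exact: ih.
by move=> x Ox; apply: cderivD; [exact: ff'|exact: gg'].
Qed.

Lemma holoM n f g : holo n f -> holo n g -> holo n (fun y => f y * g y).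
Proof.
elim: n f g => [|n ih] f g.
  by move=> hf hg x Ox; apply: cvgcM; [exact: hf|exact: hg].
move=> hf hg; have hf1 := holoW hf; have hg1 := holoW hg.
case: hf => f' ff' hf'; case: hg => g' gg' hg'.
exists (fun y => f' y * g y + f y * g' y).
  by move=> x Ox; apply: cderivM; [exact: ff'|exact: gg'].
by apply: holoD; exact: ih.
Qed.

Lemma holoV n f : (forall x, O x -> f x != 0) -> holo n f ->
  holo n (fun y => (f y)^-1).
Proof.
move=> f0; elim: n => [|n ih].
  by move=> hf x Ox; apply: cvgcV; [exact: f0|exact: hf].
move=> hf; have hf1 := holoW hf; case: hf => f' ff' hf'.
exists (fun y => -1 * f' y * ((f y)^-1 * (f y)^-1)).
  move=> x Ox; have := cderivV (f0 _ Ox) (ff' _ Ox).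
  by rewrite mulN1r expr2 invfM.
apply: holoM; last by apply: holoM; exact: ih.
by apply: holoM => //; exact: holo_cst.
Qed.

Lemma holoX n m f : holo n f -> holo n (fun y => f y ^+ m).
Proof.
move=> hf; elim: m => [|m ih]; first exact: holo_cst.
suff -> : (fun y => f y ^+ m.+1) = (fun y => f y * f y ^+ m) by exact: holoM.
by apply/funext => y; rewrite exprS.
Qed.

Lemma holo_sum n (I : Type) (r : seq I) (f : I -> R * R -> R[i]) :
  (forall i, holo n (f i)) -> holo n (fun y => \sum_(i <- r) f i y).
Proof.
move=> hf; elim: r => [|i r ih].
  rewrite (_ : (fun y => _) = (fun=> 0)); first exact: holo_cst.
  by apply/funext => y; rewrite big_nil.
rewrite (_ : (fun y => _) = (fun y => f i y + \sum_(j <- r) f j y)).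
  exact: holoD.
by apply/funext => y; rewrite big_cons.
Qed.

Lemma holo_prod n (I : Type) (r : seq I) (f : I -> R * R -> R[i]) :
  (forall i, holo n (f i)) -> holo n (fun y => \prod_(i <- r) f i y).
Proof.
move=> hf; elim: r => [|i r ih].
  rewrite (_ : (fun y => _) = (fun=> 1)); first exact: holo_cst.
  by apply/funext => y; rewrite big_nil.
rewrite (_ : (fun y => _) = (fun y => f i y * \prod_(j <- r) f j y)).
  exact: holoM.
by apply/funext => y; rewrite big_cons.
Qed.

Definition edir (i : 'I_2) : R[i] := cx (basis2 R i).

(* [L] has complex derivative [g], in the sense that [L] is locally the real
   part of a primitive of [g]. *)
Lemma harmonic_of_gradient (L : R * R -> R) g : open O ->
  (forall x, O x -> {for x, continuous L}) ->
  (forall x v, O x -> is_derive x v L (Re (cx v * g x))) ->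
  holo 1 g -> harmonic_on O L.
Proof.
move=> oO cL dL [g' gg' hg'].
have nO x : O x -> \forall y \near x, O y.
  by move=> Ox; exact: open_nbhs_nbhs.
have P1 i x : O x -> pderiv i L x = Re (edir i * g x).
  by move=> Ox; exact: (@derive_val _ _ _ _ _ _ _ (dL x (basis2 R i) Ox)).
have nP1 i x : O x -> \forall y \near x, Re (edir i * g y) = pderiv i L y.
  by move=> Ox; apply: filterS (nO x Ox) => y Oy; rewrite P1.
have dP1 i j x : O x -> is_derive x (basis2 R j) (pderiv i L)
    (Re (edir j * (edir i * g' x))).
  move=> Ox; apply: near_eq_is_derive (nP1 i x Ox) _.
  by apply: cderiv_Re; apply: cderivZ; exact: gg'.
have P2 i j x : O x -> pderiv j (pderiv i L) x = Re (edir j * (edir i * g' x)).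
  by move=> Ox; exact: (@derive_val _ _ _ _ _ _ _ (dP1 i j x Ox)).
have nP2 i j x : O x ->
    \forall y \near x, Re (edir j * (edir i * g' y)) = pderiv j (pderiv i L) y.
  by move=> Ox; apply: filterS (nO x Ox) => y Oy; rewrite P2.
split; last first.
  move=> x Ox; rewrite /laplacian big_ord_recl big_ord1 /= !P2//.
  rewrite (_ : edir (lift _ _) = Complex 0 1)// (_ : edir ord0 = 1)//.
  by case: (g' x) => a b /=; ring.
split.
  move=> s j x; case: s => [|i [|l s]]; last by move=> h; exfalso; move: h; case: (size s).
    move=> _ Ox; exact: (@ex_derive _ _ _ _ _ _ _ (dL x (basis2 R j) Ox)).
  move=> _ Ox; exact: (@ex_derive _ _ _ _ _ _ _ (dP1 i j x Ox)).
have cg x : O x -> cvgc (nbhs x) g (g x).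
  by move=> Ox; exact/cderiv_cvg/gg'.
have near_cont (u w : R * R -> R) x :
    (\forall y \near x, u y = w y) -> {for x, continuous u} -> {for x, continuous w}.
  move=> uw cu; have uwx : u x = w x := nbhs_singleton uw.
  rewrite /prop_for /continuous_at -uwx.
  by apply: cvg_trans cu; apply: near_eq_cvg; apply: filterS uw => y /= ->.
move=> s x; case: s => [|i [|j [|l s]]]; last by move=> h; exfalso; move: h; case: (size s).
- by move=> _; exact: cL.
- move=> _ Ox.
  apply: near_cont (nP1 i x Ox) _.
  have [//] : cvgc (nbhs x) (fun y => edir i * g y) (edir i * g x).
  by apply: cvgcM; [exact: cvgc_cst|exact: cg].
- move=> _ Ox.
apply: near_cont (nP2 j i x Ox) _.
have [//] : cvgc (nbhs x) (fun y => edir i * (edir j * g' y)) (edir i * (edir j * g' x)).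
by apply: cvgcM; [exact: cvgc_cst|apply: cvgcM; [exact: cvgc_cst|exact: hg']].
Qed.

Lemma continuous_ln_normc f x : f x != 0 -> cvgc (nbhs x) f (f x) ->
  {for x, continuous (fun y => ln (normc (f y)))}.
Proof.
move=> fx0 cf.
have h : normc (f y) @[y --> x] --> normc (f x) by exact: cvgc_normc.
have := @continuous_cvg _ _ _ _ _ _ (@ln R) _ (@continuous_ln R _ _) h.
by apply; rewrite normc_gt0.
Qed.

Lemma harmonic_ln_normcB f g (c : R) : open O ->
  (forall x, O x -> f x != 0) -> (forall x, O x -> g x != 0) ->
  holo 2 f -> holo 2 g ->
  harmonic_on O (fun x => c * (ln (normc (f x)) - ln (normc (g x)))).
Proof.
move=> oO f0 g0 hf hg; have [f' ff' hf'] := hf; have [g' gg' hg'] := hg.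
pose G x := (c%:C)%C * (f' x * (f x)^-1 + -1 * (g' x * (g x)^-1)).
apply: (@harmonic_of_gradient _ G) => //.
- move=> x Ox; have cf := holo0 hf Ox; have cg := holo0 hg Ox.
  apply: cvgM; first exact: cvg_cst.
  apply: cvgB; [exact: continuous_ln_normc (f0 _ Ox) cf|].
  exact: continuous_ln_normc (g0 _ Ox) cg.
- move=> x v Ox.
  have d1 := is_derive_ln_normc v (f0 _ Ox) (ff' _ Ox).
  have d2 := is_derive_ln_normc v (g0 _ Ox) (gg' _ Ox).
  have d3 := @is_deriveZ _ _ _ _ c _ _ _ (is_deriveB d1 d2).
  apply: is_derive_eq d3 _; rewrite /G [in RHS]mulrCA Re_mulr_real; congr (_ * _).
  by rewrite -cReN -cReD; congr Re; ring.
- apply: holoM; first exact: holo_cst.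
  have hfW := holoW hf; have hgW := holoW hg.
  apply: holoD; first by apply: holoM => //; exact: holoV.
  apply: holoM; first exact: holo_cst.
  by apply: holoM => //; exact: holoV.
Qed.

End holomorphic.

(** * The domain *)

Section complex_inequalities.
Variable R : realType.
Implicit Types z w : R[i].

Lemma cconjD z w : conjc (z + w) = conjc z + conjc w.
Proof. exact: rmorphD. Qed.

Lemma cconjM z w : conjc (z * w) = conjc z * conjc w.
Proof. exact: rmorphM. Qed.

Lemma Re_ge_dist z w : Re w - normc (z - w) <= Re z.
Proof.
have := Re_le_normc (z - w); rewrite cReD cReN => h.
by have := ler_norm (Re w - Re z); rewrite distrC; lra.
Qed.

Lemma normcB_sqr z w :
  normc z ^+ 2 - normc w ^+ 2 = Re ((z - w) * conjc (z + w)).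
Proof. by rewrite !normc_sqr; case: z w => a b [c d] /=; ring. Qed.

Lemma Re_mul_conj z : Re (z * conjc z) = normc z ^+ 2.
Proof. by rewrite normc_sqr; case: z => a b /=; ring. Qed.

Lemma le_normc_trans z w u : normc (z - w) <= normc (z - u) + normc (u - w).
Proof. by rewrite (_ : z - w = (z - u) + (u - w)) ?le_normcD//; ring. Qed.

End complex_inequalities.

Section domain.
Variables (R : realType) (k a : nat).
Hypotheses (k0 : (0 < k)%N) (ka : (2 * 2 ^ k <= a)%N).
Implicit Types (z w : R[i]) (x y : R * R).

(** Small enough for [PQ] - 1, Phi' - 1 and Phi'' all to be at most 1/100 in modulus: a 2 ^ k 3 ^ a
    bounds the divided difference of z ^ alpha on |z| <= 3, and the second factor a serves the
    second derivative. *)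
Definition ccoef : R := (100 * a%:R ^+ 2 * 2 ^+ k * 3 ^+ a)^-1.

Definition Phi z : R[i] := z + (ccoef%:C)%C * rt k z ^+ a.

(** The divided difference of [Phi], see [PhiE]; it stays within 1/100 of 1, so [Phi] is injective
    on the sector cut at radius 3. *)
Definition PQ z w : R[i] := 1 + (ccoef%:C)%C * pq k a z w.

Lemma a_gt0 : (0 < a)%N.
Proof. by have := expn_gt0 2 k; lia. Qed.

Lemma expn2k_lt : (2 ^ k < a)%N.
Proof. by have := expn_gt0 2 k; lia. Qed.

Lemma ccoef_gt0 : 0 < ccoef.
Proof. by rewrite invr_gt0 !mulr_gt0 ?exprn_gt0// ltr0n a_gt0. Qed.

Lemma ccoef_le (t : R) : t <= a%:R ^+ 2 * 2 ^+ k * 3 ^+ a -> ccoef * t <= 100^-1.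
Proof.
move=> h; rewrite mulrC ler_pdivrMr; last first.
  by rewrite !mulr_gt0 ?exprn_gt0// ltr0n a_gt0.
by rewrite [leRHS](_ : _ = a%:R ^+ 2 * 2 ^+ k * 3 ^+ a)//; field.
Qed.

Lemma normc_rt_le3 z : normc z <= 3 -> normc (rt k z) <= 3.
Proof.
move=> z3; rewrite leNgt; apply/negP => h.
have : normc (rt k z) <= normc (rt k z) ^+ (2 ^ k).
  by apply: ler_eXnr; [rewrite expn_gt0|lra].
by rewrite normc_rt; lra.
Qed.

Lemma normc_rtX_le3 z m : normc z <= 3 -> (m <= a)%N ->
  normc (rt k z) ^+ m <= 3 ^+ a.
Proof.
move=> z3 ma; apply: (@le_trans _ _ (3 ^+ m)).
  by apply: lerXn2r; rewrite ?nnegrE ?normc_ge0// normc_rt_le3.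
by apply: ler_weXn2l => //; lra.
Qed.

Lemma PhiE z w : sect z -> sect w -> Phi z - Phi w = (z - w) * PQ z w.
Proof.
move=> sz sw; rewrite /Phi /PQ mulrDr mulr1 mulrCA -pqE//; ring.
Qed.

Lemma PQ_near z w : sect z -> sect w -> normc z <= 3 -> normc w <= 3 ->
  normc (PQ z w - 1) <= 100^-1.
Proof.
move=> sz sw z3 w3; rewrite /PQ addrAC subrr add0r normcM normc_real.
rewrite ger0_norm ?(ltW ccoef_gt0)//.
apply: le_trans (ler_wpM2l (ltW ccoef_gt0) _) (ccoef_le (lexx _)).
apply: le_trans (normc_pq_le sz sw k0 (ltnW expn2k_lt)) _.
apply: ler_pM; rewrite ?mulr_ge0 ?exprn_ge0 ?le_max ?normc_ge0//.
  rewrite ler_wpM2r ?exprn_ge0// expr2 ler_peMl// ler1n; exact: a_gt0.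
by rewrite /Num.max; case: ifP => _; apply: normc_rtX_le3 => //; exact: leq_subr.
Qed.

Lemma Phi0 : Phi 0 = 0.
Proof. by rewrite /Phi rt0 expr0n (gtn_eqF a_gt0) mulr0 addr0. Qed.

Lemma Phi_near z : sect z -> normc z <= 3 ->
  normc (Phi z - z) <= 100^-1 * normc z.
Proof.
move=> sz z3.
have -> : Phi z - z = z * (PQ z 0 - 1).
  by rewrite mulrBr mulr1 -{3}(subr0 z) -PhiE ?sect0// Phi0 subr0.
rewrite normcM mulrC ler_wpM2r ?normc_ge0// PQ_near ?sect0//.
by rewrite normc0.
Qed.

(* [PP z w] is the divided difference of [|Phi - 1|^2], in the sense of
   [Phi_sqrB]. *)
Definition PP z w := PQ z w * conjc ((Phi z - 1) + (Phi w - 1)).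

Lemma Phi_sqrB z w : sect z -> sect w ->
  normc (Phi z - 1) ^+ 2 - normc (Phi w - 1) ^+ 2 = Re ((z - w) * PP z w).
Proof.
move=> sz sw; rewrite normcB_sqr /PP mulrA -PhiE//.
by congr (Re (_ * _)); ring.
Qed.

(** For the identity in place of [Phi] the quantity is exactly the conjugate of (z - 1) + (w - 1).
    Replacing [Phi] by the identity costs 6/100, replacing [PQ] by 1 costs 9/100. *)
Lemma PP_near z w : sect z -> sect w -> normc z <= 3 -> normc w <= 3 ->
  normc (PP z w - conjc ((z - 1) + (w - 1))) <= 6^-1.
Proof.
move=> sz sw z3 w3; rewrite /PP; set s := (Phi z - 1) + _; set r := (z - 1) + _.
have h1 := Phi_near sz z3; have h2 := Phi_near sw w3.
have sr : normc (s - r) <= 100^-1 * 6.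
  have -> : s - r = (Phi z - z) + (Phi w - w) by rewrite /s /r; ring.
  by apply: le_trans (le_normcD _ _) _; lra.
have r8 : normc r <= 8.
  rewrite /r (_ : _ + _ = z + w + (- 2)); last by ring.
  apply: le_trans (le_normcD _ _) _; rewrite normcN.
  have -> : normc (2 : R[i]) = 2 by rewrite (_ : 2 = (2%:C)%C) ?normc_real ?ger0_norm// rmorphMn.
  by have := le_normcD z w; lra.
have s9 : normc s <= 9.
  by have := le_normcD (s - r) r; rewrite subrK; lra.
have -> : PQ z w * conjc s - conjc r = (PQ z w - 1) * conjc s + conjc (s - r).
  by rewrite rmorphB /=; ring.
apply: le_trans (le_normcD _ _) _; rewrite normcM !normc_conj.
have : normc (PQ z w - 1) * normc s <= 100^-1 * 9.
  by apply: ler_pM; rewrite ?normc_ge0//; exact: PQ_near.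
by lra.
Qed.

(** The sector keeps away from the branch cut and the radius 3 keeps [Phi] close to the identity.
    Neither cuts the preimage of the disc: by [sect_Phi_le] points with |Phi - 1| <= 1 lie strictly
    inside both, apart from the vertex 0 of the sector, which is not in the domain. *)
Definition dom : set (R * R) :=
  [set x | [/\ sect (cx x), normc (cx x) <= 3 & normc (Phi (cx x) - 1) < 1]].

Lemma normcB1_le1 z : normc (z - 1) <= 1 -> 0 <= Re z.
Proof.
move=> h; have : normc (z - 1) ^+ 2 <= 1 by rewrite expr_le1// normc_ge0.
rewrite normc_sqr cReD cReN cImD cImN /= oppr0 addr0.
by have := sqr_ge0 (Im z); have := sqr_ge0 (Re z); nra.
Qed.

(** A point of the closed disc around 1 has real part >= 0 and modulus <= 2, and [Phi] moves z by at
    most |z| / 100. *)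
Lemma sect_Phi_le z : sect z -> normc z <= 3 -> normc (Phi z - 1) <= 1 ->
  - (100^-1 * normc z) <= Re z /\ normc z <= 5/2.
Proof.
move=> sz z3 Pz; have h := Phi_near sz z3; split.
  have := normcB1_le1 Pz; have := Re_ge_dist z (Phi z).
  by rewrite normcB_sym; lra.
have := le_normcD (z - Phi z) (Phi z); rewrite subrK (normcB_sym z).
have := le_normcD (Phi z - 1) 1; rewrite subrK normc1; lra.
Qed.

Lemma domP x : dom x -> [/\ cx x != 0, - (100^-1 * normc (cx x)) <= Re (cx x) &
  normc (cx x) <= 5/2].
Proof.
move=> [sx x3 Px]; have [h1 h2] := sect_Phi_le sx x3 (ltW Px); split => //.
by apply: contraTneq Px => ->; rewrite Phi0 sub0r normcN normc1 ltxx.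
Qed.

Lemma near_sect x : - (normc (cx x) / 2) < Re (cx x) ->
  \forall y \near x, sect (cx y).
Proof.
move=> h; have c1 : normc (cx y) @[y --> x] --> normc (cx x).
  by apply: cvgc_normc; exact: cvgc_cx.
have [c2 _] := cvgc_cx x.
have : (fun y => Re (cx y) + normc (cx y) / 2) @ x --> Re (cx x) + normc (cx x) / 2.
  by apply: cvgD => //; apply: cvgM => //; exact: cvg_cst.
move=> /cvgr_gt /(_ 0) h'.
have : \forall y \near x, 0 < Re (cx y) + normc (cx y) / 2 by apply: h'; lra.
by apply: filterS => y hy; apply/sectP; lra.
Qed.

Lemma dom_near_sect x : dom x -> \forall y \near x, sect (cx y).
Proof.
move=> dx; have [x0 h _] := domP dx; apply: near_sect.
by move: x0; rewrite -normc_gt0; lra.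
Qed.

Lemma cvgc_Phi (T : Type) (F : set_system T) (FF : Filter F) (f : T -> R[i]) l :
  sect l -> (\forall t \near F, sect (f t)) -> cvgc F f l ->
  cvgc F (fun t => Phi (f t)) (Phi l).
Proof.
move=> sl sf fl; apply: cvgcD => //; apply: cvgcM; first exact: cvgc_cst.
by apply: cvgcX; exact: cvgc_rt.
Qed.

Lemma cvgc_PQ (T : Type) (F : set_system T) (FF : Filter F) (f g : T -> R[i]) l l' :
  sect l -> (\forall t \near F, sect (f t)) -> cvgc F f l ->
  sect l' -> (\forall t \near F, sect (g t)) -> cvgc F g l' ->
  cvgc F (fun t => PQ (f t) (g t)) (PQ l l').
Proof.
move=> sl sf fl sl' sg gl; apply: cvgcD; first exact: cvgc_cst.
apply: cvgcM; first exact: cvgc_cst.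
by apply: cvgc_pq => //; exact: expn2k_lt.
Qed.

Lemma dom_nbhs x : dom x -> \forall y \near x, dom y.
Proof.
move=> dx; have [x0 h1 h2] := domP dx; have [sx x3 Px] := dx.
have nx := dom_near_sect dx.
have c1 : normc (cx y) @[y --> x] --> normc (cx x).
  by apply: cvgc_normc; exact: cvgc_cx.
have c2 : normc (Phi (cx y) - 1) @[y --> x] --> normc (Phi (cx x) - 1).
  apply: cvgc_normc; apply: cvgcB; last exact: cvgc_cst.
  by apply: cvgc_Phi => //; exact: cvgc_cx.
have e1 : \forall y \near x, normc (cx y) < 3 by apply: cvgr_lt c1 _ _; lra.
have e2 : \forall y \near x, normc (Phi (cx y) - 1) < 1 by apply: cvgr_lt c2 _ _.
by apply: filterS3 nx e1 e2 => y sy y3 Py; split=> //; exact: ltW.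
Qed.

Lemma open_dom : open dom.
Proof. by rewrite openE => x /dom_nbhs. Qed.

Lemma bounded_dom : bounded_set dom.
Proof.
exists 3; split; first exact: num_real.
move=> M M3 x [_ x3 _]; apply: le_trans (enorm_ge_norm x) _.
by rewrite enormE; lra.
Qed.

Lemma dom1 : dom (1, 0).
Proof.
have E : cx (1, 0) = 1 :> R[i] by [].
have s1 : sect (1 : R[i]) by apply: sect_Re_ge0; rewrite /= ler01.
have n1 : normc (1 : R[i]) <= 3 by rewrite normc1; lra.
split; rewrite E//; have := Phi_near s1 n1; rewrite normc1; lra.
Qed.

(** Within distance 3/4 of the centre 1 the bound is immediate. Farther out |Phi - 1| ^ 2 does not
    decrease along the ray from 1: with u = z - 1, its increment from the point at t u to the one at
    u is (1 - t) times a quantity at least (1 + t) |u| ^ 2 - |u| / 6. *)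
Lemma dom_star x (t : R) : dom x -> 0 <= t <= 1 ->
  dom (t *: (x - (1, 0)) + (1, 0)).
Proof.
move=> dx /andP[t0 t1]; have [x0 h1 h2] := domP dx; have [sx x3 Px] := dx.
set p := _ + _; set z := cx x; set u := z - 1.
have pE : cx p = (t%:C)%C * u + 1 by rewrite /p cxD cxZ cxB.
have p3 : normc (cx p) <= 3.
  rewrite pE (_ : _ + _ = (t%:C)%C * z + ((1 - t)%:C)%C); last first.
    by rewrite rmorphB /= /u; ring.
  apply: le_trans (le_normcD _ _) _; rewrite normcM !normc_real.
  rewrite (ger0_norm t0) ger0_norm ?subr_ge0//.
  by move: h2; rewrite -/z; nra.
have sp : sect (cx p).
  have [|Rp] := leP 0 (Re (cx p)); first exact: sect_Re_ge0.
  have pE' : cx p = (t%:C)%C * z + ((1 - t)%:C)%C.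
    by rewrite pE rmorphB /= /u; ring.
  have Re_p : Re (cx p) = t * Re z + (1 - t).
    by rewrite pE' cReD Re_mulr_real.
  have := le_normcB ((t%:C)%C * z) (- ((1 - t)%:C)%C); rewrite opprK -pE'.
  rewrite normcM normcN !normc_real (ger0_norm t0) ger0_norm ?subr_ge0// => h3.
  move: h1 Rp; rewrite -/z Re_p => h1 Rp.
  have h4 : - (100^-1 * (t * normc z)) <= t * Re z.
    by rewrite mulrCA -mulrN ler_wpM2l.
  apply/sectP; rewrite Re_p.
  have : 0 <= t * normc z by rewrite mulr_ge0// normc_ge0.
  by lra.
split => //; have hp := Phi_near sp p3.
have pu : cx p - 1 = (t%:C)%C * u by rewrite pE addrK.
have np : normc (cx p - 1) = t * normc u.
  by rewrite pu normcM normc_real ger0_norm.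
have [ht|ht] := leP (t * normc u) (3 / 4).
  have := le_normc_trans (Phi (cx p)) 1 (cx p); rewrite np; lra.
apply: le_lt_trans Px.
rewrite -(@ler_pXn2r _ 2)// ?nnegrE ?normc_ge0// -subr_ge0 Phi_sqrB//.
rewrite -/z (_ : z - cx p = ((1 - t)%:C)%C * u); last first.
  by rewrite pE rmorphB /= /u; ring.
rewrite -mulrA Re_mulr_real mulr_ge0 ?subr_ge0//.
have h5 := PP_near sx sp x3 p3; rewrite -/z -/u pu in h5.
have := Re_ge_dist (u * PP z (cx p)) (u * conjc (u + (t%:C)%C * u)).
rewrite -mulrBr normcM.
have -> : u * conjc (u + (t%:C)%C * u) = ((1 + t)%:C)%C * (u * conjc u).
  have -> : ((1 + t)%:C)%C = 1 + (t%:C)%C by apply: eq_ReIm; rewrite /= ?addr0.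
  by rewrite cconjD cconjM conjc_real; ring.
rewrite Re_mulr_real Re_mul_conj.
have u0 := normc_ge0 u.
have : normc u * normc (PP z (cx p) - conjc (u + (t%:C)%C * u)) <= normc u * 6^-1.
  by rewrite ler_wpM2l.
by nra.
Qed.

Lemma connected_dom : connected dom.
Proof.
have -> : dom = \bigcup_(x in dom) ((fun t : R => t *: (x - (1, 0)) + (1, 0)) @` `[0, 1]).
  rewrite eqEsubset; split => [x dx|x [y dy [t]]].
    by exists x => //; exists 1; rewrite ?scale1r ?subrK//= in_itv /= ler01 lexx.
  by rewrite /= in_itv /= => t01 <-; exact: dom_star.
apply: bigcup_connected.
  exists (1, 0) => x _; exists 0; first by rewrite /= in_itv /= lexx ler01.
  by rewrite scale0r add0r.
move=> x _; apply: connected_continuous_connected.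
  exact/connected_intervalP/interval_is_interval.
apply: continuous_subspaceT => t.
by apply: cvgD; [exact: scalel_continuous|exact: cvg_cst].
Qed.

Lemma bounded_domain_dom : bounded_domain dom.
Proof.
split; [exact: open_dom|exact: connected_dom| |exact: bounded_dom].
by exists (1, 0); exact: dom1.
Qed.

End domain.

(** * Green's function *)

Section green.
Variables (R : realType) (k a : nat).
Hypotheses (k0 : (0 < k)%N) (ka : (2 * 2 ^ k <= a)%N).
Implicit Types (z w : R[i]) (x y : R * R).

Local Notation dom := (@dom R k a).
Local Notation Phi := (@Phi R k a).
Local Notation PQ := (@PQ R k a).

Lemma cderiv_rt x : cx x != 0 -> sect (cx x) -> (\forall y \near x, sect (cx y)) ->
  cderiv (fun y => rt k (cx y)) x ((2 ^ k)%:R * rt k (cx x) ^+ (2 ^ k - 1))^-1.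
Proof.
move=> x0 sx nx; exists (fun y => (rtden k (rt k (cx y)) (rt k (cx x)))^-1); split.
  apply: filterS nx => y sy; rewrite cxB -{2}(rtX k (cx y)) -{2}(rtX k (cx x)) rtdenE.
  by rewrite mulfK// rtden_neq0// x0 orbT.
rewrite -rtden_diag; apply: cvgcV; first by rewrite rtden_neq0// x0.
have cr : cvgc (nbhs x) (fun y => rt k (cx y)) (rt k (cx x)).
  by apply: cvgc_rt => //; exact: cvgc_cx.
apply: cvgc_prod => i _; apply: cvgcD; apply: cvgcX => //.
exact: cvgc_cst.
Qed.

Lemma holo_rt n : holo dom n (fun x => rt k (cx x)).
Proof.
elim: n => [|n ih] /=.
  by move=> x dx; apply: cvgc_rt; [case: dx|exact: (dom_near_sect k0 ka dx)|exact: cvgc_cx].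
exists (fun x => ((2 ^ k)%:R * rt k (cx x) ^+ (2 ^ k - 1))^-1).
  move=> x dx; have [x0 _ _] := domP k0 ka dx; have [sx _ _] := dx.
  by apply: cderiv_rt => //; exact: (dom_near_sect k0 ka dx).
apply: holoV.
  move=> x dx; have [x0 _ _] := domP k0 ka dx.
  by rewrite mulf_neq0 ?expf_neq0 ?rt_eq0// pnatr_eq0 expn_eq0.
by apply: holoM; [exact: holo_cst|exact: holoX].
Qed.

Lemma holo_Phi n : holo dom n (fun x => Phi (cx x)).
Proof.
apply: holoD; first exact: holo_cx.
by apply: holoM; [exact: holo_cst|apply: holoX; exact: holo_rt].
Qed.

Lemma holo_PQ n y : dom y -> holo dom n (fun x => PQ (cx x) (cx y)).
Proof.
move=> dy; have [sy _ _] := dy; have [y0 _ _] := domP k0 ka dy.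
apply: holoD; first exact: holo_cst.
apply: holoM; first exact: holo_cst.
apply: holoM.
  apply: holo_sum => i; apply: holoM; [apply: holoX; exact: holo_rt|exact: holo_cst].
apply: holoV.
  by move=> x [sx _ _]; rewrite rtden_neq0// y0 orbT.
apply: holo_prod => i; apply: holoD; [apply: holoX; exact: holo_rt|exact: holo_cst].
Qed.

Lemma PQ_neq0 z w : sect z -> sect w -> normc z <= 3 -> normc w <= 3 -> PQ z w != 0.
Proof.
move=> sz sw z3 w3; apply: contraTneq (PQ_near k0 ka sz sw z3 w3) => ->.
by rewrite sub0r normcN normc1 -ltNge; lra.
Qed.

(** Green's function of the unit disc, pulled back by the conformal map [Phi] - 1. *)
Definition green x y : R := (2 * pi)^-1 *
  (ln (normc (Phi (cx x) - Phi (cx y))) -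
   ln (normc (1 - conjc (Phi (cx y) - 1) * (Phi (cx x) - 1)))).

Lemma reflection_neq0 z w : normc z <= 1 -> normc w < 1 -> 1 - conjc w * z != 0.
Proof.
move=> z1 w1; rewrite -normc_gt0.
have := le_normcB 1 (conjc w * z); rewrite normc1 normcM normc_conj.
have : normc w * normc z <= normc w by rewrite ler_piMr ?normc_ge0.
by lra.
Qed.

(** The factorisation of Phi x - Phi y through [PQ] splits off the logarithmic pole; what remains is
    regular across x = y because [PQ] does not vanish. *)
Lemma greenE x y : dom x -> dom y -> x != y ->
  green x y = (2 * pi)^-1 * ln (enorm (x - y)) + (2 * pi)^-1 *
  (ln (normc (PQ (cx x) (cx y))) -
   ln (normc (1 - conjc (Phi (cx y) - 1) * (Phi (cx x) - 1)))).
Proof.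
move=> [sx x3 _] [sy y3 _] xy; rewrite /green PhiE// normcM enormE cxB.
rewrite lnM ?posrE ?normc_gt0 ?PQ_neq0// ?subr_eq0 ?(inj_eq (@cx_inj R))//.
by ring.
Qed.

Lemma cvgc_Phi_within x : sect (cx x) ->
  cvgc (within dom (nbhs x)) (fun y => Phi (cx y)) (Phi (cx x)).
Proof.
move=> sx; apply: cvgc_Phi => //.
  have h : \forall y \near x, dom y -> sect (cx y).
    by apply: (@filterE _ (nbhs x)) => y [].
  exact: h.
have [e1 e2] := cvgc_cx x; split.
  by apply: cvg_trans e1; apply: cvg_app; exact: cvg_within.
by apply: cvg_trans e2; apply: cvg_app; exact: cvg_within.
Qed.

(** The closed conditions pass to the limit. If |Phi - 1| were less than 1 at x, then x would belong
    to the open set [dom], so not to its boundary. *)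
Lemma boundary_dom x : boundary dom x ->
  [/\ sect (cx x), normc (cx x) <= 5/2 & normc (Phi (cx x) - 1) = 1].
Proof.
move=> [cl ni].
have nd : ~ dom x by move=> dx; apply: ni; exact: (dom_nbhs k0 ka dx).
have cD (P : set (R * R)) : (\forall y \near x, dom y -> P y) -> exists2 y, dom y & P y.
  by move=> /cl [y [dy Py]]; exists y => //; exact: Py.
have c1 : normc (cx y) @[y --> x] --> normc (cx x).
  by apply: cvgc_normc; exact: cvgc_cx.
have sx : sect (cx x).
  apply: contrapT => /negP; rewrite /sect -ltNge => h.
  have [c2 _] := cvgc_cx x.
  have c3 : (fun y => Re (cx y) + normc (cx y) / 2) @ x --> Re (cx x) + normc (cx x) / 2.
    by apply: cvgD => //; apply: cvgM => //; exact: cvg_cst.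
  have n3 : \forall y \near x, Re (cx y) + normc (cx y) / 2 < 0.
    by apply: cvgr_lt c3 _ _; lra.
  have [|y [/sectP sy _ _]] := cD (fun y => Re (cx y) + normc (cx y) / 2 < 0); last by lra.
  by apply: filterS n3.
have x3 : normc (cx x) <= 3.
  rewrite leNgt; apply/negP => h.
  have n3 : \forall y \near x, 3 < normc (cx y) by apply: cvgr_gt c1 _ _.
  have [|y [_ y3 _]] := cD (fun y => 3 < normc (cx y)); last by lra.
  by apply: filterS n3.
have c4 := cvgc_Phi_within sx.
have P1 : normc (Phi (cx x) - 1) <= 1.
  rewrite leNgt; apply/negP => h.
  have c5 : normc (Phi (cx y) - 1) @[y --> within dom (nbhs x)] --> normc (Phi (cx x) - 1).
    by apply: cvgc_normc; apply: cvgcB => //; exact: cvgc_cst.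
  have n5 : \forall y \near within dom (nbhs x), 1 < normc (Phi (cx y) - 1).
    by apply: cvgr_gt c5 _ _.
  have [//|y [_ _ y1]] := cD (fun y => 1 < normc (Phi (cx y) - 1)).
  by lra.
have [_ x2] := sect_Phi_le k0 ka sx x3 P1; split => //.
apply/eqP; rewrite eq_le P1 /= leNgt; apply/negP => h; apply: nd.
by split.
Qed.

Lemma green_function_dom : green_function dom green.
Proof.
move=> y dy; have [sy y3 Py] := dy; split.
  exists (fun x => (2 * pi)^-1 * (ln (normc (PQ (cx x) (cx y))) -
     ln (normc (1 - conjc (Phi (cx y) - 1) * (Phi (cx x) - 1))))).
    apply: harmonic_ln_normcB.
    - exact: (open_dom k0 ka).
    - by move=> x [sx x3 _]; exact: PQ_neq0.
    - by move=> x [_ _ Px]; apply: reflection_neq0 => //; exact: ltW.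
    - exact: holo_PQ.
    - have h : holo dom 2 (fun x => 1 + - conjc (Phi (cx y) - 1) * (Phi (cx x) + - 1)).
        apply: holoD; first exact: holo_cst.
        apply: holoM; first exact: holo_cst.
        by apply: holoD; [exact: holo_Phi|exact: holo_cst].
      by rewrite (_ : (fun x => _) = (fun x => 1 + - conjc (Phi (cx y) - 1) *
        (Phi (cx x) + - 1)))//; apply/funext => x; rewrite mulNr.
  by move=> x dx xy; exact: greenE.
move=> x0 bx; have [sx x3 Px] := boundary_dom bx.
have c1 := cvgc_Phi_within sx.
set W := Phi (cx x0) - 1 in Px *; set w := Phi (cx y) - 1 in Py *.
(* On the unit circle |1 - conj w W| = |W - w|, so the two logarithms have the same limit and
   cancel. *)
have E : normc (1 - conjc w * W) = normc (Phi (cx x0) - Phi (cx y)).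
  have -> : Phi (cx x0) - Phi (cx y) = W - w by rewrite /W /w; ring.
  have -> : 1 - conjc w * W = W * conjc (W - w).
    have : conjc W * W = 1.
      apply: eq_ReIm; first by rewrite mulrC Re_mul_conj Px expr1n.
      by case: (W) => u v /=; ring.
    by rewrite cconjD (_ : conjc (- w) = - conjc w) ?rmorphN// => h; rewrite -h; ring.
  by rewrite normcM Px mul1r normc_conj.
have n0 : 1 - conjc w * W != 0 by apply: reflection_neq0 => //; rewrite Px.
have n1 : Phi (cx x0) - Phi (cx y) != 0 by rewrite -normc_gt0 -E normc_gt0.
have lnc (f : R * R -> R[i]) l : l != 0 -> cvgc (within dom (nbhs x0)) f l ->
    ln (normc (f x)) @[x --> within dom (nbhs x0)] --> ln (normc l).
  move=> l0 fl.
  have h : normc (f x) @[x --> within dom (nbhs x0)] --> normc l by exact: cvgc_normc.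
  have := @continuous_cvg _ _ _ _ _ _ (@ln R) _ (@continuous_ln R _ _) h.
  by apply; rewrite normc_gt0.
rewrite -(mulr0 (2 * pi)^-1) -(subrr (ln (normc (Phi (cx x0) - Phi (cx y))))).
apply: cvgM; first exact: cvg_cst.
apply: cvgB; first by apply: lnc => //; apply: cvgcB => //; exact: cvgc_cst.
rewrite -E; apply: lnc => //; apply: cvgcB; first exact: cvgc_cst.
apply: cvgcM; first exact: cvgc_cst.
by apply: cvgcB => //; exact: cvgc_cst.
Qed.

End green.

(** * Regularity of the boundary *)

Section regularity_classes.
Variables (R : realType) (r th : R).
Hypotheses (r0 : 0 < r) (r1 : r * 2 <= 1) (th0 : 0 < th) (th1 : th < 1).
Implicit Types (f g : R -> R[i]) (u : R -> R) (s t : R) (n : nat).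

Local Notation I := `](- r), r[%classic.

Definition cderiv1 f s (l : R[i]) := exists Q : R -> R[i],
  (\forall h \near (0:R), f (h + s) - f s = (h%:C)%C * Q h) /\ cvgc (nbhs (0:R)) Q l.

Lemma cvg_shift0 s : (fun h : R => h + s) @ (0:R) --> s.
Proof. by rewrite -[X in _ --> X]add0r; apply: cvgD; [exact: cvg_id|exact: cvg_cst]. Qed.

Lemma cderiv1_cvg f s l : cderiv1 f s l -> cvgc (nbhs (0:R)) (fun h => f (h + s)) (f s).
Proof.
move=> [Q [fQ Ql]].
apply: (@near_eq_cvgc _ _ _ _ (fun h => f s + (h%:C)%C * Q h)).
  by apply: filterS fQ => y <-; rewrite addrC subrK.
rewrite -[X in cvgc _ _ X]addr0 -(mul0r l); apply: cvgcD; first exact: cvgc_cst.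
by apply: cvgcM => //; apply: cvgc_real; exact: cvg_id.
Qed.

Lemma cderiv1_cst c s : cderiv1 (fun=> c) s 0.
Proof.
exists (fun=> 0); split; last exact: cvgc_cst.
by apply: (@filterE _ (nbhs (0:R))) => h; rewrite subrr mulr0.
Qed.

Lemma cderiv1_id s : cderiv1 (fun t => (t%:C)%C) s 1.
Proof.
exists (fun=> 1); split; last exact: cvgc_cst.
by apply: (@filterE _ (nbhs (0:R))) => h; rewrite mulr1 -rmorphB addrK.
Qed.

Lemma cderiv1D f g s l m :
  cderiv1 f s l -> cderiv1 g s m -> cderiv1 (fun t => f t + g t) s (l + m).
Proof.
move=> [P [fP Pl]] [Q [gQ Qm]]; exists (fun h => P h + Q h); split.
  by apply: filterS2 fP gQ => h fP gQ; rewrite mulrDr -fP -gQ; ring.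
exact: cvgcD.
Qed.

Lemma cderiv1M f g s l m : cderiv1 f s l -> cderiv1 g s m ->
  cderiv1 (fun t => f t * g t) s (l * g s + f s * m).
Proof.
move=> df [Q [gQ Qm]]; have fs := cderiv1_cvg df; case: df => P [fP Pl].
exists (fun h => P h * g s + f (h + s) * Q h); split.
  by apply: filterS2 fP gQ => h fP gQ; rewrite mulrDr mulrA -fP mulrCA -gQ; ring.
apply: cvgcD; last exact: cvgcM.
by apply: cvgcM => //; exact: cvgc_cst.
Qed.

Lemma cderiv1V f s l : f s != 0 -> cderiv1 f s l ->
  cderiv1 (fun t => (f t)^-1) s (-1 * l * ((f s)^-1 * (f s)^-1)).
Proof.
move=> fs0 df; have fs := cderiv1_cvg df; case: df => P [fP Pl].
have fh0 : \forall h \near (0:R), f (h + s) != 0 by exact: cvgc_neq0 fs fs0.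
exists (fun h => -1 * P h * ((f (h + s))^-1 * (f s)^-1)); split.
  apply: filterS (filterI fP fh0) => h [{}fP {}fh0].
  transitivity (-1 * ((h%:C)%C * P h) * ((f (h + s))^-1 * (f s)^-1)); last by ring.
  rewrite -fP; field.
  by rewrite fs0.
apply: cvgcM; first by apply: cvgcM => //; exact: cvgc_cst.
by apply: cvgcM; [exact: cvgcV|exact: cvgc_cst].
Qed.

Lemma cderiv1_conj f s l : cderiv1 f s l -> cderiv1 (fun t => conjc (f t)) s (conjc l).
Proof.
move=> [P [fP Pl]]; exists (fun h => conjc (P h)); split; last exact: cvgc_conj.
apply: filterS fP => h fP.
by rewrite -[in RHS](conjc_real h) -cconjM -fP cconjD (_ : conjc (- f s) = - conjc (f s)) ?rmorphN.
Qed.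

Lemma cderiv1_Re f s l : cderiv1 f s l -> is_derive s 1 (fun t => Re (f t)) (Re l).
Proof.
move=> [P [fP [Pl _]]].
apply: (@is_derive_caratheodory _ _ _ _ _ _ (fun h => Re (P h))) => //.
apply: filterS fP => h fP.
by rewrite -[RHS]/(h * Re (P h)) -Re_mulr_real -fP cReD cReN [_%:A]mulr1.
Qed.

(** The class C^{n,th} on the interval, with complex values so that the boundary curve and the
    powers of its roots live in the same algebra. Since the interval has length at most 1, Lipschitz
    functions are Hoelder of exponent th. *)
Fixpoint creg n f : Prop :=
  if n is n'.+1 then
    exists2 f', (forall s, I s -> cderiv1 f s (f' s)) & creg n' f'
  else exists C : R, forall s t, I s -> I t -> normc (f s - f t) <= C * `|s - t| `^ th.

Lemma IP s : I s <-> - r < s /\ s < r.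
Proof. by rewrite /= in_itv /=; split=> [/andP|[-> ->]]. Qed.

Lemma I_dist s t : I s -> I t -> `|s - t| <= 1.
Proof.
move=> /IP[s0 s1] /IP[t0 t1]; rewrite ler_norml.
by have r1' := r1; apply/andP; split; lra.
Qed.

Lemma le_powR_th (x : R) : 0 <= x -> x <= 1 -> x <= x `^ th.
Proof.
rewrite le_eqVlt => /predU1P[<- _|x0 x1]; first by rewrite powR_ge0.
by apply: ger1_powR; [rewrite x0|exact: ltW].
Qed.

Lemma creg0_lip f (C : R) : 
  (forall s t, I s -> I t -> normc (f s - f t) <= C * `|s - t|) -> creg 0 f.
Proof.
move=> fC; exists (Num.max 0 C) => s t Is It; apply: le_trans (fC _ _ Is It) _.
have h := le_powR_th (normr_ge0 (s - t)) (I_dist Is It).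
apply: (@le_trans _ _ (Num.max 0 C * `|s - t|)).
  by rewrite ler_wpM2r// le_max lexx orbT.
by rewrite ler_wpM2l// le_max lexx.
Qed.

Lemma creg0_bound f : creg 0 f -> exists2 M, 0 <= M & forall s, I s -> normc (f s) <= M.
Proof.
move=> [C fC]; exists (normc (f 0) + `|C|); first by rewrite addr_ge0 ?normc_ge0.
move=> s Is; have I0 : I 0 by rewrite /= in_itv /= oppr_lt0 r0.
have := le_normcD (f s - f 0) (f 0); rewrite subrK addrC => /le_trans; apply.
rewrite lerD2l; apply: le_trans (fC _ _ Is I0) _.
have hp : `|s - 0| `^ th <= 1.
  have := @ge0_ler_powR R th (ltW th0) `|s - 0| 1; rewrite !nnegrE powR1.
  by apply => //; exact: I_dist.
apply: le_trans (ler_wpM2r (powR_ge0 _ _) (ler_norm C)) _.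
by rewrite ler_piMr.
Qed.

(** A Hoelder derivative is bounded, so the function is Lipschitz by the mean value theorem. *)
Lemma creg1_0 f f' : (forall s, I s -> cderiv1 f s (f' s)) -> creg 0 f' -> creg 0 f.
Proof.
move=> ff' hf'; have [M M0 f'M] := creg0_bound hf'.
(* The mean value theorem is real: p = 1 reaches the real part of f and p = - i its imaginary
   part. *)
have aux (p : R[i]) : normc p <= 1 -> forall s t, I s -> I t -> s <= t ->
    `|Re (p * f t) - Re (p * f s)| <= M * `|s - t|.
  move=> p1 s t Is It st.
  have d x : I x -> is_derive x 1 (fun t => Re (p * f t)) (Re (p * f' x)).
    move=> Ix; have := cderiv1_Re (cderiv1M (cderiv1_cst p x) (ff' _ Ix)).
    by rewrite mul0r add0r.
  have sub x : x \in `[s, t] -> I x.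
    move: Is It => /IP[s0 _] /IP[_ t1]; rewrite in_itv /= => /andP[sx xt].
    by apply/IP; split; [exact: lt_le_trans s0 sx|exact: le_lt_trans xt t1].
  have cw : {within `[s, t], continuous (fun t => Re (p * f t))}.
    apply: derivable_within_continuous => x /sub Ix.
    exact: (@ex_derive _ _ _ _ _ _ _ (d x Ix)).
  have d' x : x \in `]s, t[ -> is_derive x 1 (fun t => Re (p * f t)) (Re (p * f' x)).
    by move=> /subset_itv_oo_cc /sub; exact: d.
  have [c /sub Ic ->] := MVT_segment st d' cw.
  rewrite normrM (distrC s) ler_wpM2r//.
  apply: le_trans (Re_le_normc _) _; rewrite normcM -[M]mul1r.
  by rewrite ler_pM ?normc_ge0// f'M.
apply: (@creg0_lip _ (2 * M)) => s t.
have main s' t' : I s' -> I t' -> s' <= t' -> normc (f t' - f s') <= 2 * M * `|s' - t'|.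
  move=> Is It st; apply: le_trans (normc_le_ReIm _) _.
  have := aux 1 _ s' t' Is It st; rewrite normc1 lexx !mul1r => /(_ isT) h1.
  have n1 : normc (Complex 0 (-1) : R[i]) <= 1 by rewrite /= expr0n sqrrN expr1n add0r sqrtr1.
  have := aux _ n1 s' t' Is It st.
  have E (z : R[i]) : Re (Complex 0 (-1) * z) = Im z by case: z => p q /=; ring.
  rewrite !E => h2; rewrite cReD cReN cImD cImN.
  by rewrite -mulrA mulr_natl mulr2n lerD.
move=> Is It; have [st|ts] := leP s t.
  by rewrite normcB_sym; exact: main.
by rewrite distrC; apply: main => //; exact: ltW.
Qed.

Lemma cregW n f : creg n.+1 f -> creg n f.
Proof.
elim: n f => [|n ih] f; first by case=> f'; exact: creg1_0.
by case=> f' ff' /ih hf'; exists f'.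
Qed.

Lemma creg_le m n f : (m <= n)%N -> creg n f -> creg m f.
Proof.
move=> /subnK <-; elim: (n - m)%N => [//|j ih]; rewrite addSn => /cregW; exact: ih.
Qed.

Lemma creg_bound n f : creg n f -> exists2 M, 0 <= M & forall s, I s -> normc (f s) <= M.
Proof. by move=> /(creg_le (leq0n n)); exact: creg0_bound. Qed.

Lemma creg_cst n c : creg n (fun=> c).
Proof.
elim: n c => [|n ih] c /=.
  by apply: (@creg0_lip _ 0) => s t _ _; rewrite subrr normc0 mul0r.
by exists (fun=> 0) => // s _; exact: cderiv1_cst.
Qed.

Lemma creg_id n : creg n (fun t => (t%:C)%C).
Proof.
case: n => [|n].
  by apply: (@creg0_lip _ 1) => s t _ _; rewrite -rmorphB normc_real mul1r.
by exists (fun=> 1); [move=> s _; exact: cderiv1_id|exact: creg_cst].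
Qed.

Lemma cregD n f g : creg n f -> creg n g -> creg n (fun t => f t + g t).
Proof.
elim: n f g => [|n ih] f g.
  move=> [C fC] [D gD]; exists (C + D) => s t Is It.
  rewrite (_ : _ - _ = (f s - f t) + (g s - g t)); last by ring.
  apply: le_trans (le_normcD _ _) _; rewrite mulrDl lerD//; [exact: fC|exact: gD].
move=> [f' ff' hf'] [g' gg' hg']; exists (fun t => f' t + g' t); last exact: ih.
by move=> s Is; apply: cderiv1D; [exact: ff'|exact: gg'].
Qed.

Lemma cregM n f g : creg n f -> creg n g -> creg n (fun t => f t * g t).
Proof.
elim: n f g => [|n ih] f g.
  move=> hf hg; have [M M0 fM] := creg_bound hf; have [L L0 gL] := creg_bound hg.
  case: hf => C fC; case: hg => D gD; exists (L * C + M * D) => s t Is It.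
  rewrite (_ : _ - _ = g t * (f s - f t) + f s * (g s - g t)); last by ring.
  apply: le_trans (le_normcD _ _) _; rewrite !normcM mulrDl -!mulrA.
  apply: lerD.
    by apply: ler_pM; rewrite ?normc_ge0//; [exact: gL|exact: fC].
  by apply: ler_pM; rewrite ?normc_ge0//; [exact: fM|exact: gD].
move=> hf hg; have hf1 := cregW hf; have hg1 := cregW hg.
case: hf => f' ff' hf'; case: hg => g' gg' hg'.
exists (fun t => f' t * g t + f t * g' t).
  by move=> s Is; apply: cderiv1M; [exact: ff'|exact: gg'].
by apply: cregD; exact: ih.
Qed.

Lemma cregV n f (m : R) : 0 < m -> (forall s, I s -> m <= normc (f s)) -> creg n f ->
  creg n (fun t => (f t)^-1).
Proof.
move=> m0 mf; have f0 s : I s -> f s != 0.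
  by move=> /mf; rewrite -normc_gt0; exact: lt_le_trans.
elim: n => [|n ih].
  move=> [C fC]; exists (m^-1 * m^-1 * C) => s t Is It.
  have fs := f0 _ Is; have ft := f0 _ It.
  rewrite (_ : _ - _ = (f s)^-1 * (f t)^-1 * (f t - f s)); last by field; rewrite ?fs ?ft.
  rewrite !normcM !normcV normcB_sym -mulrA -[leRHS]mulrA -mulrA.
  have hV x : I x -> (normc (f x))^-1 <= m^-1.
    by move=> Ix; rewrite lef_pV2 ?posrE ?mf// normc_gt0 f0.
  apply: ler_pM; rewrite ?invr_ge0 ?mulr_ge0 ?invr_ge0 ?normc_ge0//; first exact: hV.
  by apply: ler_pM; rewrite ?invr_ge0 ?normc_ge0//; [exact: hV|exact: fC].
move=> hf; have hf1 := cregW hf; case: hf => f' ff' hf'.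
exists (fun t => -1 * f' t * ((f t)^-1 * (f t)^-1)).
  by move=> s Is; apply: cderiv1V; [exact: f0|exact: ff'].
apply: cregM; last by apply: cregM; exact: ih.
by apply: cregM => //; exact: creg_cst.
Qed.

Lemma creg_conj n f : creg n f -> creg n (fun t => conjc (f t)).
Proof.
elim: n f => [|n ih] f.
  move=> [C fC]; exists C => s t Is It.
  rewrite (_ : _ - _ = conjc (f s - f t)) ?normc_conj; first exact: fC.
  by rewrite cconjD (_ : conjc (- f t) = - conjc (f t)) ?rmorphN.
move=> [f' ff' hf']; exists (fun t => conjc (f' t)); last exact: ih.
by move=> s Is; apply: cderiv1_conj; exact: ff'.
Qed.

Lemma creg_Re n f : creg n f -> creg n (fun t => ((Re (f t))%:C)%C).
Proof.
move=> hf.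
have -> : (fun t => ((Re (f t))%:C)%C) = (fun t => ((2^-1)%:C)%C * (f t + conjc (f t))).
  by apply/funext => t; case: (f t) => p q; apply: eq_ReIm => /=; field.
by apply: cregM; [exact: creg_cst|apply: cregD => //; exact: creg_conj].
Qed.

Lemma near_I s : I s -> \forall t \near s, I t.
Proof.
move=> Is; apply: open_nbhs_nbhs; split => //; exact: interval_open.
Qed.

Lemma eq_derive1n n u v : (forall s, I s -> u s = v s) ->
  forall s, I s -> derive1n n u s = derive1n n v s.
Proof.
elim: n u v => [//|n ih] u v uv s Is; rewrite /derive1n !iterSr -!/(derive1n n _).
apply: ih => // t It; rewrite !derive1E; apply: near_eq_derive.
by apply: filterS (near_I It) => x /uv.
Qed.

(** Lowering the exponent from th to al is free, as distances are at most 1. Continuity of the last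
    derivative comes from th > 0, which covers al = 0. *)
Lemma Cholder_creg n (al : R) u : 0 <= al <= th ->
  creg n (fun t => ((u t)%:C)%C) -> Cholder_on n al I u.
Proof.
move=> /andP[al0 alth].
suff main f : creg n f -> Cholder_on n al I (fun t => Re (f t)) by exact: main.
elim: n f => [|n ih] f.
  move=> [C fC].
  have h s t : I s -> I t -> `|Re (f s) - Re (f t)| <= `|C| * `|s - t| `^ th.
    move=> Is It; rewrite -cReN -cReD; apply: le_trans (Re_le_normc _) _.
    apply: le_trans (fC _ _ Is It) _.
    by rewrite ler_wpM2r ?powR_ge0// ler_norm.
  split => // [s Is|_].
    apply/cvgrPdist_le => e e0.
    pose d := (e / (`|C| + 1)) `^ th^-1.
    have C1 : 0 < `|C| + 1 by rewrite ltr_wpDl.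
    have d0 : 0 < d by rewrite powR_gt0// divr_gt0.
    have nd : \forall t \near s, `|s - t| <= d.
      exact: (@cvgr_dist_le _ _ _ _ _ _ _ (@cvg_id _ (nbhs s)) d d0).
    near=> t; apply: le_trans (h _ _ Is _) _; first by near: t; exact: near_I.
    have td : `|s - t| <= d by near: t.
    apply: (@le_trans _ _ ((`|C| + 1) * d `^ th)).
      by apply: ler_pM; rewrite ?powR_ge0 ?lerDl// ge0_ler_powR// ?nnegrE ltW.
    have e1 : 0 <= e / (`|C| + 1) by apply: divr_ge0; exact: ltW.
    have C2 : `|C| + 1 != 0 by rewrite gt_eqF.
    rewrite /d -powRrM mulVf ?gt_eqF// powRr1//.
    by rewrite mulrC divfK.
  exists `|C| => s t Is It; apply: le_trans (h _ _ Is It) _.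
  rewrite ler_wpM2l//; have := I_dist Is It; have := normr_ge0 (s - t).
  rewrite le_eqVlt => /predU1P[<- _|x0 x1].
    by rewrite powR0 ?gt_eqF// powR_ge0.
  by apply: ger_powR; rewrite ?x0.
move=> [f' ff' /ih [d1 c1 h1]].
have D s : I s -> is_derive s 1 (fun t => Re (f t)) (Re (f' s)).
  by move=> Is; apply: cderiv1_Re; exact: ff'.
have E s : I s -> derive1 (fun t => Re (f t)) s = Re (f' s).
  by move=> Is; rewrite derive1E (@derive_val _ _ _ _ _ _ _ (D s Is)).
have ES j s : I s -> derive1n j.+1 (fun t => Re (f t)) s = derive1n j (fun t => Re (f' t)) s.
  by move=> Is; rewrite /derive1n iterSr -!/(derive1n j _); exact: eq_derive1n.
have nES j s : I s -> \forall t \near s,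
    derive1n j (fun t => Re (f' t)) t = derive1n j.+1 (fun t => Re (f t)) t.
  by move=> Is; apply: filterS (near_I Is) => t It; rewrite ES.
split.
- move=> [|j] s jn Is; first exact: (@ex_derive _ _ _ _ _ _ _ (D s Is)).
  apply: near_eq_derivable (nES j s Is) _; exact: d1.
- move=> s Is; have := c1 s Is; rewrite /prop_for /continuous_at ES//.
  apply: cvg_trans; apply: near_eq_cvg.
  by apply: filterS (nES n s Is) => t /= ->.
- move=> al1; have [C hC] := h1 al1; exists C => s t Is It.
  by rewrite !ES//; exact: hC.
Unshelve. all: by end_near. Qed.

End regularity_classes.

(** * Hoelder continuity of z ^ (1 - 2 ^ -k) *)

Section holder_root.
Variables (R : realType) (k : nat).
Implicit Types z w : R[i].

Lemma normc_expB_le (z w : R[i]) b (M : R) : normc z <= M -> normc w <= M ->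
  normc (z ^+ b.+1 - w ^+ b.+1) <= b.+1%:R * M ^+ b * normc (z - w).
Proof.
move=> zM wM; have M0 := le_trans (normc_ge0 z) zM.
rewrite subrXX normcM mulrC ler_wpM2r ?normc_ge0//.
apply: le_trans (normc_sum_le _ _ _) _.
rewrite [leRHS](_ : _ = \sum_(i < b.+1) M ^+ b); last first.
  by rewrite sumr_const card_ord mulr_natl.
apply: ler_sum => i _; rewrite normcM !normcX.
have ib : (i <= b)%N by rewrite -ltnS.
rewrite -[in leRHS](subnK ib) exprD /=.
by apply: ler_pM; rewrite ?exprn_ge0 ?normc_ge0//; apply: lerXn2r;
  rewrite ?nnegrE ?normc_ge0.
Qed.

(** With n = 2 ^ k, M the larger modulus of the two roots and 2 M rho their distance, the left-hand
    side is at most a constant times M ^ (n - 1) rho, while |z - w| is at least a constant times M ^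
    n rho. After M is normalised to mu <= 1, rho <= rho ^ th and mu ^ (n - 1) <= mu ^ (n th),
    because n th <= n - 1. *)
Lemma normc_sqrtnB_holder (th : R) : (0 < k)%N -> 0 < th -> th < 1 ->
  1 <= (2 ^ k)%:R * (1 - th) ->
  exists C : R, forall z w, sect z -> sect w -> normc z <= 3 -> normc w <= 3 ->
    normc (rt k z ^+ (2 ^ k - 1) - rt k w ^+ (2 ^ k - 1)) <= C * normc (z - w) `^ th.
Proof.
move=> k0 th0 th1 kth; set n := (2 ^ k)%N.
have n2 : (2 <= n)%N by rewrite /n; case: (k) k0 => // j _; rewrite expnS leq_pmulr// expn_gt0.
have [b nb] : exists b, n = b.+2 by exists (n - 2)%N; lia.
have b1 : (n - 1 = b.+1)%N by lia.
pose c1 : R := (2^-1 ^+ k * 2 * 3 ^+ n) `^ th.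
have c10 : 0 < c1 by rewrite powR_gt0// !mulr_gt0 ?exprn_gt0 ?invr_gt0.
pose C := 2 * b.+1%:R * 3 ^+ b.+1 / c1; exists C => z w sz sw z3 w3.
rewrite b1; set ze := rt k z; set et := rt k w; set M := Num.max (normc ze) (normc et).
have zM : normc ze <= M by rewrite le_max lexx.
have wM : normc et <= M by rewrite le_max lexx orbT.
have M3 : M <= 3 by rewrite ge_max !normc_rt_le3.
have [M0|M0] := ltP 0 M; last first.
  have z0 : ze = 0.
    by apply/eqP; rewrite -[_ == _]negbK -normc_gt0 -leNgt (le_trans zM).
  have w0 : et = 0.
    by apply/eqP; rewrite -[_ == _]negbK -normc_gt0 -leNgt (le_trans wM).
  by rewrite z0 w0 subrr normc0 mulr_ge0 ?powR_ge0// !mulr_ge0 ?exprn_ge0// invr_ge0 ltW.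
(* Both parameters lie in [0, 1]: the distance of the roots is at most 2 M, and M is at most 3. *)
pose rho := normc (ze - et) / (2 * M); pose mu := M / 3.
have M20 : 2 * M != 0 by rewrite mulf_neq0// gt_eqF.
have rho0 : 0 <= rho by rewrite divr_ge0 ?normc_ge0// mulr_ge0// ltW.
have rho1 : rho <= 1.
  rewrite ler_pdivrMr ?mulr_gt0// mul1r; have := le_normcD ze (- et).
  by rewrite normcN; lra.
have mu0 : 0 < mu by rewrite divr_gt0.
have mu0' := ltW mu0.
have mu1 : mu <= 1 by rewrite ler_pdivrMr// mul1r.
have dE : normc (ze - et) = 2 * M * rho by rewrite /rho mulrC divfK.
have ME : M = 3 * mu by rewrite /mu mulrC divfK.
clearbody rho mu.
have L : normc (ze ^+ b.+1 - et ^+ b.+1) <= 2 * b.+1%:R * 3 ^+ b.+1 * (mu ^+ b.+1 * rho).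
  apply: le_trans (normc_expB_le b zM wM) _.
  rewrite dE [leLHS](_ : _ = 2 * b.+1%:R * M ^+ b.+1 * rho); last by rewrite exprS; ring.
  by rewrite {1}ME exprMn mulrA -!mulrA.
have lower : 2^-1 ^+ k * 2 * 3 ^+ n * mu ^+ n * rho <= normc (z - w).
  have -> : z - w = (ze - et) * rtden k ze et by rewrite -rtdenE !rtX.
  rewrite normcM dE.
  have := rtden_ge k sz sw; rewrite -/ze -/et -/M -/n b1 => h.
  have h2 : 0 <= 2 * M * rho by rewrite mulr_ge0// mulr_ge0// ltW.
  apply: le_trans (ler_wpM2l h2 h).
  rewrite -[2^-1 ^+ k * 2 * 3 ^+ n * _]mulrA -exprMn -ME nb exprS.
  by rewrite le_eqVlt; apply/orP; left; apply/eqP; ring.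
have key : c1 * (mu ^+ b.+1 * rho) <= normc (z - w) `^ th.
  apply: (@le_trans _ _ ((2^-1 ^+ k * 2 * 3 ^+ n * mu ^+ n * rho) `^ th)); last first.
    apply: ge0_ler_powR; rewrite ?nnegrE ?normc_ge0 ?(ltW th0)//.
    by rewrite !mulr_ge0 ?exprn_ge0 ?invr_ge0.
  rewrite -mulrA powRM; last 2 first.
    by rewrite !mulr_ge0 ?exprn_ge0 ?invr_ge0.
    by rewrite mulr_ge0 ?exprn_ge0.
  rewrite ler_wpM2l ?(ltW c10)// powRM ?exprn_ge0// ?(ltW mu0)//.
  apply: ler_pM; rewrite ?exprn_ge0 ?powR_ge0//.
    rewrite -!powR_mulrn ?(ltW mu0)// -powRrM; apply: ger_powR; first by rewrite mu0.
    have : b.+1%:R + 1 = n%:R :> R by rewrite nb natr1.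
    by move: kth; rewrite -/n mulrBr mulr1; lra.
  exact: le_powR_th.
apply: le_trans L _; rewrite /C -[leRHS]mulrA ler_wpM2l ?mulr_ge0 ?exprn_ge0//.
by rewrite ler_pdivlMl.
Qed.

End holder_root.

Section exponents.
Implicit Types k N i n M : nat.

Lemma expn2_ge2 k : (0 < k)%N -> (2 <= 2 ^ k)%N.
Proof. by case: k => // j _; rewrite expnS leq_pmulr// expn_gt0. Qed.

Lemma exponent_step k N i : (0 < k)%N -> (i < N.-1)%N ->
  (2 ^ k < (N - i) * 2 ^ k - 1)%N /\
  ((N - i) * 2 ^ k - 1 - 2 ^ k = (N - i.+1) * 2 ^ k - 1)%N.
Proof.
move=> k0 iN; have n2 := expn2_ge2 k0.
have [j Nj] : exists j, (N - i = j.+2)%N by exists (N - i - 2)%N; lia.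
have Nj' : (N - i.+1 = j.+1)%N by lia.
by rewrite Nj Nj' !mulSn; lia.
Qed.

Lemma subn_pred N : (3 <= N)%N -> (N - N.-1 = 1)%N /\ (1 <= N.-1)%N.
Proof. by lia. Qed.

Lemma minn_step n M i : (i < M)%N -> minn n.+1 (M - i) = (minn n (M - i.+1)).+1.
Proof. by lia. Qed.

Lemma leq_subn1 n M : (n < M)%N -> (n <= M - 1)%N.
Proof. by lia. Qed.

End exponents.

(** * The boundary as the graph of an implicit function *)

Section boundary_graph.
Variables (R : realType) (k a : nat).
Hypotheses (k0 : (0 < k)%N) (ka : (2 * 2 ^ k <= a)%N).
Variables (z0 u : R[i]) (d r : R).
Hypotheses (sz0 : sect z0) (z03 : normc z0 <= 5/2).
Hypothesis Pz0 : normc (Phi k a z0 - 1) = 1.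
Hypotheses (u1 : normc u = 1) (z0u : z0 - 1 = - (d%:C)%C * u).
Hypotheses (d1 : 39/40 <= d) (d2 : d <= 41/40).
Hypotheses (r0 : 0 < r) (r1 : r <= 100^-1).

Local Notation dom := (@dom R k a).
Local Notation Phi := (@Phi R k a).
Local Notation PQ := (@PQ R k a).
Local Notation PP := (@PP R k a).
Local Notation J := (Complex (0 : R) 1).

(** The axis [u] points from z0 to the centre 1, so z0 = 1 - d u with d close to 1. It is nearly the
    inner normal because [Phi] is nearly the identity. *)
Definition chart (s t : R) : R[i] := z0 + (s%:C)%C * (J * u) + (t%:C)%C * u.

(** The restriction on t is for z0 = 0, where the chart is t + i s: this part of the square is in
    the sector, and the graph is found inside it. *)
Hypothesis sect_chart : forall s t, `|s| < r -> `|t| < r -> - (`|s| / 2) <= t ->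
  sect (chart s t).

Lemma normJ : normc J = 1.
Proof. by rewrite /= expr0n expr1n add0r sqrtr1. Qed.

Lemma chart_dist s t : `|s| < r -> `|t| < r -> normc (chart s t - z0) <= 50^-1.
Proof.
move=> hs ht; have h := r1; rewrite /chart.
have -> : z0 + (s%:C)%C * (J * u) + (t%:C)%C * u - z0 = (s%:C)%C * (J * u) + (t%:C)%C * u.
  by ring.
apply: le_trans (le_normcD _ _) _.
by rewrite !normcM !normc_real normJ u1 !mulr1; lra.
Qed.

Lemma chart_le3 s t : `|s| < r -> `|t| < r -> normc (chart s t) <= 3.
Proof.
move=> hs ht; have := chart_dist hs ht; have h := z03.
by have := le_normcD (chart s t - z0) z0; rewrite subrK; lra.
Qed.

(** For the identity at z = w = z0, [PP] is the conjugate of 2 (z0 - 1) = - 2 d u, so the normal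
    component is - 2 d, near - 2, and the tangential one is 0. The errors 1/6 from [Phi] and 1/25
    from the displacement add up to less than 1/4. *)
Lemma PP_chart z w : sect z -> sect w -> normc z <= 3 -> normc w <= 3 ->
  normc (z - z0) <= 50^-1 -> normc (w - z0) <= 50^-1 ->
  `|Re (J * u * PP z w)| <= 1/4 /\ - 3 <= Re (u * PP z w) <= - (3/2).
Proof.
move=> sz sw z3 w3 zz wz; have h := PP_near k0 ka sz sw z3 w3.
have h2 : normc (PP z w - conjc (2 * (z0 - 1))) <= 6^-1 + 25^-1.
  have -> : PP z w - conjc (2 * (z0 - 1)) = (PP z w - conjc (z - 1 + (w - 1))) +
      conjc ((z - z0) + (w - z0)).
    have E : z - z0 + (w - z0) = (z - 1 + (w - 1)) + - (2 * (z0 - 1)) by ring.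
    have F : conjc (z - z0 + (w - z0)) = conjc (z - 1 + (w - 1)) - conjc (2 * (z0 - 1)).
      by rewrite E cconjD; congr (_ + _); exact: rmorphN.
    by rewrite F; ring.
  apply: le_trans (le_normcD _ _) _; rewrite normc_conj.
  by have := le_normcD (z - z0) (w - z0); lra.
have uu : u * conjc (2 * (z0 - 1)) = ((-2 * d)%:C)%C.
  have uc : u * conjc u = 1.
    apply: eq_ReIm; first by rewrite Re_mul_conj u1 expr1n.
    by case: (u) => p q /=; ring.
  rewrite z0u; transitivity (((-2 * d)%:C)%C * (u * conjc u)); last by rewrite uc mulr1.
  rewrite (_ : 2 * (- (d%:C)%C * u) = ((-2 * d)%:C)%C * u); last first.
    by rewrite !rmorphM /= rmorphN rmorphMn; ring.
  by rewrite cconjM conjc_real mulrCA.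
have e1 : normc (u * PP z w - ((-2 * d)%:C)%C) <= 6^-1 + 25^-1.
  by rewrite -uu -mulrBr normcM u1 mul1r.
have e2 : normc (J * u * PP z w - J * ((-2 * d)%:C)%C) <= 6^-1 + 25^-1.
  by rewrite -uu -mulrA -mulrBr -mulrBr !normcM normJ u1 !mul1r.
have q1 := d1; have q2 := d2; split.
  have := Re_le_normc (J * u * PP z w - J * ((-2 * d)%:C)%C).
  rewrite cReD cReN [Re (J * (_)%:C)%C](_ : _ = 0); last by rewrite /=; ring.
  by rewrite subr0; lra.
have := Re_le_normc (u * PP z w - ((-2 * d)%:C)%C).
rewrite cReD cReN /= ler_norml => /andP[b1 b2].
by apply/andP; split; lra.
Qed.

(** [m] is the defining function in the chart, and [A] and [B] are its tangential and normal divided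
    differences: [mB] is a first-order expansion without remainder. *)
Let m s t := normc (Phi (chart s t) - 1) ^+ 2.
Let A s t s' t' := Re (J * u * PP (chart s t) (chart s' t')).
Let B s t s' t' := Re (u * PP (chart s t) (chart s' t')).

Local Lemma mB s t s' t' : sect (chart s t) -> sect (chart s' t') ->
  m s t - m s' t' = (s - s') * A s t s' t' + (t - t') * B s t s' t'.
Proof.
move=> h h'; rewrite /m Phi_sqrB//.
have -> : chart s t - chart s' t' = ((s - s')%:C)%C * (J * u) + ((t - t')%:C)%C * u.
  by rewrite /chart !rmorphB /=; ring.
by rewrite mulrDl cReD -!mulrA !Re_mulr_real /A /B mulrA.
Qed.

Local Lemma AB s t s' t' : `|s| < r -> `|t| < r -> `|s'| < r -> `|t'| < r ->
  sect (chart s t) -> sect (chart s' t') ->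
  `|A s t s' t'| <= 1/4 /\ - 3 <= B s t s' t' <= - (3/2).
Proof.
move=> hs ht hs' ht' h h'; apply: PP_chart => //; try exact: chart_le3;
  exact: chart_dist.
Qed.

Local Lemma m00 : m 0 0 = 1.
Proof. by rewrite /m /chart !mul0r !addr0 Pz0 expr1n. Qed.

Local Lemma domE s t : `|s| < r -> `|t| < r -> sect (chart s t) ->
  (normc (Phi (chart s t) - 1) < 1) = (m s t < 1).
Proof.
move=> _ _ _; rewrite /m -[X in _ = (_ < X)](expr1n _ 2).
by rewrite ltr_pXn2r ?nnegrE ?normc_ge0.
Qed.

(** Moving by |s| / 2 along the normal changes [m] by at least 3 |s| / 4, moving by s along the
    tangent by at most |s| / 4. Hence [m] is at least 1 at the lower end, at most 1 at the upper
    end, and the intermediate value theorem applies. *)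
Lemma graph_exists s : `|s| < r -> exists2 t, `|t| <= `|s| / 2 & m s t = 1.
Proof.
move=> hs; have n0 := normr_ge0 s; have rr := r0.
have box t : - (`|s| / 2) <= t <= `|s| / 2 -> `|t| < r /\ sect (chart s t).
  move=> /andP[t1 t2]; have tr : `|t| < r by rewrite ltr_norml; apply/andP; split; lra.
  by split => //; apply: sect_chart.
have s0 : sect (chart 0 0) by apply: sect_chart; rewrite ?normr0//; lra.
have c0 : `|0 : R| < r by rewrite normr0.
have cw : {within `[- (`|s| / 2), `|s| / 2], continuous (m s)}.
  apply/subspace_continuousP => t; rewrite /= in_itv /= => tb.
  have [tr st] := box _ tb.
  apply/cvgrPdist_le => e e0.
  have nd : \forall t' \near t, `|t - t'| <= e / 3.
    apply: (@cvgr_dist_le _ _ _ _ _ _ _ (@cvg_id _ (nbhs t)) (e / 3)).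
    by rewrite divr_gt0.
  apply: filterS nd => t' tt'; rewrite /= in_itv /= => tb'.
  have [tr' st'] := box _ tb'.
  rewrite mB// subrr mul0r add0r normrM.
  have [_ /andP[b1 b2]] := AB hs tr hs tr' st st'.
  have : `|B s t s t'| <= 3 by rewrite ler_norml; apply/andP; split; lra.
  move=> b3; apply: (@le_trans _ _ (e / 3 * 3)); last by rewrite divfK.
  by apply: ler_pM.
have [|lo slo] := box (- (`|s| / 2)); first by apply/andP; split; lra.
have [|hi shi] := box (`|s| / 2); first by apply/andP; split; lra.
have := mB slo s0; rewrite m00 !subr0 => e1.
have := mB shi s0; rewrite m00 !subr0 => e2.
have [a1 /andP[b1 b1']] := AB hs lo c0 c0 slo s0.
have [a2 /andP[b2 b2']] := AB hs hi c0 c0 shi s0.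
have sA (x : R) : `|x| <= 1/4 -> `|s * x| <= `|s| * (1/4).
  by move=> hx; rewrite normrM ler_wpM2l.
have /ler_normlP[f1 f2] := sA _ a1; have /ler_normlP[f3 f4] := sA _ a2.
have g1 : 1 <= m s (- (`|s| / 2)) by nra.
have g2 : m s (`|s| / 2) <= 1 by nra.
have [||t] := @IVT R (m s) (- (`|s| / 2)) (`|s| / 2) 1 _ cw.
- by lra.
- by rewrite ge_min le_max g1 g2 orbT.
rewrite in_itv /= => /andP[t1 t2] mt; exists t => //.
by rewrite ler_norml t1 t2.
Qed.

Section graph_function.
Variable g : R -> R.
Hypothesis gP : forall s, `|s| < r -> `|g s| <= `|s| / 2 /\ m s (g s) = 1.

Local Lemma g_box s : `|s| < r -> `|g s| < r /\ sect (chart s (g s)).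
Proof.
move=> hs; have [gs _] := gP hs; have n0 := normr_ge0 s; have rr := r0.
have gr : `|g s| < r by lra.
by split=> //; apply: sect_chart => //; have /ler_normlP[] := gs; lra.
Qed.

Lemma graph_dom s t : `|s| < r -> `|t| < r ->
  [/\ sect (chart s t), normc (chart s t) <= 3 & normc (Phi (chart s t) - 1) < 1] <->
  g s < t.
Proof.
move=> hs ht; have [gs sgs] := g_box hs; have [gs2 mg] := gP hs; split.
  move=> [st _]; rewrite domE// => m1.
  have := mB st sgs; rewrite mg subrr mul0r add0r => e.
  have [_ /andP[b1 b2]] := AB hs ht hs gs st sgs.
  by rewrite ltNge; apply/negP => tg; nra.
move=> gt; have st : sect (chart s t).
  by apply: sect_chart => //; have /ler_normlP[] := gs2; lra.
split => //; first exact: chart_le3.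
rewrite domE//; have := mB st sgs; rewrite mg subrr mul0r add0r => e.
have [_ /andP[b1 b2]] := AB hs ht hs gs st sgs.
by nra.
Qed.

Let Zg s := chart s (g s).
(** Implicit differentiation on divided differences: [m] is constant along the graph, so (s - t) A +
    (g s - g t) B = 0. *)
Let slope s t := - A s (g s) t (g t) / B s (g s) t (g t).

Local Lemma g_slope s t : `|s| < r -> `|t| < r ->
  g s - g t = (s - t) * slope s t /\ `|slope s t| <= 1.
Proof.
move=> hs ht; have [gs sgs] := g_box hs; have [gt sgt] := g_box ht.
have [_ mgs] := gP hs; have [_ mgt] := gP ht.
have := mB sgs sgt; rewrite mgs mgt subrr => e.
have [a1 /andP[b1 b2]] := AB hs gs ht gt sgs sgt.
have B0 : B s (g s) t (g t) != 0 by apply/negP => /eqP b0; move: b2; rewrite b0; lra.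
rewrite /slope; split.
  apply: (mulIf B0); rewrite -[in RHS]mulrA divfK//; lra.
rewrite normrM normrN normfV ler_pdivrMr ?normr_gt0// mul1r.
apply: le_trans a1 _; rewrite ler_normr; apply/orP; right; lra.
Qed.

Local Lemma g_lip s t : `|s| < r -> `|t| < r -> `|g s - g t| <= `|s - t|.
Proof.
by move=> hs ht; have [-> h] := g_slope hs ht; rewrite normrM ler_piMr.
Qed.

Local Lemma Zg_lip s t : `|s| < r -> `|t| < r -> normc (Zg s - Zg t) <= 2 * `|s - t|.
Proof.
move=> hs ht; rewrite /Zg /chart.
rewrite [X in normc X](_ : _ = ((s - t)%:C)%C * (J * u) + ((g s - g t)%:C)%C * u); last first.
  by rewrite !rmorphB /=; ring.
apply: le_trans (le_normcD _ _) _.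
rewrite !normcM !normc_real normJ u1 !mulr1 mulr_natl mulr2n lerD2l.
exact: g_lip.
Qed.

Local Lemma near_box s : `|s| < r -> \forall h \near (0:R), `|h + s| < r.
Proof.
move=> hs; have : (fun h : R => `|h + s|) @ (0:R) --> `|s|.
  by apply: cvg_norm; exact: cvg_shift0.
by move=> h; apply: cvgr_lt h _ hs.
Qed.

Local Lemma cvgc_Zg s : `|s| < r -> cvgc (nbhs (0:R)) (fun h => Zg (h + s)) (Zg s).
Proof.
move=> hs; apply: (@cvgc_squeeze _ _ _ _ _ _ (fun h => 2 * `|h|)).
  have : (fun h : R => 2 * `|h|) @ (0:R) --> 2 * `|0 : R|.
    by apply: cvgM; [exact: cvg_cst|apply: cvg_norm; exact: cvg_id].
  by rewrite normr0 mulr0.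
apply: filterS (near_box hs) => h hh.
by have := Zg_lip hh hs; rewrite addrK.
Qed.

Local Lemma near_sect_Zg s : `|s| < r -> \forall h \near (0:R), sect (Zg (h + s)).
Proof. by move=> hs; apply: filterS (near_box hs) => h /g_box[]. Qed.

Local Lemma cvgc_PP_Zg s : `|s| < r ->
  cvgc (nbhs (0:R)) (fun h => PP (Zg (h + s)) (Zg s)) (PP (Zg s) (Zg s)).
Proof.
move=> hs; have [_ sg] := g_box hs.
have c1 := cvgc_Zg hs; have n1 := near_sect_Zg hs.
apply: cvgcM.
  apply: cvgc_PQ => //; last exact: cvgc_cst.
  by apply: (@filterE _ (nbhs (0:R))).
apply: cvgc_conj; apply: cvgcD; last exact: cvgc_cst.
by apply: cvgcB; [exact: cvgc_Phi|exact: cvgc_cst].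
Qed.

Local Lemma slope_cvg s : `|s| < r -> (fun h => slope (h + s) s) @ (0:R) --> slope s s.
Proof.
move=> hs; have [gs sg] := g_box hs; have cP := cvgc_PP_Zg hs.
have [a1 /andP[b1 b2]] := AB hs gs hs gs sg sg.
have B0 : B s (g s) s (g s) != 0 by apply/negP => /eqP b0; move: b2; rewrite b0; lra.
have [cA _] : cvgc (nbhs (0:R)) (fun h => J * u * PP (Zg (h + s)) (Zg s)) (J * u * PP (Zg s) (Zg s)).
  by apply: cvgcM => //; exact: cvgc_cst.
have [cB _] : cvgc (nbhs (0:R)) (fun h => u * PP (Zg (h + s)) (Zg s)) (u * PP (Zg s) (Zg s)).
  by apply: cvgcM => //; exact: cvgc_cst.
by apply: cvgM; [exact: cvgN|exact: cvgV].
Qed.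

Local Lemma cderiv1_g s : `|s| < r ->
  cderiv1 (fun t => ((g t)%:C)%C) s (((slope s s))%:C)%C.
Proof.
move=> hs; exists (fun h => ((slope (h + s) s)%:C)%C); split.
  apply: filterS (near_box hs) => h hh; rewrite -rmorphB -rmorphM /=.
  by have [-> _] := g_slope hh hs; rewrite addrK.
by apply: cvgc_real; exact: slope_cvg.
Qed.

Let Zg' s := J * u + ((slope s s)%:C)%C * u.

Local Lemma cderiv1_rtX e s : (2 ^ k < e)%N -> `|s| < r ->
  cderiv1 (fun t => rt k (Zg t) ^+ e) s
    ((e%:R / (2 ^ k)%:R) * rt k (Zg s) ^+ (e - 2 ^ k) * Zg' s).
Proof.
move=> ke hs; have [_ sg] := g_box hs; have e0 : (0 < e)%N by apply: leq_ltn_trans ke.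
rewrite -pq_diag//.
exists (fun h => pq k e (Zg (h + s)) (Zg s) * (J * u + ((slope (h + s) s)%:C)%C * u)); split.
  apply: filterS (near_box hs) => h hh; have [_ sh] := g_box hh.
  rewrite pqE// (_ : Zg (h + s) - Zg s = (h%:C)%C * (J * u + ((slope (h + s) s)%:C)%C * u)).
    by ring.
  have [eg _] := g_slope hh hs; rewrite addrK in eg.
  have -> : Zg (h + s) - Zg s =
      (((h + s) - s)%:C)%C * (J * u) + ((g (h + s) - g s)%:C)%C * u.
    by rewrite /Zg /chart !rmorphB /=; ring.
  by rewrite addrK eg rmorphM /=; ring.
apply: cvgcM.
  apply: cvgc_pq => //; [exact: near_sect_Zg|exact: cvgc_Zg| |exact: cvgc_cst].
  by apply: (@filterE _ (nbhs (0:R))).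
apply: cvgcD; first exact: cvgc_cst.
apply: cvgcM; last exact: cvgc_cst.
by apply: cvgc_real; exact: slope_cvg.
Qed.

Variables (N : nat) (th : R).
Hypotheses (N3 : (3 <= N)%N) (aN : a = (N * 2 ^ k - 1)%N).
Hypotheses (th0 : 0 < th) (th1 : th < 1) (kth : 1 <= (2 ^ k)%:R * (1 - th)).

Local Notation I := `](- r), r[%classic.
Let expo i := ((N - i) * 2 ^ k - 1)%N.
(** The power of exponent alpha - i along the boundary: differentiating raises i by one. *)
Let Ai i s := rt k (Zg s) ^+ expo i.

Local Lemma r2 : r * 2 <= 1. Proof. by have h := r1; lra. Qed.

Local Lemma I_norm s : I s -> `|s| < r.
Proof. by move=> /IP[s1 s2]; rewrite ltr_norml s1 s2. Qed.

Local Lemma expoS i : (i < N.-1)%N -> (2 ^ k < expo i)%N /\ (expo i - 2 ^ k = expo i.+1)%N.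
Proof.
by move=> iN; exact: exponent_step.
Qed.

(** For i < N - 1 the exponent exceeds 1 and the bounded divided difference gives a Lipschitz
    function. For i = N - 1 the exponent is 1 - 2 ^ -k, and the choice of k relative to th
    enters. *)
Local Lemma creg0_Ai i : (i <= N.-1)%N -> creg r th 0 (Ai i).
Proof.
move=> iN; have [iN1|Ni] := ltnP i N.-1.
  have [ke _] := expoS iN1.
  apply: (creg0_lip r2 th1 (C := 2 * (((expo i)%:R * 2 ^+ k * 3 ^+ expo i)))) => s t Is It.
  have hs := I_norm Is; have ht := I_norm It.
  have [gs sg] := g_box hs; have [gt tg] := g_box ht.
  rewrite /Ai pqE// normcM mulrAC; apply: ler_pM; rewrite ?normc_ge0//; first exact: Zg_lip.
  apply: le_trans (normc_pq_le sg tg k0 (ltnW ke)) _.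
  rewrite ler_wpM2l ?mulr_ge0 ?exprn_ge0//.
  apply: (@le_trans _ _ (3 ^+ (expo i - 2 ^ k))).
    apply: lerXn2r; rewrite ?nnegrE ?le_max ?normc_ge0// ge_max.
    by rewrite !normc_rt_le3// chart_le3.
  by apply: ler_weXn2l; [lra|exact: leq_subr].
have -> : i = N.-1 by apply/eqP; rewrite eqn_leq iN Ni.
have [C hC] := normc_sqrtnB_holder k0 th0 th1 kth.
exists (`|C| * 2 `^ th) => s t Is It; have hs := I_norm Is; have ht := I_norm It.
have [gs sg] := g_box hs; have [gt tg] := g_box ht.
have -> : Ai N.-1 = fun s => rt k (Zg s) ^+ (2 ^ k - 1).
  by apply/funext => x; rewrite /Ai /expo; have [-> _] := subn_pred N3; rewrite mul1n.
apply: le_trans (hC _ _ sg tg (chart_le3 hs gs) (chart_le3 ht gt)) _.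
apply: le_trans (ler_wpM2r (powR_ge0 _ _) (ler_norm C)) _.
rewrite -mulrA ler_wpM2l// -powRM//.
apply: ge0_ler_powR; rewrite ?nnegrE ?normc_ge0 ?(ltW th0) ?mulr_ge0//.
exact: Zg_lip.
Qed.

(** Bootstrap by a simultaneous induction. The derivative of [g] is a rational expression in the
    curve, [Ai 0], [Ai 1] and conjugates; that of [Ai i] is a multiple of [Ai i.+1] times the
    derivative of the curve. The supply of powers ends at i = N - 1, hence the order N - 1 for
    [g]. *)
Lemma graph_regular n : (n <= N.-1)%N -> creg r th n (fun t => ((g t)%:C)%C).
Proof.
suff main : (n <= N.-1)%N -> creg r th n (fun t => ((g t)%:C)%C) /\
    forall i, (i <= N.-1)%N -> creg r th (minn n (N.-1 - i)) (Ai i).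
  by move=> /main[].
elim: n => [_|n ih nN].
  split; last by move=> i iN; rewrite min0n; exact: creg0_Ai.
  apply: (creg0_lip r2 th1 (C := 1)) => s t Is It.
  by rewrite -rmorphB normc_real mul1r; apply: g_lip; exact: I_norm.
have [rg rA] := ih (ltnW nN).
have RC c := @creg_cst R r th r2 th1 n c.
have RM := @cregM R r th r0 r2 th0 th1 n; have RD := @cregD R r th n.
have rZ : creg r th n Zg.
  apply: (RD); last by apply: (RM) => //; exact: RC.
  by apply: (RD); [exact: RC|apply: (RM); [exact: (creg_id r2 th1)|exact: RC]].
have rA0 : creg r th n (Ai 0).
  by have := rA 0%N isT; rewrite subn0 (minn_idPl _)// ltnW.
have rA1 : creg r th n (Ai 1).
  have [_ h1] := subn_pred N3.
  by have := rA 1%N h1; rewrite (minn_idPl (leq_subn1 nN)).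
have rPP : creg r th n (fun s => PP (Zg s) (Zg s)).
  (* On the diagonal [PP] is Phi' times the conjugate of 2 (Phi - 1), which involves only [Ai 1] and
     [Ai 0]. *)
  have E : (fun s => PP (Zg s) (Zg s)) = (fun s =>
      (1 + ((ccoef R k a)%:C)%C * (a%:R / (2 ^ k)%:R) * Ai 1 s) *
      conjc (2 * (Zg s + ((ccoef R k a)%:C)%C * Ai 0 s + -1))).
    have ka' : (2 ^ k < a)%N by exact: expn2k_lt.
    have a0 : (0 < a)%N by exact: leq_ltn_trans ka'.
    apply/funext => s; rewrite /PP /PQ pq_diag//; congr (_ * _).
      rewrite -mulrA -[in RHS]mulrA; congr (1 + _ * _); rewrite mulrA; congr (_ * _).
      congr (_ ^+ _).
      by rewrite aN /expo mulnBl mul1n subnAC.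
    congr conjc; rewrite /Phi /Ai (_ : expo 0 = a); last by rewrite /expo subn0 aN.
    by ring.
  rewrite E; apply: (RM).
    by apply: (RD); [exact: RC|apply: (RM) => //; exact: RC].
  apply: creg_conj; apply: (RM); first exact: RC.
  apply: (RD); last exact: RC.
  by apply: (RD) => //; apply: (RM) => //; exact: RC.
have rs : creg r th n (fun s => ((slope s s)%:C)%C).
  have E : (fun s => ((slope s s)%:C)%C) = (fun s =>
     -1 * ((Re (J * u * PP (Zg s) (Zg s)))%:C)%C *
       (((Re (u * PP (Zg s) (Zg s)))%:C)%C)^-1).
    by apply/funext => s; rewrite /slope rmorphM rmorphN fmorphV /= mulN1r.
  rewrite E; apply: (RM).
    apply: (RM); first exact: RC.
    by apply: (creg_Re r0 r2 th0 th1); apply: (RM) => //; exact: RC.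
  apply: (cregV r0 r2 th0 th1 (m := 1)) => //.
    move=> s /I_norm hs; have [gs sg] := g_box hs.
    have [_ /andP[b1 b2]] := AB hs gs hs gs sg sg.
    by rewrite normc_real ler_normr; apply/orP; right; move: b2; rewrite /B -/(Zg s); lra.
  by apply: (creg_Re r0 r2 th0 th1); apply: (RM) => //; exact: RC.
split.
  by exists (fun s => ((slope s s)%:C)%C) => // s /I_norm; exact: cderiv1_g.
move=> i iN; have [iN1|Ni] := ltnP i N.-1; last first.
  have -> : (N.-1 - i = 0)%N by apply/eqP; rewrite subn_eq0.
  by rewrite minn0; exact: creg0_Ai.
have [ke eS] := expoS iN1.
rewrite (minn_step n iN1).
exists (fun s => ((expo i)%:R / (2 ^ k)%:R) * Ai i.+1 s * Zg' s).
  by move=> s /I_norm hs; rewrite /Ai -eS; exact: cderiv1_rtX.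
set q := minn _ _; have qn : (q <= n)%N by exact: geq_minl.
have RM' := @cregM R r th r0 r2 th0 th1 q.
apply: (RM').
  by apply: (RM'); [exact: (@creg_cst R r th r2 th1)|exact: rA].
apply: (creg_le r0 r2 th0 th1 qn); apply: (RD); first exact: RC.
by apply: (RM) => //; exact: RC.
Qed.

End graph_function.

End boundary_graph.

Section boundary_of_graph.
Variables (R : realType) (D : set (R * R)) (x0 nu : R * R) (r : R) (g : R -> R).
Hypotheses (oD : open D) (nu1 : dot nu nu = 1).
Local Notation tau := (- nu.2, nu.1).
Local Notation pt := (fun s t : R => x0 + s *: tau + t *: nu).
Hypothesis cg : forall s, `|s| < r -> {for s, continuous g}.
Hypothesis Dg : forall s t, `|s| < r -> `|t| < r -> D (pt s t) <-> g s < t.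

(** By continuity of [g], a point below the graph has a neighbourhood below it, hence outside D; a
    point on the graph is a limit of points of D along [nu]. *)
Lemma boundary_of_graph s t : `|s| < r -> `|t| < r ->
  boundary D (pt s t) <-> t = g s.
Proof.
move=> hs ht; have nD : interior D = D by apply/interior_id.
rewrite /boundary nD; split=> [[cl nDx]|tg].
  have [gt|gt] := ltP (g s) t; first by exfalso; apply: nDx; exact/Dg.
  have [//|tg] := eqVneq t (g s).
  have {}tg : t < g s by rewrite lt_neqAle tg.
  exfalso; pose sc y := dot (y - x0) tau; pose tc y := dot (y - x0) nu.
  have nu1' : nu.1 * nu.1 + nu.2 * nu.2 = 1 by [].
  have ysc y : y = pt (sc y) (tc y).
    rewrite /sc /tc /dot; case: y => y1 y2; case: (x0) => a1 a2 /=.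
    congr (_, _).
      suff h : y1 = a1 + ((y1 - a1) * - nu.2 + (y2 - a2) * nu.1) * - nu.2 +
        ((y1 - a1) * nu.1 + (y2 - a2) * nu.2) * nu.1 by exact: h.
      transitivity (a1 + (y1 - a1) * (nu.1 * nu.1 + nu.2 * nu.2)); last by ring.
      by rewrite nu1' mulr1 addrC subrK.
    suff h : y2 = a2 + ((y1 - a1) * - nu.2 + (y2 - a2) * nu.1) * nu.1 +
      ((y1 - a1) * nu.1 + (y2 - a2) * nu.2) * nu.2 by exact: h.
    transitivity (a2 + (y2 - a2) * (nu.1 * nu.1 + nu.2 * nu.2)); last by ring.
    by rewrite nu1' mulr1 addrC subrK.
  have scE : sc (pt s t) = s.
    rewrite /sc /dot /=; case: (x0) => a1 a2 /=.
    suff h : (a1 + s * - nu.2 + t * nu.1 - a1) * - nu.2 +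
      (a2 + s * nu.1 + t * nu.2 - a2) * nu.1 = s by exact: h.
    transitivity (s * (nu.1 * nu.1 + nu.2 * nu.2)); first by ring.
    by rewrite nu1' mulr1.
  have tcE : tc (pt s t) = t.
    rewrite /tc /dot /=; case: (x0) => a1 a2 /=.
    suff h : (a1 + s * - nu.2 + t * nu.1 - a1) * nu.1 +
      (a2 + s * nu.1 + t * nu.2 - a2) * nu.2 = t by exact: h.
    transitivity (t * (nu.1 * nu.1 + nu.2 * nu.2)); first by ring.
    by rewrite nu1' mulr1.
  have cdot v : (fun y => dot (y - x0) v) @ pt s t --> dot (pt s t - x0) v.
    apply: cvgD; apply: cvgM; try exact: cvg_cst.
      by apply: (@cvgB _ _ _ _ _ (fun y : R * R => y.1)); [exact: cvg_fst|exact: cvg_cst].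
    by apply: (@cvgB _ _ _ _ _ (fun y : R * R => y.2)); [exact: cvg_snd|exact: cvg_cst].
  have csc : sc y @[y --> pt s t] --> s by rewrite -{2}scE; exact: cdot.
  have ctc : tc y @[y --> pt s t] --> t by rewrite -{2}tcE; exact: cdot.
  have n1 : \forall y \near pt s t, `|sc y| < r.
    have h : `|sc y| @[y --> pt s t] --> `|s| by exact: cvg_norm.
    exact: cvgr_lt h _ hs.
  have n2 : \forall y \near pt s t, `|tc y| < r.
    have h : `|tc y| @[y --> pt s t] --> `|t| by exact: cvg_norm.
    exact: cvgr_lt h _ ht.
  have n3 : \forall y \near pt s t, tc y - g (sc y) < 0.
    have h : tc y - g (sc y) @[y --> pt s t] --> t - g s.
      by apply: cvgB => //; apply: (@cvg_comp _ _ _ sc g _ _ _ csc); exact: cg.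
    by apply: cvgr_lt h _ _; rewrite subr_lt0.
  have [y [Dy [[y1 y2] y3]]] := cl _ (filterI (filterI n1 n2) n3).
  move: Dy; rewrite (ysc y) => /(Dg y1 y2); rewrite subr_lt0 in y3.
  by move=> /(lt_trans y3); rewrite ltxx.
split; last by move=> /(Dg hs ht); rewrite tg ltxx.
move=> B nB.
have nB' : \forall e \near (0:R), B (e *: nu + pt s t).
  exact: (@cvg_line _ _ (pt s t) nu _ nB).
have [e [e0 eB er]] : exists e : R, [/\ 0 < e, B (e *: nu + pt s t) & `|e + t| < r].
  have n1 : \forall e \near (0:R), `|e + t| < r.
    have h : (fun e : R => `|e + t|) @ (0:R) --> `|t|.
      by apply: cvg_norm; exact: cvg_shift0.
    exact: cvgr_lt h _ ht.
  have : \forall e \near (0:R)^'+, B (e *: nu + pt s t) /\ `|e + t| < r.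
    by apply: cvg_within; exact: filterI nB' n1.
  move=> h; have : \forall e \near (0:R)^'+,
      0 < e /\ (B (e *: nu + pt s t) /\ `|e + t| < r).
    by apply: filterI h; exact: nbhs_right_gt.
  by move=> /filter_ex [e [e0 [eB er]]]; exists e.
exists (e *: nu + pt s t); split => //.
have -> : e *: nu + pt s t = pt s (e + t) by rewrite /= scalerDl addrCA.
by apply/(Dg hs er); rewrite -tg ltrDr.
Qed.

End boundary_of_graph.

Lemma dot_rot (R : realType) (x : R * R) : dot (- x.2, x.1) (- x.2, x.1) = dot x x.
Proof. by rewrite /dot /=; ring. Qed.

Lemma dot_rot0 (R : realType) (x : R * R) : dot (- x.2, x.1) x = 0.
Proof. by rewrite /dot /=; ring. Qed.

Lemma exponent_ge k N : (0 < k)%N -> (3 <= N)%N -> (2 * 2 ^ k <= N * 2 ^ k - 1)%N.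
Proof.
move=> k0 N3; have := expn2_ge2 k0; case: N N3 => [|[|[|M]]] // _.
by rewrite !mulSn mul0n addn0 => h; lia.
Qed.

Section C_boundary_domain.
Variables (R : realType) (k N : nat) (th lambda : R).
Local Notation a := (N * 2 ^ k - 1)%N.
Local Notation n := (Num.truncn lambda).
Hypotheses (k0 : (0 < k)%N) (N3 : (3 <= N)%N).
Hypotheses (th0 : 0 < th) (th1 : th < 1) (kth : 1 <= (2 ^ k)%:R * (1 - th)).
Hypotheses (l0 : 0 <= lambda) (nN : (n <= N.-1)%N) (lth : lambda - n%:R <= th).

Local Notation dom := (@dom R k a).
Local Notation Phi := (@Phi R k a).

Lemma C_boundary_dom : C_boundary lambda dom.
Proof.
have ka := exponent_ge k0 N3.
move=> x0 bx; have [sz0 z03 Pz0] := boundary_dom k0 ka bx.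
set z0 := cx x0 in sz0 z03 Pz0.
have z03' : normc z0 <= 3 by lra.
have Pz1 : normc (Phi z0 - 1) <= 1 by rewrite Pz0.
have [Rz0 _] := sect_Phi_le k0 ka sz0 z03' Pz1.
pose d := normc (z0 - 1); pose u := - ((d^-1)%:C)%C * (z0 - 1).
have hd : `|d - 1| <= 40^-1.
  have := normc_dist (z0 - 1) (Phi z0 - 1); rewrite Pz0 => /le_trans; apply.
  rewrite (_ : _ - _ = z0 - Phi z0); last by ring.
  by rewrite normcB_sym; have := Phi_near k0 ka sz0 z03'; lra.
have /andP[d1 d2] : 39/40 <= d <= 41/40.
  by move: hd; rewrite ler_norml => /andP[]; lra.
have d0 : 0 < d by lra.
have u1 : normc u = 1.
  by rewrite /u normcM normcN normc_real ger0_norm ?invr_ge0 ?(ltW d0)// mulVf ?gt_eqF.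
have z0u : z0 - 1 = - (d%:C)%C * u.
  rewrite /u mulrA mulrNN -rmorphM /= divff ?gt_eqF//.
  by rewrite rmorph1 mul1r.
pose nu : R * R := (Re u, Im u).
have cnu : cx nu = u by apply: eq_ReIm.
have nn : dot nu nu = 1 by rewrite -[LHS]/(Re u * Re u + Im u * Im u) -!expr2 -normc_sqr u1 expr1n.
have chartE s t : cx (x0 + s *: (- nu.2, nu.1) + t *: nu) = chart z0 u s t.
  rewrite !cxD !cxZ cnu /chart; congr (_ + _ * _ + _).
  by apply: eq_ReIm; rewrite ?cReM ?cImM /=; ring.
have [r [r0 r1 sc]] : exists r : R, [/\ 0 < r, r <= 100^-1 & forall s t, `|s| < r ->
    `|t| < r -> - (`|s| / 2) <= t -> sect (chart z0 u s t)].
  (* At the branch point the axes are the coordinate axes and the radius is free. Elsewhere the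
     radius is proportional to |z0|, so that the chart moves by at most |z0| / 10 and stays in the
     sector. *)
  have [e0|e0] := eqVneq z0 0.
    have dE : d = 1 by rewrite /d e0 sub0r normcN normc1.
    have uE : u = 1 by rewrite /u dE e0 invr1 sub0r mulrNN mulr1.
    exists 100^-1; split => // s t hs ht st.
    have -> : chart z0 u s t = Complex t s.
      by rewrite /chart e0 uE; apply: eq_ReIm => /=; ring.
    apply/sectP => /=; have := Im_le_normc (Complex t s); rewrite /=.
    lra.
  have n0 : 0 < normc z0 by rewrite normc_gt0.
  exists (Num.min 100^-1 (normc z0 / 20)); split.
  - by rewrite lt_min; apply/andP; split; [rewrite invr_gt0|exact: divr_gt0].
  - by rewrite ge_min lexx.
  - move=> s t; rewrite !lt_min => /andP[_ hs] /andP[_ ht] _.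
    have dist : normc (chart z0 u s t - z0) <= normc z0 / 10.
      rewrite /chart.
      have -> : z0 + (s%:C)%C * (Complex 0 1 * u) + (t%:C)%C * u - z0 =
          (s%:C)%C * (Complex 0 1 * u) + (t%:C)%C * u by ring.
      apply: le_trans (le_normcD _ _) _.
      have nJu : normc (Complex 0 1 * u) = 1 by rewrite normcM normJ u1 mulr1.
      by rewrite (normcM (s%:C)%C) (normcM (t%:C)%C) nJu u1 !normc_real !mulr1; lra.
    apply/sectP; have := Re_ge_dist (chart z0 u s t) z0.
    have := le_normcB z0 (z0 - chart z0 u s t).
    rewrite (_ : z0 - (z0 - chart z0 u s t) = chart z0 u s t); last by ring.
    rewrite (normcB_sym z0).
    by lra.
have /choice [g gP] : forall s, exists t, `|s| < r -> `|t| <= `|s| / 2 /\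
    normc (Phi (chart z0 u s t) - 1) ^+ 2 = 1.
  move=> s; have [hs|hs] := pselect (`|s| < r); last by exists 0.
  have [t t1 t2] := graph_exists k0 ka z03 Pz0 u1 z0u d1 d2 r0 r1 sc hs.
  by exists t.
have domE s t : dom (x0 + s *: (- nu.2, nu.1) + t *: nu) <->
    [/\ sect (chart z0 u s t), normc (chart z0 u s t) <= 3 &
        normc (Phi (chart z0 u s t) - 1) < 1].
  rewrite -chartE; exact: iff_refl.
have Dg s t : `|s| < r -> `|t| < r ->
    dom (x0 + s *: (- nu.2, nu.1) + t *: nu) <-> g s < t.
  move=> hs ht; rewrite domE.
  exact: (graph_dom k0 ka z03 u1 z0u d1 d2 r0 r1 sc gP).
have rg : creg r th n (fun t => ((g t)%:C)%C).
  exact: (graph_regular k0 ka z03 u1 z0u d1 d2 r0 r1 sc gP N3 (erefl _) th0 th1 kth nN).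
have r2 : r * 2 <= 1 by lra.
have ll : 0 <= lambda - n%:R <= th by rewrite subr_ge0 lth andbT truncn_le.
have [D1 C1 H1] := Cholder_creg r2 th0 ll rg.
have rg0 := creg_le r0 r2 th0 th1 (leq0n _) rg.
have th00 : 0 <= th <= th by rewrite lexx ltW.
have [_ C0 _] := Cholder_creg r2 th0 th00 rg0.
exists (- nu.2, nu.1), nu, r, g; split.
  by split; rewrite ?dot_rot ?dot_rot0.
split => //.
move=> s t hs ht; apply: (boundary_of_graph (r := r)) => //.
  exact: (open_dom k0 ka).
move=> x hx; apply: C0; apply/IP; move: hx; rewrite ltr_norml => /andP[h1 h2]. by split.
Qed.

End C_boundary_domain.

(** * Integration in the plane *)

Section plane_measure.
Variable R : realType.
Implicit Types (f g : R * R -> R) (x y c v : R * R) (b M : R).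

Local Notation T2 := (measurableTypeR R * measurableTypeR R)%type.
Local Notation mu := (@mu2 R).

Definition box c b : set (R * R) := [set x | `|x - c| <= b].

Lemma boxE c b : box c b = `[c.1 - b, c.1 + b]%classic `*` `[c.2 - b, c.2 + b]%classic.
Proof.
apply/seteqP; split=> x; rewrite /box /= !in_itv /= prod_normE ge_max /= !ler_distl.
  by move=> /andP[-> ->].
by move=> [-> ->].
Qed.

Lemma measurable_box c b : measurable (box c b : set T2).
Proof. by rewrite boxE; apply: measurableX; exact: measurable_itv. Qed.

Lemma mu2_box c b : 0 <= b -> mu (box c b) = ((2 * b) ^+ 2)%:E.
Proof.
move=> b0; rewrite boxE; transitivity
  (lebesgue_measure (`[(c.1 - b)%R, (c.1 + b)%R]%classic : set R) *
   lebesgue_measure (`[(c.2 - b)%R, (c.2 + b)%R]%classic : set R))%E.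
  by apply: product_measure1E; exact: measurable_itv.
have E (t : R) : lebesgue_measure (`[t - b, t + b]%classic : set R) = (2 * b)%:E.
  rewrite lebesgue_measure_itv /= lte_fin; case: ifPn => h.
    by rewrite -EFinD; congr (_%:E); ring.
  have -> : b = 0 by apply/eqP; rewrite eq_le b0 andbT; move: h; rewrite -leNgt; lra.
  by rewrite mulr0.
by rewrite !E -EFinM expr2.
Qed.

(** An open set is the countable union of the closed boxes with rational centre and side 2 / (n + 1)
    that it contains. *)
Lemma open_measurable2 (O : set (R * R)) : open O -> measurable (O : set T2).
Proof.
move=> oO.
pose F (i : rat * rat * nat) : set (R * R) :=
  if `[< box (ratr i.1.1, ratr i.1.2) (i.2.+1%:R^-1) `<=` O >]
  then box (ratr i.1.1, ratr i.1.2) (i.2.+1%:R^-1) else set0.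
have -> : O = \bigcup_i F i.
  apply/seteqP; split => [x Ox|x [i _]]; last first.
    by rewrite /F; case: ifPn => // /asboolP h /h.
  have /nbhs_ballP[e /= e0 eO] := open_nbhs_nbhs (conj oO Ox).
  have [n ne] : exists n : nat, n.+1%:R^-1 < e / 2.
    have : \forall n \near \oo, n.+1%:R^-1 < e / 2.
      by apply: (near_infty_natSinv_lt (PosNum _)); rewrite divr_gt0.
    by move=> /filter_ex.
  have n0 : 0 < n.+1%:R^-1 :> R by rewrite invr_gt0.
  have rq (t : R) : exists q : rat, `|t - ratr q| <= n.+1%:R^-1.
    have [q] : exists q, (t - n.+1%:R^-1 < ratr q) && (ratr q < t + n.+1%:R^-1).
      have hh : t - n.+1%:R^-1 < t + n.+1%:R^-1.
        by rewrite ltrBlDr -addrA ltrDl addr_gt0.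
      have [q] := rat_in_itvoo hh.
      by rewrite in_itv /=; exists q.
    by move=> /andP[q1 q2]; exists q; rewrite distrC ler_distl; apply/andP; split; exact: ltW.
  have [q1 h1] := rq x.1; have [q2 h2] := rq x.2.
  exists (q1, q2, n) => //; rewrite /F.
  have xb : box (ratr q1, ratr q2) n.+1%:R^-1 x.
    by rewrite /box /= prod_normE ge_max /= h1 h2.
  case: ifPn => //= /asboolPn; apply: contra_notP => _ y yb; apply: eO.
  rewrite -ball_normE /= /ball_.
  have xb' : `|x - (ratr q1, ratr q2)| <= n.+1%:R^-1 := xb.
  have yb' : `|y - (ratr q1, ratr q2)| <= n.+1%:R^-1 := yb.
  have h3 : `|x - y| <= `|x - (ratr q1, ratr q2)| + `|y - (ratr q1, ratr q2)|.
    by rewrite (distrC y); apply: le_trans (ler_normD _ _); rewrite addrA subrK.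
  by apply: le_lt_trans h3 _; apply: le_lt_trans (lerD xb' yb') _; rewrite (splitr e) ltrD.
apply: countable_bigcupT_measurable; first exact: countableP.
by move=> i; rewrite /F; case: ifPn => // _; exact: measurable_box.
Qed.

Definition mfun2 (O : set (R * R)) f := measurable_fun (O : set T2) (f : T2 -> R).

Lemma continuous_mfun2 (O : set (R * R)) f : open O ->
  (forall x, O x -> {for x, continuous f}) -> mfun2 O f.
Proof.
move=> oO cf; apply: (measurability _ (RGenOpens.measurableE R)).
move=> _ [_ [a [b ->] <-]].
have -> : O `&` f @^-1` `]a, b[%classic = O `&` interior (f @^-1` `]a, b[%classic).
  apply/seteqP; split => [x [Ox fx]|x [Ox /interior_subset fx]]; split => //.
  by apply: (cf _ Ox); apply: open_nbhs_nbhs; split => //; exact: interval_open.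
by apply: open_measurable2; apply: openI => //; exact: open_interior.
Qed.

Lemma continuous_mfunT f : (forall x, {for x, continuous f}) -> mfun2 setT f.
Proof. by move=> cf; apply: continuous_mfun2 => //; exact: openT. Qed.

(** This class is stable under translations, differences and products with bounded measurable
    functions, and all its members are integrable; it removes integrability side conditions from
    what follows. *)
Definition bsup f := mfun2 setT f /\
  exists b M, [/\ 0 <= b, 0 <= M, forall x, `|f x| <= M & forall x, b < `|x| -> f x = 0].

Lemma bsup_integrable f : bsup f -> mu.-integrable setT (EFin \o f).
Proof.
move=> [mf [b [M [b0 M0 fM fb]]]].
have ic : mu.-integrable setT (EFin \o (fun x => M * \1_(box 0 b) x)).
  have i1 : mu.-integrable setT (EFin \o \1_(box 0 b)).
    have mb := measurable_box 0 b; apply/integrableP; split.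
      by apply/measurable_EFinP; exact: measurable_indic.
    apply: (@le_lt_trans _ _ (\int[mu]_x (\1_(box 0 b) x)%:E)%E).
      rewrite le_eqVlt; apply/orP; left; apply/eqP.
      by apply: eq_integral => x _; rewrite gee0_abs// lee_fin.
    by have := @integral_indic _ _ _ mu setT measurableT (box 0 b) mb;
      rewrite setIT mu2_box// => ->; rewrite ltry.
  have := @integrableZl _ _ _ mu setT measurableT M _ i1.
  by apply: eq_integrable => // x _; rewrite /= EFinM.
apply: le_integrable ic => //; first exact/measurable_EFinP.
move=> x _ /=; rewrite lee_fin normrM indicE (ger0_norm M0).
have [xb|xb] := leP `|x| b.
  have -> : x \in box 0 b by rewrite inE /box /= subr0.
  by rewrite normr1 mulr1.
by rewrite fb// normr0 mulr_ge0.
Qed.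

Lemma bsupM f g M : bsup f -> mfun2 setT g -> (forall x, `|g x| <= M) ->
  bsup (fun x => f x * g x).
Proof.
move=> [mf [b [L [b0 L0 fL fb]]]] mg gM; split; first exact: measurable_funM.
exists b, (L * M); split => //.
- by rewrite mulr_ge0// (le_trans _ (gM 0)).
- by move=> x; rewrite normrM ler_pM.
- by move=> x /fb ->; rewrite mul0r.
Qed.

Lemma bsupZ f (r : R) : bsup f -> bsup (fun x => r * f x).
Proof.
move=> [mf [b [L [b0 L0 fL fb]]]]; split.
  by apply: measurable_funM => //; exact: measurable_cst.
exists b, (`|r| * L); split => //; first by rewrite mulr_ge0.
- by move=> x; rewrite normrM ler_wpM2l.
- by move=> x /fb ->; rewrite mulr0.
Qed.

Lemma bsupD f g : bsup f -> bsup g -> bsup (fun x => f x + g x).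
Proof.
move=> [mf [b [L [b0 L0 fL fb]]]] [mg [b' [M [b0' M0 gM gb]]]]; split.
  exact: measurable_funD.
exists (Num.max b b'), (L + M); split.
- by rewrite le_max b0.
- exact: addr_ge0.
- by move=> x; apply: le_trans (ler_normD _ _) _; exact: lerD.
- by move=> x; rewrite gt_max => /andP[/fb -> /gb ->]; rewrite addr0.
Qed.

Lemma bsupB f g : bsup f -> bsup g -> bsup (fun x => f x - g x).
Proof.
move=> hf hg; have := bsupD hf (bsupZ (-1) hg).
by under eq_fun do rewrite mulN1r.
Qed.

Lemma measurable_shift v : measurable_fun [set: T2] ((fun x => v + x) : T2 -> T2).
Proof.
have m1 : measurable_fun [set: T2] (fun x : T2 => (v.1 + x.1 : measurableTypeR R)).
  by apply: measurable_funD; [exact: measurable_cst|exact: measurable_fst].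
have m2 : measurable_fun [set: T2] (fun x : T2 => (v.2 + x.2 : measurableTypeR R)).
  by apply: measurable_funD; [exact: measurable_cst|exact: measurable_snd].
exact: (measurable_fun_pair m1 m2).
Qed.

Lemma bsup_shift f v : bsup f -> bsup (fun x => f (v + x)).
Proof.
move=> [mf [b [M [b0 M0 fM fb]]]]; split.
  exact: (measurableT_comp mf (measurable_shift v)).
exists (b + `|v|), M; split => //; first exact: addr_ge0.
move=> x bx; apply: fb; have := lerB_normD v x; rewrite (addrC v) => h.
have := ler_normB (x + v) v; rewrite addrK; rewrite addrC; lra.
Qed.

End plane_measure.

Section plane_integral.
Variable R : realType.
Implicit Types (f g : R * R -> R) (x y c v : R * R) (b M : R).

Local Notation T2 := (measurableTypeR R * measurableTypeR R)%type.
Local Notation mu := (@mu2 R).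

Lemma measurable_shift1 (a : R) :
  measurable_fun [set: measurableTypeR R] (fun t : measurableTypeR R => (a + t : measurableTypeR R)).
Proof. by apply: measurable_funD; [exact: measurable_cst|exact: measurable_id]. Qed.

Lemma lebesgue_measure_shift (a : R) (A : set R) : measurable (A : set (measurableTypeR R)) ->
  lebesgue_measure ((fun t => a + t) @^-1` A) = lebesgue_measure A.
Proof.
move=> mA; rewrite -[LHS]/(pushforward lebesgue_measure
  (fun t : measurableTypeR R => (a + t : measurableTypeR R)) A).
apply/esym/lebesgue_measure_unique => //; first exact: measurable_shift1.
move=> m1 _ [[p q]] _ <-; rewrite /= /pushforward.
rewrite (_ : _ @^-1` _ = `]p - a, q - a]%classic); last first.
  by apply/seteqP; split => t /=; rewrite !in_itv /= ltrBlDl lerBrDl.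
by rewrite !lebesgue_measure_itv /= !lte_fin ltrD2r -!EFinD; case: ifP => // _; congr (_%:E); ring.
Qed.

Lemma mu2_shift v (A : set (R * R)) : measurable (A : set T2) ->
  mu ((fun x => v + x) @^-1` A) = mu A.
Proof.
move=> mA; rewrite -[LHS]/(pushforward mu ((fun x => v + x) : T2 -> T2) A).
apply/esym/product_measure_unique => //; first exact: measurable_shift.
move=> m1 B C mB mC.
transitivity (mu (((fun t => v.1 + t) @^-1` B) `*` ((fun t => v.2 + t) @^-1` C))) => //.
transitivity (lebesgue_measure ((fun t => v.1 + t)%R @^-1` B) *
  lebesgue_measure ((fun t => v.2 + t)%R @^-1` C))%E.
  apply: product_measure1E.
    by rewrite -[X in measurable X]setTI; exact: measurable_shift1.
  by rewrite -[X in measurable X]setTI; exact: measurable_shift1.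
by congr (_ * _)%E; exact: lebesgue_measure_shift.
Qed.

Lemma Rintegral_shift f v : bsup f -> \int[mu]_x f (v + x) = \int[mu]_x f x.
Proof.
move=> hf; rewrite /Rintegral; congr fine.
have ms := @measurable_shift R v; have [mf _] := hf.
have mf' : measurable_fun [set: T2] (EFin \o f : T2 -> \bar R) by exact/measurable_EFinP.
have i1 := bsup_integrable (bsup_shift v hf).
transitivity (\int[pushforward mu ((fun x => v + x)%R : T2 -> T2)]_x (f x)%:E)%E.
  have := @integral_pushforward _ _ _ _ R ((fun x => v + x) : T2 -> T2) ms mu setT _ mf'.
  by rewrite preimage_setT => /(_ i1 measurableT) ->.
apply: eq_measure_integral => A mA _ /=; exact: mu2_shift.
Qed.

Lemma Rintegral_bsupD f g : bsup f -> bsup g ->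
  \int[mu]_x (f x + g x) = \int[mu]_x f x + \int[mu]_x g x.
Proof. by move=> hf hg; apply: RintegralD => //; exact: bsup_integrable. Qed.

Lemma Rintegral_bsupB f g : bsup f -> bsup g ->
  \int[mu]_x (f x - g x) = \int[mu]_x f x - \int[mu]_x g x.
Proof. by move=> hf hg; apply: RintegralB => //; exact: bsup_integrable. Qed.

Lemma Rintegral_bsupZ f (r : R) : bsup f -> \int[mu]_x (r * f x) = r * \int[mu]_x f x.
Proof. by move=> hf; apply: RintegralZl => //; exact: bsup_integrable. Qed.

Lemma le_Rintegral_bsup f g : bsup f -> bsup g -> (forall x, f x <= g x) ->
  \int[mu]_x f x <= \int[mu]_x g x.
Proof. by move=> hf hg fg; apply: le_Rintegral => //; exact: bsup_integrable. Qed.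

Lemma bsup_box c b M : 0 <= b -> 0 <= M -> bsup (fun x => M * \1_(box c b) x).
Proof.
move=> b0 M0; apply: bsupZ; split.
  exact: measurable_indic (measurable_box c b).
exists (b + `|c|), 1; split=> //; first exact: addr_ge0.
  by move=> x; rewrite indicE; case: (_ \in _); rewrite ?normr0 ?normr1.
move=> x bx; rewrite indicE; case: (boolP (x \in _)) => //; rewrite inE /box /= => h.
by exfalso; have := ler_normD (x - c) c; rewrite subrK; lra.
Qed.

Lemma Rintegral_box c b M : 0 <= b -> 0 <= M ->
  \int[mu]_x (M * \1_(box c b) x) = M * (2 * b) ^+ 2.
Proof.
move=> b0 M0; have h1 : bsup (\1_(box c b) : R * R -> R).
  have := bsup_box c b0 ler01.
  by rewrite (_ : (fun x => 1 * _) = (\1_(box c b) : R * R -> R))//; apply/funext => x; rewrite mul1r.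
rewrite Rintegral_bsupZ//; congr (_ * _); rewrite /Rintegral.
have := @integral_indic _ _ _ mu setT measurableT (box c b) (measurable_box c b).
by rewrite setIT mu2_box// => ->.
Qed.

Lemma Rintegral_box_le f c b M : mfun2 setT f -> 0 <= b -> 0 <= M ->
  (forall x, `|f x| <= M) -> (forall x, b < `|x - c| -> f x = 0) ->
  `|\int[mu]_x f x| <= M * (2 * b) ^+ 2.
Proof.
move=> mf b0 M0 fM fb.
have bf : bsup f.
  split=> //; exists (b + `|c|), M; split=> //; first exact: addr_ge0.
  by move=> x bx; apply: fb; have := ler_normD (x - c) c; rewrite subrK; lra.
have hM := bsup_box c b0 M0.
have fle x : `|f x| <= M * \1_(box c b) x.
  rewrite indicE; case: (boolP (x \in _)); first by rewrite mulr1.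
  rewrite notin_setE /box /= => /negP; rewrite -ltNge => /fb ->.
  by rewrite normr0 mulr0.
rewrite ler_norml -(Rintegral_box c b0 M0) -mulN1r -Rintegral_bsupZ//.
apply/andP; split; apply: le_Rintegral_bsup => //; try exact: bsupZ.
  by move=> x; have /ler_normlP[] := fle x; lra.
by move=> x; have /ler_normlP[] := fle x; lra.
Qed.

Lemma Rintegral_box_ge f c b M : bsup f -> 0 <= b -> 0 <= M ->
  (forall x, 0 <= f x) -> (forall x, `|x - c| <= b -> M <= f x) ->
  M * (2 * b) ^+ 2 <= \int[mu]_x f x.
Proof.
move=> bf b0 M0 f0 fM; rewrite -(Rintegral_box c b0 M0).
apply: le_Rintegral_bsup => //; first exact: bsup_box.
move=> x; rewrite indicE; case: (boolP (x \in _)) => h; last by rewrite mulr0.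
by rewrite mulr1; apply: fM; rewrite inE in h.
Qed.

Lemma bsup_dif (e : R * R) (h : R) f : bsup f -> bsup (dif e h f).
Proof. by move=> hf; apply: bsupB => //; exact: bsup_shift. Qed.

Lemma bsup_iter_dif (e : R * R) (h : R) K f : bsup f -> bsup (iter K (dif e h) f).
Proof. by move=> hf; elim: K => //= K; exact: bsup_dif. Qed.

(** Discrete integration by parts: translation invariance moves the difference to the other factor
    and reverses its step. *)
Lemma Rintegral_dif (e : R * R) (h : R) f g M : bsup f -> mfun2 setT g ->
  (forall x, `|g x| <= M) ->
  \int[mu]_x (dif e h f x * g x) = \int[mu]_x (f x * dif e (- h) g x).
Proof.
move=> hf mg gM; rewrite /dif.
have b1 : bsup (fun x => f x * g x) by exact: bsupM gM.
have mgs : mfun2 setT (fun x => g (- h *: e + x)).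
  exact: (measurableT_comp mg (@measurable_shift R (- h *: e))).
have b2 : bsup (fun x => f x * g (- h *: e + x)).
  by apply: (@bsupM _ _ _ M) => // x.
have b3 : bsup (fun x => f (h *: e + x) * g x).
  by apply: (bsupM _ mg gM); exact: bsup_shift.
transitivity (\int[mu]_x (f (h *: e + x) * g x - f x * g x)).
  by apply: eq_Rintegral => x _; rewrite mulrBl.
rewrite Rintegral_bsupB//.
transitivity (\int[mu]_x (f x * g (- h *: e + x) - f x * g x)); last first.
  by apply: eq_Rintegral => x _; rewrite mulrBr.
rewrite Rintegral_bsupB//; congr (_ - _).
rewrite -(Rintegral_shift (h *: e) b2).
apply: eq_Rintegral => x _; rewrite scaleNr addKr//.
Qed.

Lemma mfun2_dif (e : R * R) (h : R) g M : mfun2 setT g -> (forall x, `|g x| <= M) ->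
  mfun2 setT (dif e h g) /\ forall x, `|dif e h g x| <= 2 * M.
Proof.
move=> mg gM; split.
  apply: measurable_funB => //.
  exact: (measurableT_comp mg (@measurable_shift R (h *: e))).
by move=> x; apply: le_trans (ler_normB _ _) _; rewrite mulr_natl mulr2n lerD.
Qed.

Lemma Rintegral_iter_dif (e : R * R) (h : R) K f g M : bsup f -> mfun2 setT g ->
  (forall x, `|g x| <= M) ->
  \int[mu]_x (iter K (dif e h) f x * g x) = \int[mu]_x (f x * iter K (dif e (- h)) g x).
Proof.
elim: K f g M => [//|K ih] f g M hf mg gM.
rewrite iterS (Rintegral_dif _ _ (bsup_iter_dif e h K hf) mg gM) iterSr.
have [mg' gM'] := mfun2_dif e (- h) mg gM.
exact: ih mg' gM'.
Qed.

End plane_integral.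

Section monotone_integral.
Context d (T : measurableType d) (R : realType) (m : {measure set T -> \bar R}).

(* The integral is a supremum over simple functions, so that measurability is
   not needed; the maximal function is not known to be measurable. *)
Lemma le_integral_ge0T (f g : T -> \bar R) :
  (forall x, (0 <= f x)%E) -> (forall x, (f x <= g x)%E) ->
  (\int[m]_x f x <= \int[m]_x g x)%E.
Proof.
move=> f0 fg; have g0 x : (0 <= g x)%E by exact: le_trans (fg x).
rewrite !ge0_integralTE//; apply: le_ereal_sup => _ [h hf <-].
by exists h => // x; exact: le_trans (hf x) (fg x).
Qed.

End monotone_integral.

(** * Smooth functions, test functions and distributions given by densities *)

Section test_functions.
Variable R : realType.
Implicit Types (f g : R * R -> R) (x y c v : R * R) (s : seq 'I_2) (O K : set (R * R)).

Lemma smooth_derivable f s i x : smooth f -> derivable (pderivs s f) x (basis2 R i).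
Proof. by move=> sf; have [h _] := sf (size s).+1; exact: h. Qed.

Lemma smooth_is_derive f s i x : smooth f ->
  is_derive x (basis2 R i) (pderivs s f) (pderivs (i :: s) f x).
Proof. by move=> sf; apply/derivableP; exact: smooth_derivable. Qed.

Lemma smooth_continuous f s x : smooth f -> {for x, continuous (pderivs s f)}.
Proof. by move=> sf; have [_ h] := sf (size s); exact: h. Qed.

Lemma smoothP f : (forall s i x, derivable (pderivs s f) x (basis2 R i)) ->
  (forall s x, {for x, continuous (pderivs s f)}) -> smooth f.
Proof. by move=> df cf k; split=> [s i x _ _|s x _ _]; [exact: df|exact: cf]. Qed.

Lemma pderivsB f g s : smooth f -> smooth g ->
  pderivs s (fun x => f x - g x) = (fun x => pderivs s f x - pderivs s g x).
Proof.
move=> sf sg; elim: s => [//|i s ih]; apply/funext => x /=.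
rewrite -/(pderivs s _) ih.
exact: (@derive_val _ _ _ _ _ _ _ (is_deriveB (smooth_is_derive s i x sf) (smooth_is_derive s i x sg))).
Qed.

Lemma smoothB f g : smooth f -> smooth g -> smooth (fun x => f x - g x).
Proof.
move=> sf sg; apply: smoothP => [s i x|s x]; rewrite pderivsB//.
  by apply: derivableB; exact: smooth_derivable.
by apply: cvgB; exact: smooth_continuous.
Qed.

Lemma is_derive_affine f (a : R) (b v : R * R) x (d : R) :
  is_derive (a *: x + b) v f d -> is_derive x v (fun y => f (a *: y + b)) (a * d).
Proof.
move=> /is_derive_line df; apply/is_derive_line.
have E : (fun h : R => f (a *: (h *: v + x) + b)) =
    (fun h : R => f (h *: v + (a *: x + b))) \o (fun h : R => a * h).
  by apply/funext => h /=; rewrite scalerDr scalerA addrA.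
rewrite E mulrC; apply: is_derive_chain; last by rewrite mulr0.
apply: is_derive_eq (is_deriveZ a (is_derive_id (0 : R) (1 : R))) _.
exact: mulr1.
Qed.

Lemma cvg_affine (a : R) b x : (fun y => a *: y + b) @ x --> a *: x + b.
Proof. by apply: cvgD; [exact: cvgZr|exact: cvg_cst]. Qed.

Lemma pderivs_affine f (c a : R) b s : smooth f ->
  pderivs s (fun x => c * f (a *: x + b)) = (fun x => c * a ^+ size s * pderivs s f (a *: x + b)).
Proof.
move=> sf; elim: s => [|i s ih]; first by apply/funext => x; rewrite mulr1.
apply/funext => x /=; rewrite -/(pderivs s _) ih.
have d := @is_derive_affine _ a b _ x _ (smooth_is_derive s i (a *: x + b) sf).
have := @derive_val _ _ _ _ _ _ _ (is_deriveZ (c * a ^+ size s) d).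
by move=> e; rewrite exprS; transitivity (c * a ^+ size s * (a * pderivs (i :: s) f (a *: x + b)));
  [exact: e|rewrite /=; ring].
Qed.

Lemma smooth_affine f (c a : R) b : smooth f -> smooth (fun x => c * f (a *: x + b)).
Proof.
move=> sf; apply: smoothP => [s i x|s x]; rewrite pderivs_affine//.
  have d := @is_derive_affine _ a b _ x _ (smooth_is_derive s i (a *: x + b) sf).
  exact: (@ex_derive _ _ _ _ _ _ _ (is_deriveZ (c * a ^+ size s) d)).
apply: cvgM; first exact: cvg_cst.
have := cvg_comp (fun y => a *: y + b) (pderivs s f) (@cvg_affine a b x)
  (@smooth_continuous f s (a *: x + b) sf).
by [].
Qed.

Lemma smooth_dif f (e : R * R) (h : R) : smooth f -> smooth (dif e h f).
Proof.
move=> sf; apply: smoothB => //.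
have := smooth_affine 1 1 (h *: e) sf.
by under eq_fun do rewrite mul1r scale1r addrC.
Qed.

Lemma smooth_iter_dif f (e : R * R) (h : R) n : smooth f -> smooth (iter n (dif e h) f).
Proof. by move=> sf; elim: n => //= n; exact: smooth_dif. Qed.

Lemma pderivs_out K f s x : closed K -> (forall y, ~ K y -> f y = 0) -> ~ K x ->
  pderivs s f x = 0.
Proof.
move=> cK fK; elim: s x => [|i s ih] x Kx; first exact: fK.
rewrite /= /pderiv (@near_eq_derive _ _ _ _ (fun=> 0)) ?derive_cst//.
have : \forall y \near x, ~ K y by apply: open_nbhs_nbhs; split => //; exact: closed_openC.
by apply: filterS => y /ih.
Qed.

Lemma test_function_bsup O f s : test_function O f -> bsup (pderivs s f).
Proof.
move=> [sf [K [cK KO fK]]].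
have clK : closed K by apply: compact_closed => //; exact: norm_hausdorff.
split; first by apply: continuous_mfunT => x; exact: smooth_continuous.
have [b [_ bK]] := compact_bounded cK.
have cI : compact (pderivs s f @` K).
  apply: continuous_compact => //; apply: continuous_subspaceT => x.
  exact: smooth_continuous.
have [M [_ MK]] := compact_bounded cI.
exists (`|b| + 1), (`|M| + 1); split; rewrite ?addr_ge0//.
  move=> x; have [Kx|Kx] := pselect (K x).
    by apply: MK; [rewrite (le_lt_trans (ler_norm M))// ltrDl|exists x].
  by rewrite (pderivs_out s clK fK Kx) normr0 addr_ge0.
move=> x bx; apply: (pderivs_out s clK fK) => Kx.
have := bK (`|b| + 1); rewrite (le_lt_trans (ler_norm b)) ?ltrDl// => /(_ isT x Kx).
by rewrite /= leNgt bx.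
Qed.

Lemma compact_box c (b : R) : compact (box c b).
Proof.
rewrite boxE; apply: compact_setX; exact: segment_compact.
Qed.

Lemma test_function_box f c (b : R) O : smooth f -> box c b `<=` O ->
  (forall x, b < `|x - c| -> f x = 0) -> test_function O f.
Proof.
move=> sf bO f0; split=> //; exists (box c b); split=> //; first exact: compact_box.
by move=> x; rewrite /box /= => /negP; rewrite -ltNge => /f0.
Qed.

Lemma distr_of_support (D : set (R * R)) f g : (forall x, ~ D x -> f x = 0) ->
  distr_of D f g = \int[@mu2 R]_x (f x * g x).
Proof.
move=> f0; rewrite /distr_of Rintegral_mkcond; congr Rintegral.
apply/funext => x; rewrite patchE; case: ifPn => //.
by rewrite notin_setE => /f0 ->; rewrite mul0r.
Qed.

Lemma schwartz_bounded g : schwartz g -> exists2 M, schwartz_norm 0 g = M%:E &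
  forall x, `|g x| <= M.
Proof.
move=> [sg /(_ 0%N) g0].
have h x : (`|g x|%:E <= schwartz_norm 0 g)%E.
  apply: ereal_sup_ubound; exists [::], x; split => //=.
  by rewrite expr0 mul1r.
have : (schwartz_norm 0 g \is a fin_num)%E.
  by rewrite ge0_fin_numE// (le_trans _ (h 0)).
case: (schwartz_norm 0 g) g0 h => [M| |] // _ h _; exists M => //.
Qed.

Lemma smooth_mfun f : smooth f -> mfun2 setT f.
Proof. by move=> sf; apply: continuous_mfunT => x; exact: (@smooth_continuous f [::]). Qed.

Lemma tempered_distr_of f : bsup f -> tempered (distr_of setT f).
Proof.
move=> bf; have E g : distr_of setT f g = \int[@mu2 R]_x (f x * g x).
  by apply: distr_of_support => x; case.
have bs g : schwartz g -> bsup (fun x => f x * g x).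
  move=> sg; have [M _ gM] := schwartz_bounded sg; have [sg' _] := sg.
  exact: bsupM (smooth_mfun sg') gM.
split.
  move=> a f1 g1 s1 s2; have b1 := bs _ s1; have b2 := bs _ s2.
  rewrite !E -(Rintegral_bsupZ a b1) -(Rintegral_bsupD (bsupZ a b1) b2).
  by apply: eq_Rintegral => x _; ring.
have [mf [b [M [b0 M0 fM fb]]]] := bf.
exists (M * (2 * b) ^+ 2), 0%N => g sg.
have [L -> gL] := schwartz_bounded sg; have [sg' _] := sg.
have L0 : 0 <= L := le_trans (normr_ge0 _) (gL 0).
rewrite -EFinM lee_fin E mulrAC; apply: (@Rintegral_box_le _ _ 0) => //.
- by apply: measurable_funM => //; exact: smooth_mfun.
- by rewrite mulr_ge0.
- by move=> x; rewrite normrM ler_pM.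
- by move=> x; rewrite subr0 => /fb ->; rewrite mul0r.
Qed.

End test_functions.

(** * Maximal functions of atoms *)

Section Kernel.
Context {R : realType}.
Implicit Types (d : R).
Local Notation mu := (@mu2 R).
Local Notation T2 := (measurableTypeR R * measurableTypeR R)%type.

Lemma is_derive_atan_scale d (x : R) : d != 0 ->
  is_derive x (1 : R) (fun x : R => d * atan (d^-1 * x)) ((oneDsqr (d^-1 * x))^-1).
Proof.
move=> d0; have h1 : is_derive x 1 (fun x : R => d^-1 * x) (d^-1 * 1).
  exact: is_deriveZ.
have h2 : is_derive x 1 (fun x : R => atan (d^-1 * x)) ((oneDsqr (d^-1 * x))^-1 * (d^-1 * 1)).
  exact: (@is_derive1_comp _ atan (fun x : R => d^-1 * x)).
have := @is_deriveZ _ _ _ _ d _ _ _ h2.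
rewrite (_ : d *: _ = (oneDsqr (d^-1 * x))^-1)//.
rewrite mulr1 /GRing.scale /= mulrCA mulfV// mulr1//.
Qed.

Lemma continuous_oneDsqrV_scale d : continuous (fun x : R => (oneDsqr (d * x))^-1).
Proof.
move=> x; have := @continuous_comp _ _ _ (fun x : R => d * x) (fun y : R => (oneDsqr y)^-1) x.
apply; first by apply: cvgM; [exact: cvg_cst|exact: cvg_id].
exact: continuous_oneDsqrV.
Qed.

Lemma integral_oneDsqrV_scale d : 0 < d ->
  (\int[@lebesgue_measure R]_x ((oneDsqr (d^-1 * x))^-1)%:E = (d * pi)%:E)%E.
Proof.
move=> d0; rewrite ge0_symfun_integralT; last 3 first.
- by move=> x; rewrite invr_ge0 (le_trans ler01)// oneDsqr_ge1.
- exact: continuous_oneDsqrV_scale.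
- by move=> x /=; rewrite /oneDsqr mulrN sqrrN.
rewrite -set_itvcy (@ge0_continuous_FTC2y _ _ (fun x => d * atan (d^-1 * x)) 0 (d * (pi / 2))).
- by rewrite mulr0 atan0 mulr0 sube0 -EFinM; congr (_%:E); field.
- by move=> x _; rewrite invr_ge0 (le_trans ler01)// oneDsqr_ge1.
- by apply: continuous_subspaceT; exact: continuous_oneDsqrV_scale.
- apply: cvgM; first exact: cvg_cst.
  apply: (@cvg_comp _ _ _ (fun x : R => d^-1 * x) atan _ (+oo%R : set_system R)).
    by apply: gt0_cvgMry => //; rewrite ?invr_gt0//; exact: cvg_id.
  exact: cvgy_atan.
- by move=> x _; have [] := @is_derive_atan_scale d x (lt0r_neq0 d0).
- apply: cvg_at_right_filter.
  have [h _] := @is_derive_atan_scale d 0 (lt0r_neq0 d0).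
  exact: (differentiable_continuous ((derivable1_diffP _ _).1 h)).
- by move=> x _; rewrite derive1E; have [_ ->] := @is_derive_atan_scale d x (lt0r_neq0 d0).
Qed.
(** An integrable majorant with an explicit integral, through the arctangent. It dominates (1 + (|x|
    / d) ^ 2) ^ -2, the decay of the p-th power of the maximal function of an atom. *)
Definition ker d (x : R * R) : R := (oneDsqr (d^-1 * x.1))^-1 * (oneDsqr (d^-1 * x.2))^-1.

Lemma ker_ge0 d x : 0 <= ker d x.
Proof. by rewrite mulr_ge0// invr_ge0 (le_trans ler01)// oneDsqr_ge1. Qed.

Lemma measurable_oneDsqrV_scale d :
  measurable_fun [set: measurableTypeR R] (fun x : R => (oneDsqr (d * x))^-1).
Proof. by apply: continuous_measurable_fun; exact: continuous_oneDsqrV_scale. Qed.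

Lemma measurable_ker d : mfun2 setT (ker d).
Proof.
have m1 := measurable_oneDsqrV_scale d^-1.
apply: measurable_funM; first exact: (measurableT_comp m1 measurable_fst).
exact: (measurableT_comp m1 measurable_snd).
Qed.

Lemma integral_ker d : 0 < d -> (\int[mu]_x (ker d x)%:E = ((d * pi) ^+ 2)%:E)%E.
Proof.
move=> d0; have p0 (x : R) : 0 <= (oneDsqr (d^-1 * x))^-1.
  by rewrite invr_ge0 (le_trans ler01)// oneDsqr_ge1.
have m1 : measurable_fun [set: measurableTypeR R] (fun x : R => (oneDsqr (d^-1 * x))^-1).
  exact: measurable_oneDsqrV_scale.
rewrite /mu2 fubini_tonelli1; last 2 first.
- by apply/measurable_EFinP; exact: measurable_ker.
- by move=> x; rewrite lee_fin ker_ge0.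
rewrite /fubini_F /ker /=.
transitivity (\int[@lebesgue_measure R]_x (((oneDsqr (d^-1 * x))^-1)%:E * (d * pi)%:E)%E)%E.
  apply: eq_integral => x _; rewrite -(integral_oneDsqrV_scale d0) -ge0_integralZl//.
  by apply/measurable_EFinP.
rewrite expr2 [RHS]EFinM -[in X in _ = (X * _)%E](integral_oneDsqrV_scale d0).
apply: ge0_integralZr => //.
- by apply/measurable_EFinP.
- by rewrite lee_fin mulr_ge0// ltW// pi_gt0.
Qed.

Lemma hp_norm_le (phi : R * R -> R) p F d C : 0 < p -> 0 < d -> 0 <= C ->
  (forall t x, 0 < t -> t < 1 -> `|mollify phi t F x| `^ p <= C * ker d x) ->
  (hp_norm phi p F <= ((C * (d * pi) ^+ 2) `^ p^-1)%:E)%E.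
Proof.
move=> p0 d0 C0 h; rewrite /hp_norm unlock /=.
have p0' : 0 <= p by exact: ltW.
have k0 x : 0 <= C * ker d x by rewrite mulr_ge0// ker_ge0.
have M0 x : (0 <= local_maximal phi F x)%E.
  (* Any t in the open unit interval shows that the supremum is nonnegative; here t = 1/2. *)
  apply: ereal_sup_ge; exists (`|mollify phi 2^-1 F x|)%:E; last by rewrite lee_fin.
  by exists 2^-1 => //=; rewrite in_itv /=; apply/andP; split; lra.
have M1 x : (local_maximal phi F x <= ((C * ker d x) `^ p^-1)%:E)%E.
  apply: ge_ereal_sup => z [t /=]; rewrite in_itv /= => /andP[t0 t1] <-.
  rewrite lee_fin -(@powRr1 _ `|_|)// -(mulfV (lt0r_neq0 p0)) powRrM.
  by rewrite ge0_ler_powR ?invr_ge0 ?nnegrE ?powR_ge0// h.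
rewrite -poweR_EFin gt0_ler_poweR//.
- by rewrite invr_ge0.
- by rewrite in_itv /= leey andbT integral_ge0// => x _; exact: poweR_ge0.
- by rewrite in_itv /= leey andbT lee_fin mulr_ge0// sqr_ge0.
have mk : measurable_fun [set: T2] (fun x : T2 => (ker d x)%:E).
  by apply/measurable_EFinP; exact: measurable_ker.
have -> : ((C * (d * pi) ^+ 2)%:E = \int[mu]_x (C%:E * (ker d x)%:E))%E.
  rewrite EFinM -integral_ker//; apply/esym/ge0_integralZl => //.
  by move=> x _; rewrite lee_fin ker_ge0.
apply: le_integral_ge0T => x; first exact: poweR_ge0.
rewrite gee0_abs// -EFinM -[(_ * ker d x)](@powRr1 _ (C * ker d x))//.
rewrite -(mulVf (lt0r_neq0 p0)) powRrM -poweR_EFin gt0_ler_poweR// in_itv /= leey andbT//.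
by rewrite lee_fin powR_ge0.
Qed.

Lemma hp_norm_ge (phi : R * R -> R) p F c r v : 0 < p -> 0 <= r -> 0 <= v ->
  (forall x, `|x - c| <= r -> (v%:E <= local_maximal phi F x)%E) ->
  ((v * ((2 * r) ^+ 2) `^ p^-1)%:E <= hp_norm phi p F)%E.
Proof.
move=> p0 r0 v0 h; rewrite /hp_norm unlock /=.
have -> : (v * ((2 * r) ^+ 2) `^ p^-1)%:E = (((v `^ p) * (2 * r) ^+ 2)%:E `^ p^-1)%E.
  rewrite poweR_EFin powRM ?powR_ge0 ?sqr_ge0// -powRrM mulfV ?lt0r_neq0// powRr1//.
rewrite gt0_ler_poweR//.
- by rewrite invr_ge0 ltW.
- by rewrite in_itv /= leey andbT lee_fin mulr_ge0// ?sqr_ge0// powR_ge0.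
- by rewrite in_itv /= leey andbT integral_ge0// => x _; exact: poweR_ge0.
have E : (((2 * r) ^+ 2)%:E = \int[mu]_x (\1_(box c r) x)%:E)%E.
  rewrite integral_indic//; last exact: measurable_box.
  by rewrite setIT mu2_box.
rewrite EFinM E.
have mb : measurable_fun [set: T2] (fun x : T2 => (\1_(box c r) x : R)%:E).
  by apply/measurable_EFinP; apply: measurable_indic; exact: measurable_box.
rewrite -ge0_integralZl//; last by rewrite lee_fin powR_ge0.
apply: le_integral_ge0T => x.
  by rewrite mule_ge0// lee_fin ?powR_ge0.
rewrite indicE; case: (boolP (x \in _)) => xb; last by rewrite mule0 poweR_ge0.
rewrite mule1 -poweR_EFin gt0_ler_poweR ?(ltW p0)//.
- by rewrite in_itv /= leey andbT lee_fin.
- by rewrite in_itv /= leey andbT.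
- by apply: (le_trans (h x _)); [move: xb; rewrite inE|exact: lee_abs].
Qed.
End Kernel.

Section Atom.
Context {R : realType}.
Implicit Types (f g : R * R -> R) (x y c : R * R).
Local Notation mu := (@mu2 R).
Local Notation e0 := (basis2 R 0).

Lemma shift_fst (h : R) y : (h *: e0 + y).1 = h + y.1.
Proof. by rewrite -[LHS]/(h * 1 + y.1) mulr1. Qed.

Lemma shift_snd (h : R) y : (h *: e0 + y).2 = y.2.
Proof. by rewrite -[LHS]/(h * 0 + y.2) mulr0 add0r. Qed.

(** Differences of step - h spread the support only to the right, away from the boundary point 0. *)
Lemma iter_dif_strip f (a b s h : R) K y : 0 <= h ->
  (forall y, f y != 0 -> [/\ a <= y.1, y.1 <= b & `|y.2| <= s]) ->
  iter K (dif e0 (- h)) f y != 0 -> [/\ a <= y.1, y.1 <= b + K%:R * h & `|y.2| <= s].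
Proof.
move=> h0 fs; elim: K y => [|K ih] y; first by rewrite mul0r addr0; exact: fs.
rewrite iterS; set g := iter _ _ _ in ih *; rewrite /dif => h1.
have [g0|/ih[y1 y2 y3]] := eqVneq (g y) 0; last first.
  by split=> //; apply: le_trans y2 _; rewrite lerD2l ler_wpM2r// ler_nat.
move: h1; rewrite g0 subr0 => /ih; rewrite shift_fst shift_snd.
move=> [y1 y2 y3]; split => //; first by lra.
by rewrite -natr1 mulrDl mul1r; lra.
Qed.

Definition dilate (phi : R * R -> R) (s : R) c : R * R -> R := fun y => phi (s^-1 *: (y - c)).

(** The bump has radius rho d around (d, 0), so the support stays at a distance comparable to d from
    0, inside a cone with vertex 0. The K differences provide the cancellation. *)
Definition atom (phi : R * R -> R) K (rho d : R) : R * R -> R :=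
  iter K (dif e0 (- d)) (dilate phi (rho * d) (d, 0)).

Variable phi : R * R -> R.
Hypothesis hphi : mollifier phi.

Lemma mollifier_smooth : smooth phi. Proof. by case: hphi => [[]]. Qed.

Lemma mollifier_out x : 1 <= `|x| -> phi x = 0.
Proof.
move=> x1; have [[_ [K [_ KO Kphi]]] _ _] := hphi; apply: Kphi => /KO /=.
by apply/negP; rewrite -leNgt (le_trans x1)// enorm_ge_norm.
Qed.

Lemma mollifier_ge0 x : 0 <= phi x. Proof. by case: hphi => _ h _. Qed.

Lemma mollifier_bound s : exists2 M, 0 <= M & forall x, `|pderivs s phi x| <= M.
Proof.
have [h _ _] := hphi; have [_ [b [M [_ M0 hM _]]]] := test_function_bsup s h.
by exists M.
Qed.

Lemma dilateE s c : dilate phi s c = fun y => 1 * phi (s^-1 *: y + - s^-1 *: c).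
Proof. by apply/funext => y; rewrite mul1r /dilate scalerBr scaleNr. Qed.

Lemma dilate_smooth s c : smooth (dilate phi s c).
Proof. by rewrite dilateE; apply: smooth_affine; exact: mollifier_smooth. Qed.

Lemma dilate_out s c y : 0 < s -> s <= `|y - c| -> dilate phi s c y = 0.
Proof.
move=> s0 h; apply: mollifier_out; rewrite normrZ gtr0_norm ?invr_gt0//.
by rewrite mulrC ler_pdivlMr// mul1r.
Qed.

Lemma dilate_bsup s c : 0 < s -> bsup (dilate phi s c).
Proof.
move=> s0; have [M M0 hM] := mollifier_bound [::].
split; first by apply: smooth_mfun; exact: dilate_smooth.
exists (s + `|c|), M; split=> //; first by rewrite addr_ge0// ltW.
  by move=> y; exact: hM.
move=> y h; apply: dilate_out => //; have := lerB_dist y c; lra.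
Qed.

Lemma atom_smooth K rho d : smooth (atom phi K rho d).
Proof. by apply: smooth_iter_dif; exact: dilate_smooth. Qed.

Lemma atom_bsup K rho d : 0 < rho -> 0 < d -> bsup (atom phi K rho d).
Proof. by move=> r0 d0; apply: bsup_iter_dif; apply: dilate_bsup; exact: mulr_gt0. Qed.

Lemma atom_strip K rho d y : 0 < rho -> rho <= 2^-1 -> 0 < d -> atom phi K rho d y != 0 ->
  [/\ 2^-1 * d <= y.1, y.1 <= K.+2%:R * d & `|y.2| <= 2^-1 * d].
Proof.
move=> r0 r1 d0 h.
have [] := @iter_dif_strip (dilate phi (rho * d) (d, 0)) (2^-1 * d) (2 * d) (2^-1 * d) d K y (ltW d0) _ h.
  move=> z bz; have rd : rho * d <= 2^-1 * d by rewrite ler_wpM2r// ltW.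
  have : `|z - (d, 0)| <= 2^-1 * d.
    rewrite leNgt; apply/negP => h1; move/eqP: bz; apply; apply: dilate_out.
      exact: mulr_gt0.
    by apply: le_trans rd _; exact: ltW.
  rewrite prod_normE ge_max /= subr0 ler_distl => /andP[/andP[z1 z2] z3].
  by split => //; lra.
move=> y1 y2 y3; split=> //; rewrite -addn2 natrD mulrDl; lra.
Qed.

Lemma atom_norm K rho d y : 0 < rho -> rho <= 2^-1 -> 0 < d -> atom phi K rho d y != 0 ->
  `|y| <= K.+2%:R * d.
Proof.
move=> r0 r1 d0 /(atom_strip r0 r1 d0)[y1 y2 y3]; rewrite prod_normE ge_max.
have : 0 <= K%:R * d by rewrite mulr_ge0// ltW.
move: y2; rewrite -addn2 natrD mulrDl => y2 kd.
by apply/andP; split; [rewrite ler_norml; apply/andP; split|]; lra.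
Qed.
End Atom.

Section AtomNorm.
Context {R : realType}.
Implicit Types (f g : R * R -> R) (x y c : R * R).
Local Notation mu := (@mu2 R).
Local Notation e0 := (basis2 R 0).
Variable phi : R * R -> R.
Hypothesis hphi : mollifier phi.
Variables (K : nat) (rho : R).
Hypothesis rho0 : 0 < rho.
Hypothesis rho2 : rho <= 2^-1.

Definition bump_at (t : R) x : R * R -> R := fun y => t ^- 2 * phi (t^-1 *: (x - y)).

Lemma bump_atE t x : bump_at t x = fun y => t ^- 2 * phi (- t^-1 *: y + t^-1 *: x).
Proof. by apply/funext => y; rewrite /bump_at scalerBr scaleNr addrC. Qed.

Lemma bump_at_smooth t x : smooth (bump_at t x).
Proof. by rewrite bump_atE; apply: smooth_affine; exact: mollifier_smooth. Qed.

Lemma bump_at_out t x y : 0 < t -> t <= `|y - x| -> bump_at t x y = 0.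
Proof.
move=> t0 h; rewrite /bump_at (mollifier_out hphi) ?mulr0// normrZ distrC gtr0_norm ?invr_gt0//.
by rewrite mulrC ler_pdivlMr// mul1r.
Qed.

Lemma pderivs_bump_at t x s M : 0 < t -> (forall z, `|pderivs s phi z| <= M) ->
  forall y, `|pderivs s (bump_at t x) y| <= M * t ^- (size s).+2.
Proof.
move=> t0 hM y; rewrite bump_atE pderivs_affine; last exact: mollifier_smooth.
rewrite normrM normrM normfV !normrX normrN normfV (gtr0_norm t0) exprVn -invfM -exprD mulrC.
by apply: ler_wpM2r => //; rewrite invr_ge0 exprn_ge0// ltW.
Qed.

Lemma mollify_atomE d t x : 0 < d -> mollify phi t (distr_of setT (atom phi K rho d)) x =
  \int[mu]_y (atom phi K rho d y * bump_at t x y).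
Proof. by move=> d0; rewrite /mollify distr_of_support// => z; case. Qed.

Lemma mollify_atom_bound : exists2 C, 0 <= C & forall d t x, 0 < d -> 0 < t ->
  `|mollify phi t (distr_of setT (atom phi K rho d)) x| <= C.
Proof.
have [M M0 hM] := mollifier_bound hphi [::].
exists ((2 ^+ K * M) * M * 4); first by rewrite !mulr_ge0// exprn_ge0.
move=> d t x d0 t0; rewrite mollify_atomE//.
apply: (le_trans (@Rintegral_box_le _ _ x t ((2 ^+ K * M) * (M * t ^- 2)) _ _ _ _ _)).
- apply: measurable_funM; apply: smooth_mfun; [exact: atom_smooth|exact: bump_at_smooth].
- exact: ltW.
- by rewrite !mulr_ge0// ?exprn_ge0// invr_ge0 exprn_ge0// ltW.
- move=> y; rewrite normrM ler_pM//; first by apply: iter_dif_sup => j _; exact: hM.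
  exact: (pderivs_bump_at x t0 hM).
- by move=> y /ltW h; rewrite bump_at_out ?mulr0.
- have t2 : t ^+ 2 != 0 by rewrite expf_neq0// lt0r_neq0.
  rewrite exprMn [leLHS](_ : _ = 2 ^+ K * M * M * 4 * (t ^- 2 * t ^+ 2)); last by ring.
  by rewrite mulVf// mulr1.
Qed.

(** Three regimes. If |x| <= 2 (K + 2) d, the uniform bound suffices. Otherwise, if t <= |x| / 2 the
    supports are disjoint; and if t > |x| / 2 the differences are moved to the mollifier, giving d ^
    K t ^ -(K + 2) times an area of order d ^ 2. *)
Lemma mollify_atom_decay : exists2 C, 0 <= C & forall d t x, 0 < d -> 0 < t ->
  `|x| ^+ K.+2 * `|mollify phi t (distr_of setT (atom phi K rho d)) x| <= C * d ^+ K.+2.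
Proof.
have [C C0 hC] := mollify_atom_bound.
have [M M0 hM] := mollifier_bound hphi [::].
have [L L0 hL] := mollifier_bound hphi (nseq K 0).
pose c := K.+2%:R : R.
have c0 : 0 <= c by [].
have rho0' := ltW rho0.
exists ((2 * c) ^+ K.+2 * C + 2 ^+ K.+2 * (M * L * (2 * rho) ^+ 2)).
  have e1 : 0 <= (2 * c) ^+ K.+2 by apply: exprn_ge0; exact: mulr_ge0.
  have e2 : 0 <= (2 : R) ^+ K.+2 by exact: exprn_ge0.
  have e3 : 0 <= (2 * rho) ^+ 2 by exact: sqr_ge0.
  by apply: addr_ge0; [exact: mulr_ge0|apply: mulr_ge0 => //; apply: mulr_ge0 => //; exact: mulr_ge0].
move=> d t x d0 t0.
have d0' := ltW d0.
have p2 : 0 <= 2 ^+ K.+2 * (M * L * (2 * rho) ^+ 2) * d ^+ K.+2.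
  apply: mulr_ge0; last exact: exprn_ge0.
  apply: mulr_ge0; first exact: exprn_ge0.
  by apply: mulr_ge0; [exact: mulr_ge0|exact: sqr_ge0].
have p1 : 0 <= (2 * c) ^+ K.+2 * C * d ^+ K.+2.
  apply: mulr_ge0; last exact: exprn_ge0.
  by apply: mulr_ge0 => //; apply: exprn_ge0; exact: mulr_ge0.
rewrite mulrDl.
have [xd|xd] := leP `|x| (2 * c * d).
  apply: le_trans (ler_wpDr p2 (lexx _)).
  rewrite [leRHS]mulrAC -exprMn; apply: ler_pM; rewrite ?exprn_ge0// ?hC//.
  by rewrite lerXn2r// nnegrE ?mulr_ge0.
apply: le_trans (ler_wpDl p1 (lexx _)).
have x0 : 0 < `|x| by apply: le_lt_trans xd; rewrite !mulr_ge0.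
rewrite mollify_atomE//; have [tx|tx] := leP t (2^-1 * `|x|).
  rewrite (_ : (fun y => _) = fun=> 0); last first.
    apply/funext => y; have [->|/(atom_norm hphi rho0 rho2 d0) yd] := eqVneq (atom phi K rho d y) 0.
      by rewrite mul0r.
    rewrite bump_at_out ?mulr0//; have := lerB_dist x y; rewrite distrC.
    move: yd xd tx; rewrite -/c -mulrA; move: (c * d) => w; lra.
  have -> : (\int[mu]_y (0 : R)) = 0 by rewrite /Rintegral integral0.
  by rewrite normr0 mulr0.
rewrite /atom (@Rintegral_iter_dif _ _ _ _ _ _ (M * t ^- 2)); first last.
- exact: (pderivs_bump_at x t0 hM).
- by apply: smooth_mfun; exact: bump_at_smooth.
- by apply: dilate_bsup => //; exact: mulr_gt0.
rewrite opprK.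
have B y : `|iter K (dif e0 d) (bump_at t x) y| <= L * t ^- K.+2 * d ^+ K.
  apply: (@iter_dif_le _ _ e0 K (fun j => pderivs (nseq j 0) (bump_at t x))) => //.
    by move=> j s _ _; apply: (@smooth_is_derive _ _ (nseq j 0) 0); exact: bump_at_smooth.
  by move=> s _; have := pderivs_bump_at x t0 hL (s *: e0 + y); rewrite size_nseq.
apply: (@le_trans _ _ (`|x| ^+ K.+2 * (M * (L * t ^- K.+2 * d ^+ K) * (2 * (rho * d)) ^+ 2))).
  apply: ler_wpM2l; first exact: exprn_ge0.
  apply: (@Rintegral_box_le _ _ (d, 0)).
  - apply: measurable_funM; apply: smooth_mfun; first exact: dilate_smooth.
    by apply: smooth_iter_dif; exact: bump_at_smooth.
  - exact: mulr_ge0.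
  - by rewrite !mulr_ge0// ?exprn_ge0// invr_ge0 exprn_ge0// ltW.
  - by move=> y; rewrite normrM; apply: ler_pM => //; exact: hM.
  - by move=> y /ltW h; rewrite dilate_out ?mul0r//; exact: mulr_gt0.
have h : `|x| ^+ K.+2 * t ^- K.+2 <= 2 ^+ K.+2.
  have h1 : `|x| * t^-1 <= 2 by rewrite ler_pdivrMr//; lra.
  have h2 : 0 <= `|x| * t^-1 by rewrite mulr_ge0// invr_ge0 ltW.
  by rewrite -exprVn -exprMn; apply: lerXn2r h1; rewrite nnegrE.
rewrite [leLHS](_ : _ = (`|x| ^+ K.+2 * t ^- K.+2) * (M * L * (2 * rho) ^+ 2 * d ^+ K.+2)).
  rewrite -(mulrA (2 ^+ K.+2)); apply: ler_wpM2r h.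
  apply: mulr_ge0; last exact: exprn_ge0.
  by apply: mulr_ge0; [exact: mulr_ge0|exact: sqr_ge0].
move: (t ^- K.+2) (`|x| ^+ K.+2) => u v.
by rewrite -(addn2 K) exprD; ring.
Qed.
Lemma powR_decay (p C m s : R) L : 0 < p -> p * L%:R = 4 -> 0 <= C -> 0 <= m -> 0 <= s ->
  m <= C -> s ^+ L * m <= C -> m `^ p * (1 + s ^+ 2) ^+ 2 <= C `^ p * 4.
Proof.
move=> p0 pL C0 m0 s0 mC smC; have p0' := ltW p0.
have [s1|s1] := leP s 1.
  apply: ler_pM; rewrite ?powR_ge0 ?sqr_ge0//; first by rewrite ge0_ler_powR ?nnegrE.
  have : s ^+ 2 <= 1 by rewrite expr_le1.
  have : 0 <= s ^+ 2 by exact: sqr_ge0.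
  move: (s ^+ 2) => q; nra.
have h : m `^ p * (s ^+ 2) ^+ 2 <= C `^ p.
  rewrite -exprM -powR_mulrn// -(_ : p * L%:R = 4)// mulrC [p * _]mulrC powRrM powR_mulrn//.
  by rewrite -powRM ?exprn_ge0// ge0_ler_powR ?nnegrE// mulr_ge0// exprn_ge0.
have q1 : 1 <= s ^+ 2 by rewrite expr_ge1// ltW.
have m1 : 0 <= m `^ p by exact: powR_ge0.
move: q1 h; move: (s ^+ 2) (m `^ p) m1 => q w w0 q1 h.
have : (1 + q) ^+ 2 <= 4 * q ^+ 2 by nra.
move=> /(ler_wpM2l w0); lra.
Qed.

Lemma ler_ker d x : 0 < d -> 1 <= ker d x * (1 + (`|x| / d) ^+ 2) ^+ 2.
Proof.
move=> d0; have h1 (u : R) : `|u| <= `|x| -> oneDsqr (d^-1 * u) <= 1 + (`|x| / d) ^+ 2.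
  move=> ux; rewrite /oneDsqr lerD2l -(real_normK (num_real (d^-1 * u))).
  have d0' : 0 <= d^-1 by rewrite invr_ge0 ltW.
  apply: lerXn2r; rewrite ?nnegrE ?mulr_ge0//.
  by rewrite normrM (ger0_norm d0') mulrC ler_wpM2r.
have x1 : `|x.1| <= `|x| by rewrite prod_normE le_max lexx.
have x2 : `|x.2| <= `|x| by rewrite prod_normE le_max lexx orbT.
have g0 (u : R) : 0 < oneDsqr u by rewrite (lt_le_trans ltr01)// oneDsqr_ge1.
rewrite /ker -invfM mulrC ler_pdivlMr ?mulr_gt0// mul1r expr2.
by rewrite ler_pM ?h1// ltW.
Qed.

(** Here p (K + 2) = 4, so the p-th power of the maximal function is at most a multiple of [ker d].
    Its integral, of order d ^ 2, has p-th root of order d ^ (2 / p), and 2 / p = N + 2. *)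
Lemma hp_norm_atom (p : R) N : 0 < p -> p * N.+2%:R = 2 -> K.+2 = (2 * N.+2)%N ->
  exists2 C, 0 <= C & forall d, 0 < d ->
  (hp_norm phi p (distr_of setT (atom phi K rho d)) <= (C * d ^+ N.+2)%:E)%E.
Proof.
move=> p0 pN KN; have [C C0 hC] := mollify_atom_bound; have [B B0 hB] := mollify_atom_decay.
pose A := C + B; have A0 : 0 <= A by exact: addr_ge0.
exists ((A `^ p * 4 * pi ^+ 2) `^ p^-1); first exact: powR_ge0.
move=> d d0; apply: (le_trans (@hp_norm_le _ _ _ _ d (A `^ p * 4) p0 d0 _ _)).
- by rewrite mulr_ge0// powR_ge0.
- move=> t x t0 _; set m := `|_|.
  have h : m `^ p * (1 + (`|x| / d) ^+ 2) ^+ 2 <= A `^ p * 4.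
    apply: (@powR_decay p A m (`|x| / d) K.+2) => //.
    - by rewrite KN natrM mulrCA pN; lra.
    - exact: normr_ge0.
    - by rewrite divr_ge0// ltW.
    - by have := hC d t x d0 t0; rewrite -/m /A; lra.
    - rewrite exprMn mulrAC exprVn ler_pdivrMr ?exprn_gt0//.
      apply: le_trans (hB d t x d0 t0) _; rewrite ler_wpM2r ?exprn_ge0 ?(ltW d0)//.
      by rewrite /A lerDr.
  have k0 := ker_ge0 d x.
  apply: le_trans (_ : (m `^ p * (1 + (`|x| / d) ^+ 2) ^+ 2) * ker d x <= _).
    rewrite -mulrA ler_peMr ?powR_ge0// mulrC; exact: ler_ker.
  exact: ler_wpM2r.
rewrite lee_fin exprMn mulrCA mulrC [leLHS]powRM; last 2 first.
- by apply: mulr_ge0; [rewrite mulr_ge0// powR_ge0|exact: sqr_ge0].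
- exact: sqr_ge0.
rewrite -[d ^+ 2]powR_mulrn ?(ltW d0)// -powRrM (_ : 2%:R * p^-1 = N.+2%:R) ?powR_mulrn ?(ltW d0)//.
by rewrite -pN mulrAC mulfV ?mul1r// lt0r_neq0.
Qed.
End AtomNorm.

(** * Green's kernel near the singular boundary point *)

Section HpzNorm.
Context {R : realType}.
Implicit Types (f g : R * R -> R) (x y c : R * R).
Local Notation mu := (@mu2 R).

Lemma test_function_out O f x : test_function O f -> ~ O x -> f x = 0.
Proof. by move=> [_ [K [_ KO fK]]] Ox; apply: fK => /KO. Qed.

Lemma hpz_norm_le phi p D f : test_function D f ->
  (hpz_norm phi p D (distr_of D f) <= hp_norm phi p (distr_of setT f))%E.
Proof.
move=> tf; apply: ereal_inf_lbound; exists (distr_of setT f) => //; split.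
- by apply: tempered_distr_of; exact: (test_function_bsup [::] tf).
- move=> g _; rewrite distr_of_support; last by move=> x; case.
  by rewrite distr_of_support// => x; exact: test_function_out tf.
- move=> g tg; rewrite distr_of_support; last by move=> x; case.
  rewrite (_ : (fun x => _) = fun=> 0) /Rintegral ?integral0//.
  apply/funext => x; have [Dx|Dx] := pselect (D x); last first.
    by rewrite (test_function_out tf Dx) mul0r.
  rewrite (test_function_out tg) ?mulr0// => h; apply: h; exact: subset_closure.
Qed.

(** A lower bound read off one box where [phi] exceeds half a positive value replaces the change of
    variables, which would give [a ^- 2] exactly. *)
Lemma mollifier_integral_ge phi : mollifier phi -> exists2 c, 0 < c &
  forall (a : R) (b : R * R), a != 0 -> c * a ^- 2 <= \int[mu]_y phi (a *: y + b).
Proof.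
move=> hphi; have [tphi phi0 phi1] := hphi; have [sphi _] := tphi.
have [y0 py0] : exists y, 0 < phi y.
  apply: contrapT => /forallNP h; have : (0 : R) <> 1 by apply/eqP; rewrite eq_sym oner_eq0.
  apply; rewrite -phi1 (_ : phi = fun=> 0) /Rintegral ?integral0//.
  by apply/funext => y; apply/le_anti; rewrite phi0 andbT leNgt; apply/negP.
have /cvgr_dist_lt/(_ (phi y0 / 2)) := @smooth_continuous _ _ [::] y0 sphi.
rewrite divr_gt0// => /(_ isT) /nbhs_ballP [r /= r0 hr].
exists (phi y0 / 2 * r ^+ 2); first by rewrite mulr_gt0 ?divr_gt0 ?exprn_gt0.
move=> a b a0.
have bf : bsup (fun y => phi (a *: y + b)).
  have [mf [q [M [q0 M0 fM fq]]]] := test_function_bsup [::] tphi.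
  have := smooth_affine 1 a b sphi; under eq_fun do rewrite mul1r.
  move=> sm; split; first exact: smooth_mfun.
  exists ((q + `|b|) / `|a|), M; split => //; first by rewrite divr_ge0// addr_ge0.
  move=> x; rewrite ltr_pdivrMr ?normr_gt0// mulrC => h; apply: fq.
  have := lerB_normD (a *: x) b; rewrite normrZ; lra.
have a1 : 0 < `|a| by rewrite normr_gt0.
apply: le_trans (@Rintegral_box_ge _ _ (a^-1 *: (y0 - b)) (r / 2 / `|a|) (phi y0 / 2) bf _ _ _ _).
- rewrite [leRHS](_ : _ = phi y0 / 2 * r ^+ 2 * (`|a| ^- 2)); last by field; exact: lt0r_neq0.
  by rewrite real_normK ?num_real.
- by rewrite !divr_ge0// ltW.
- by rewrite divr_ge0.
- by move=> x.
- move=> x h; have /hr /= : ball y0 r (a *: x + b).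
    rewrite -ball_normE /ball_ /= distrC.
    have -> : a *: x + b - y0 = a *: (x - a^-1 *: (y0 - b)).
      by rewrite scalerBr scalerA mulfV// scale1r opprB addrA addrAC.
    rewrite normrZ mulrC -ltr_pdivlMr//; apply: le_lt_trans h _.
    by rewrite ltr_pM2r ?invr_gt0// ltr_pdivrMr//; lra.
  by rewrite ltr_norml; lra.
Qed.
End HpzNorm.

(** * Expansion of the logarithmic kernels *)

Section LogExpansion.
Context {R : realType}.
Implicit Types (u b z q : R[i]) (x y : R * R).

(** Taylor expansion of ln |1 - u|, obtained from ln v <= v - 1 applied to v = |1 - u| ^ 2 and to
    its inverse. *)
Lemma ln_normc1B u : normc u <= 2^-1 -> `|ln (normc (1 - u)) + Re u| <= 13 * normc u ^+ 2.
Proof.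
move=> u2; have u0 := normc_ge0 u.
have n1 : 2^-1 <= normc (1 - u) by have := le_normcB 1 u; rewrite normc1; lra.
have n0 : 0 < normc (1 - u) by lra.
set v := normc (1 - u) ^+ 2.
have vE : v = 1 - 2 * Re u + normc u ^+ 2.
  by rewrite /v !normc_sqr; case: (u) => s t /=; ring.
have lE : ln v = 2 * ln (normc (1 - u)).
  by rewrite /v lnXn// mulr_natl.
have v0 : 4^-1 <= v by rewrite /v; nra.
have v0' : 0 < v by lra.
have h1 : ln v <= v - 1 by have := @le_ln1Dx _ (v - 1); rewrite addrCA subrr addr0; apply; lra.
have h2 : - ln v <= v^-1 - 1.
  rewrite -lnV; last by rewrite posrE.
  have := @le_ln1Dx _ (v^-1 - 1); rewrite addrCA subrr addr0; apply.
  by have := v0'; rewrite -invr_gt0; lra.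
have ru := Re_le_normc u.
have h3 : v^-1 - 1 <= 1 - v + 25 * normc u ^+ 2.
  have -> : v^-1 - 1 = (1 - v) + (1 - v) ^+ 2 / v by field; exact: lt0r_neq0.
  rewrite lerD2l ler_pdivrMr//.
  have : `|1 - v| <= 5/2 * normc u.
    rewrite vE; move: ru; rewrite !ler_norml; nra.
  rewrite ler_norml; nra.
rewrite ler_norml; apply/andP; split; nra.
Qed.

(** Factor 1 - b (z + q) as (1 - b z) (1 - u) with u = b q / (1 - b z). The error carries |q| |z|
    and not merely |q|: this extra |z| is what makes it smaller than the main term. *)
Lemma ln_normc1BD b z q : normc b * normc z <= 4^-1 -> normc q <= normc z ->
  `|ln (normc (1 - b * (z + q))) - ln (normc (1 - b * z)) + Re (b * q)| <=
    54 * normc b ^+ 2 * (normc q * normc z).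
Proof.
move=> bz qz; have z0 := normc_ge0 z; have q0 := normc_ge0 q; have b0 := normc_ge0 b.
have n1 : 3/4 <= normc (1 - b * z) by have := le_normcB 1 (b * z); rewrite normc1 normcM; lra.
have n0 : 0 < normc (1 - b * z) by lra.
have w0 : 1 - b * z != 0 by rewrite -normc_gt0.
set u := b * q / (1 - b * z).
have nu : normc u <= 4/3 * (normc b * normc q).
  rewrite /u normcM normcV ler_pdivrMr// normcM.
  have : 0 <= normc b * normc q by exact: mulr_ge0.
  nra.
have bq : normc b * normc q <= 4^-1 by apply: le_trans bz; exact: ler_wpM2l.
have u2 : normc u <= 2^-1 by lra.
have E : 1 - b * (z + q) = (1 - b * z) * (1 - u).
  by rewrite /u; field.
have n2 : 0 < normc (1 - u) by have := le_normcB 1 u; rewrite normc1; lra.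
rewrite E normcM lnM ?posrE//.
rewrite [X in `|X|](_ : _ = (ln (normc (1 - u)) + Re u) - Re (u - b * q)); last first.
  by rewrite cReD cReN; ring.
apply: le_trans (ler_normB _ _) _.
have h1 := ln_normc1B u2.
have h2 : `|Re (u - b * q)| <= 4/3 * (normc b ^+ 2 * (normc q * normc z)).
  apply: le_trans (Re_le_normc _) _.
  have -> : u - b * q = u * (b * z) by rewrite /u; field.
  rewrite normcM (normcM b z).
  have : 0 <= normc b * normc z by exact: mulr_ge0.
  nra.
have h3 : normc u ^+ 2 <= 16/9 * (normc b ^+ 2 * (normc q * normc z)).
  apply: (@le_trans _ _ ((4/3 * (normc b * normc q)) ^+ 2)).
    by apply: lerXn2r nu; rewrite nnegrE ?normc_ge0// !mulr_ge0.
  have : normc q * normc q <= normc q * normc z by exact: ler_wpM2l.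
  have : 0 <= normc b ^+ 2 by exact: sqr_ge0.
  nra.
have : 0 <= normc b ^+ 2 * (normc q * normc z) by rewrite mulr_ge0 ?sqr_ge0// mulr_ge0.
lra.
Qed.
End LogExpansion.

Section LogDifference.
Context {R : realType}.
Implicit Types (b z : R[i]) (x y : R * R) (q : R * R -> R[i]).
Local Notation e0 := (basis2 R 0).

Lemma cx_e0 : cx e0 = 1 :> R[i]. Proof. by []. Qed.

Lemma is_derive_ln_normc1B b y : 1 - b * cx y != 0 ->
  is_derive y e0 (fun y => ln (normc (1 - b * cx y))) (- Re (b / (1 - b * cx y))).
Proof.
move=> f0; have df : cderiv (fun y => 1 - b * cx y) y (0 - b * 1).
  by apply: cderivB; [exact: cderiv_cst|apply: cderivZ; exact: cderiv_cx].
have := is_derive_ln_normc e0 f0 df.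
by rewrite cx_e0 mul1r mulr1 sub0r mulNr cReN.
Qed.

Lemma is_derive_Re_pole b y n : 1 - b * cx y != 0 ->
  is_derive y e0 (fun y => - (n`!%:R * Re ((b / (1 - b * cx y)) ^+ n.+1)))
    (- (n.+1`!%:R * Re ((b / (1 - b * cx y)) ^+ n.+2))).
Proof.
move=> f0; have df : cderiv (fun y => 1 - b * cx y) y (0 - b * 1).
  by apply: cderivB; [exact: cderiv_cst|apply: cderivZ; exact: cderiv_cx].
have := cderiv_Re e0 (cderivX n.+1 (cderivZ b (cderivV f0 df))).
move=> /(is_deriveZ (- n`!%:R)) h.
rewrite (_ : (fun y => _) = - n`!%:R \*: (fun y => Re ((b * (1 - b * cx y)^-1) ^+ n.+1))); last first.
  by apply/funext => w; rewrite -[RHS]/(- n`!%:R * _) mulNr.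
rewrite (_ : - (_ * _) = - n`!%:R *: Re (cx e0 * (n.+1%:R * (b * (1 - b * cx y)^-1) ^+ n.+1.-1 *
  (b * (- (0 - b * 1) / (1 - b * cx y) ^+ 2)))))//.
rewrite cx_e0 mul1r -[RHS]/(- n`!%:R * _) factS natrM mulNr; congr (- _).
rewrite [in LHS]mulrAC mulrC; congr (_ * _).
rewrite -Re_mulr_real; congr Re.
have -> : ((n.+1%:R : R)%:C)%C = n.+1%:R :> R[i] by rewrite rmorph_nat.
by rewrite /= !exprS; field.
Qed.

Lemma iter_dif_ln b K y d M : (0 < K)%N -> 0 <= d -> normc b <= M ->
  (forall t, 0 <= t <= K%:R * d -> M * normc (cx (t *: e0 + y)) <= 2^-1) ->
  `|iter K (dif e0 d) (fun y => ln (normc (1 - b * cx y))) y| <=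
    K.-1`!%:R * (2 * M) ^+ K * d ^+ K.
Proof.
move=> K0 d0 bM hM.
have M0 : 0 <= M by apply: le_trans bM; exact: normc_ge0.
have n2 t : 0 <= t <= K%:R * d -> 2^-1 <= normc (1 - b * cx (t *: e0 + y)).
  move=> /hM h; have := le_normcB 1 (b * cx (t *: e0 + y)); rewrite normc1 normcM.
  have : normc b * normc (cx (t *: e0 + y)) <= M * normc (cx (t *: e0 + y)).
    by apply: ler_wpM2r => //; exact: normc_ge0.
  lra.
have n0 t : 0 <= t <= K%:R * d -> 1 - b * cx (t *: e0 + y) != 0.
  by move=> /n2 h; rewrite -normc_gt0; lra.
pose r (j : nat) (y : R * R) : R := if j is n.+1 then - (n`!%:R * Re ((b / (1 - b * cx y)) ^+ n.+1))
  else ln (normc (1 - b * cx y)).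
apply: (@iter_dif_le _ _ e0 K r) => //.
  move=> [|j] t _ ht; last exact/is_derive_Re_pole/n0.
  by rewrite /= fact0 mul1r expr1; exact/is_derive_ln_normc1B/n0.
move=> t ht; rewrite /r; case: (K) K0 => [//|n] _.
rewrite normrN normrM ger0_norm// ler_wpM2l//.
apply: le_trans (Re_le_normc _) _; rewrite normcX.
apply: lerXn2r; rewrite ?nnegrE ?normc_ge0 ?mulr_ge0//.
rewrite normcM normcV ler_pdivrMr; last by have := n2 t ht; lra.
have := n2 t ht; nra.
Qed.

(* Green's kernel has this shape: see [gker], with [q y = c y ^ alpha]. *)
Lemma iter_dif_ln_perturbed b1 b2 q (kappa : R) K y d M E : (0 < K)%N -> 0 <= d ->
  b1 - b2 = - (kappa%:C)%C -> normc b1 <= M -> normc b2 <= M ->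
  (forall t, 0 <= t <= K%:R * d -> [/\ M * normc (cx (t *: e0 + y)) <= 4^-1,
     normc (q (t *: e0 + y)) <= normc (cx (t *: e0 + y)) &
     normc (q (t *: e0 + y)) * normc (cx (t *: e0 + y)) <= E]) ->
  `|iter K (dif e0 d) (fun y => ln (normc (1 - b1 * (cx y + q y))) -
       ln (normc (1 - b2 * (cx y + q y)))) y -
     kappa * iter K (dif e0 d) (fun y => Re (q y)) y| <=
    2 * (K.-1`!%:R * (2 * M) ^+ K * d ^+ K) + 2 ^+ K * (108 * M ^+ 2 * E).
Proof.
move=> K0 d0 bk b1M b2M h.
have M0 : 0 <= M by apply: le_trans b1M; exact: normc_ge0.
have lin f1 f2 f3 f4 f5 : iter K (dif e0 d)
    (fun y => (f1 y + -1 * f2 y) + (kappa * f3 y + (f4 y + -1 * f5 y))) y =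
  (iter K (dif e0 d) f1 y + -1 * iter K (dif e0 d) f2 y) + (kappa * iter K (dif e0 d) f3 y +
  (iter K (dif e0 d) f4 y + -1 * iter K (dif e0 d) f5 y)) by rewrite !iter_difD !iter_difZ.
pose l b y : R := ln (normc (1 - b * cx y)).
pose lq b y : R := ln (normc (1 - b * (cx y + q y))) - ln (normc (1 - b * cx y)) + Re (b * q y).
(* Three pieces: logarithms with [q] removed, killed to order d ^ K by the differences; the linear
   term, with coefficient kappa since b1 - b2 = - kappa; and remainders bounded through |q| |z|. *)
have -> : (fun y => ln (normc (1 - b1 * (cx y + q y))) - ln (normc (1 - b2 * (cx y + q y)))) =
  (fun y => (l b1 y + -1 * l b2 y) + (kappa * Re (q y) + (lq b1 y + -1 * lq b2 y))).
  apply/funext => w; rewrite /l /lq.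
  have : Re (b1 * q w) - Re (b2 * q w) = - (kappa * Re (q w)).
    rewrite -cReN -cReD -mulrBl bk mulNr cReN; congr (- _).
    by case: (q w) => s t /=; ring.
  lra.
rewrite (lin (l b1) (l b2) (fun y => Re (q y)) (lq b1) (lq b2)).
have hl b : normc b <= M -> `|iter K (dif e0 d) (l b) y| <= K.-1`!%:R * (2 * M) ^+ K * d ^+ K.
  by move=> bM; apply: iter_dif_ln => // t /h[]; lra.
have hq b : normc b <= M -> `|iter K (dif e0 d) (lq b) y| <= 2 ^+ K * (54 * M ^+ 2 * E).
  move=> bM; apply: iter_dif_sup => j jK.
  have [] := h (j%:R * d); first by rewrite mulr_ge0//= ler_wpM2r// ler_nat.
  set w := _ + y => h1 h2 h3.
  have nb := normc_ge0 b; have nw := normc_ge0 (cx w); have nq := normc_ge0 (q w).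
  have bw : normc b * normc (cx w) <= 4^-1 by apply: le_trans h1; exact: ler_wpM2r.
  apply: le_trans (ln_normc1BD bw h2) _.
  apply: ler_pM => //; first by rewrite mulr_ge0// sqr_ge0.
    by rewrite mulr_ge0.
  by rewrite ler_wpM2l//; apply: lerXn2r.
rewrite (_ : 2 ^+ K * (108 * M ^+ 2 * E) = 2 * (2 ^+ K * (54 * M ^+ 2 * E))); last by ring.
have := hl b1 b1M; have := hl b2 b2M; have := hq b1 b1M; have := hq b2 b2M.
move: (K.-1`!%:R * _ * _) (2 ^+ K * _) => u v.
pose s b := iter K (dif e0 d) (l b) y; pose s' b := iter K (dif e0 d) (lq b) y.
change (`|s' b2| <= v -> `|s' b1| <= v -> `|s b2| <= u -> `|s b1| <= u ->
  `|(s b1 + -1 * s b2) + (kappa * iter K (dif e0 d) (fun y => Re (q y)) y + (s' b1 + -1 * s' b2))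
  - kappa * iter K (dif e0 d) (fun y => Re (q y)) y| <= 2 * u + 2 * v).
rewrite !ler_norml; lra.
Qed.
End LogDifference.

(** * Homogeneity and differences of z ^ alpha *)

Section RootPower.
Context {R : realType}.
Implicit Types (z : R[i]) (x y : R * R) (f : R * R -> R).
Local Notation e0 := (basis2 R 0).

Lemma sqrtc_scale (r : R) z : 0 <= r -> sqrtc (((r ^+ 2)%:C)%C * z) = (r%:C)%C * sqrtc z.
Proof.
move=> r0; have [->|rn0] := eqVneq r 0; first by rewrite expr0n /= !mul0r sqrtc0.
have rp : 0 < r ^+ 2 by rewrite exprn_gt0// lt0r rn0.
case: z => a b; have -> : ((r ^+ 2)%:C)%C * Complex a b = Complex (r ^+ 2 * a) (r ^+ 2 * b).
  by apply: eq_ReIm => /=; ring.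
have -> : (r%:C)%C * sqrtc (Complex a b) =
    Complex (r * Re (sqrtc (Complex a b))) (r * Im (sqrtc (Complex a b))).
  by apply: eq_ReIm => /=; ring.
have E : (r ^+ 2 * a) ^+ 2 + (r ^+ 2 * b) ^+ 2 = (r ^+ 2) ^+ 2 * (a ^+ 2 + b ^+ 2) by ring.
have S (t : R) : Num.sqrt (r ^+ 2 * t) = r * Num.sqrt t.
  by rewrite sqrtrM ?sqr_ge0// sqrtr_sqr ger0_norm.
have S2 : Num.sqrt ((r ^+ 2) ^+ 2 * (a ^+ 2 + b ^+ 2)) = r ^+ 2 * Num.sqrt (a ^+ 2 + b ^+ 2).
  by rewrite sqrtrM ?sqr_ge0// sqrtr_sqr (ger0_norm (ltW rp)).
rewrite /sqrtc /= E S2.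
set n := Num.sqrt (a ^+ 2 + b ^+ 2).
have -> : (r ^+ 2 * n + r ^+ 2 * a) / 2 = r ^+ 2 * ((n + a) / 2) by ring.
have -> : (r ^+ 2 * n - r ^+ 2 * a) / 2 = r ^+ 2 * ((n - a) / 2) by ring.
rewrite !S sgrM (gtr0_sg rp) mul1r mulf_eq0 gt_eqF//=.
by congr Complex; case: ifP => _; ring.
Qed.

Lemma rt_scale k (r : R) z : 0 <= r -> rt k (((r ^+ (2 ^ k))%:C)%C * z) = (r%:C)%C * rt k z.
Proof.
elim: k r => [|k ih] r r0; first by rewrite expr1.
rewrite /rt !iterS -!/(rt k _) expnS exprM ih; last exact: exprn_ge0.
exact: sqrtc_scale.
Qed.

Lemma rt_real k (t : R) : 0 <= t -> exists2 s : R, 0 <= s & rt k ((t%:C)%C) = (s%:C)%C.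
Proof.
move=> t0; elim: k => [|k [s s0 ih]]; first by exists t.
exists (Num.sqrt s); first exact: sqrtr_ge0.
by rewrite /rt iterS -/(rt k _) ih sqrtc_sqrtr// lecR.
Qed.

Lemma rt_powR k a (t : R) : 0 <= t -> Re (rt k ((t%:C)%C) ^+ a) = t `^ (a%:R / (2 ^ k)%:R).
Proof.
move=> t0; have [s s0 rs] := rt_real k t0.
have st : s ^+ (2 ^ k) = t.
  have := rtX k ((t%:C)%C); rewrite rs -rmorphXn /=.
  by case.
by rewrite rs -rmorphXn /= -st -[s ^+ (2 ^ k)]powR_mulrn// -powRrM mulrCA mulfV ?mulr1 ?powR_mulrn.
Qed.

Lemma iter_dif_scale f (d : R) K y :
  iter K (dif e0 d) f (d *: y) = iter K (dif e0 1) (fun y => f (d *: y)) y.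
Proof.
elim: K y => [//|K ih] y; rewrite !iterS /dif -!ih.
by rewrite scalerDr scalerA mulr1.
Qed.

Lemma is_derive_fst (g : R -> R) y d :
  is_derive y.1 1 g d -> is_derive y e0 (fun y => g y.1) d.
Proof. by move=> /is_derive_line h; apply/is_derive_line; exact: h. Qed.

Lemma powR_between (u v t e : R) : 0 < u -> u <= t -> t <= v ->
  Num.min (u `^ e) (v `^ e) <= t `^ e <= Num.max (u `^ e) (v `^ e).
Proof.
move=> u0 ut tv; have t0 : 0 < t by lra.
have v0 : 0 < v by lra.
rewrite ge_min le_max; have [e0|e0] := leP 0 e.
  have h (w z : R) : 0 < w -> w <= z -> w `^ e <= z `^ e.
    by move=> w0 wz; rewrite ge0_ler_powR ?nnegrE ?(ltW w0) ?(le_trans (ltW w0) wz).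
  by rewrite (h u t u0 ut) (h t v t0 tv) orbT.
have ne : 0 <= - e by lra.
have E (w : R) : w `^ e = (w `^ (- e))^-1 by rewrite -powRN opprK.
have h (w z : R) : 0 < w -> w <= z -> z `^ e <= w `^ e.
  move=> w0 wz; rewrite !E lef_pV2 ?posrE ?powR_gt0 ?(lt_le_trans w0 wz)//.
  by rewrite ge0_ler_powR ?nnegrE ?(ltW w0) ?(le_trans (ltW w0) wz).
by rewrite (h u t u0 ut) (h t v t0 tv) orbT.
Qed.

(** The K-th derivative of t ^ b is t ^ (b - K) times the product of the b - i for i < K. The
    product is nonzero because b is not a natural number, so the derivative keeps one sign, and so
    does the K-th difference. *)
Lemma iter_dif_powR (b : R) K x : (forall j : nat, b != j%:R) -> 0 < x.1 ->
  iter K (dif e0 1) (fun y => y.1 `^ b) x != 0.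
Proof.
move=> bj x0.
pose c (j : nat) : R := \prod_(i < j) (b - i%:R).
have c0 : c K != 0 by apply/prodf_neq0 => i _; rewrite subr_eq0.
pose r (j : nat) (y : R * R) : R := c j * y.1 `^ (b - j%:R).
have dr j t : (j < K)%N -> 0 <= t <= K%:R * 1 ->
    is_derive (t *: e0 + x) e0 (r j) (r j.+1 (t *: e0 + x)).
  move=> _ /andP[t0 _]; set y := _ + x.
  have y0 : 0 < y.1 by rewrite /y shift_fst; lra.
  have h1 := is_derive_fst (is_derive1_powR (b - j%:R) y0).
  have := @is_deriveZ _ _ _ _ (c j) _ _ _ h1.
  rewrite (_ : _ *: (_ * _) = r j.+1 y)// -[LHS]/(c j * _) /r /c big_ord_recr /=.
  by rewrite mulrA -natr1 opprD addrA.
have -> : (fun y : R * R => y.1 `^ b) = r 0.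
  by apply/funext => y; rewrite /r /c big_ord0 mul1r subr0.
set e := b - K%:R; set u := x.1; set v := x.1 + K%:R.
have uv : u <= v by rewrite lerDl.
have v0 : 0 < v by exact: lt_le_trans uv.
have m0 : 0 < Num.min (u `^ e) (v `^ e) by rewrite lt_min !powR_gt0.
have rb t : 0 <= t <= K%:R * 1 ->
    Num.min (u `^ e) (v `^ e) <= (t *: e0 + x).1 `^ e <= Num.max (u `^ e) (v `^ e).
  move=> /andP[t0 t1]; apply: powR_between; rewrite ?shift_fst /u /v//; lra.
set m := Num.min _ _ in m0 rb; set M := Num.max _ _ in rb.
have bd := @iter_dif_bounds _ _ e0 K r x 1.
have [cp|cn] := ltP 0 (c K).
  have /andP[h _] : c K * m * 1 ^+ K <= iter K (dif e0 1) (r 0) x <= c K * M * 1 ^+ K.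
    by apply: bd => // t /rb; rewrite /r !ler_pM2l.
  by rewrite gt_eqF//; apply: lt_le_trans h; rewrite expr1n mulr1 mulr_gt0.
have cn' : c K < 0 by rewrite lt_neqAle c0.
have /andP[_ h] : c K * M * 1 ^+ K <= iter K (dif e0 1) (r 0) x <= c K * m * 1 ^+ K.
  by apply: bd => // t /rb; rewrite /r !ler_nM2l// andbC.
by rewrite lt_eqF//; apply: le_lt_trans h _; rewrite expr1n mulr1 nmulr_rlt0.
Qed.

Definition rtdif k a K y : R := iter K (dif e0 1) (fun y => Re (rt k (cx y) ^+ a)) y.

(** Homogeneity under positive dilations: with step w ^ (2 ^ k) the factor d ^ alpha is the integer
    power w ^ a. *)
Lemma rtdif_scale k a K (w : R) y : 0 <= w ->
  iter K (dif e0 (w ^+ (2 ^ k))) (fun y => Re (rt k (cx y) ^+ a)) (w ^+ (2 ^ k) *: y) =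
  w ^+ a * rtdif k a K y.
Proof.
move=> w0; rewrite iter_dif_scale -iter_difZ; apply: eq_iter_dif => j _.
by rewrite cxZ rt_scale// exprMn -rmorphXn /= Re_mulr_real.
Qed.

Lemma rtdif_neq0 k a K : (forall j, a != j * 2 ^ k)%N -> rtdif k a K (1, 0) != 0.
Proof.
move=> aj; rewrite /rtdif (@eq_iter_dif _ _ _ _ _ (fun y => y.1 `^ (a%:R / (2 ^ k)%:R))).
  apply: iter_dif_powR => // j.
  have k0 : (2 ^ k)%:R != 0 :> R by rewrite pnatr_eq0 expn_eq0.
  apply: contra (aj j) => /eqP h; rewrite -(@eqr_nat R).
  by rewrite natrM -h divfK.
move=> j _; set y := _ + _.
have -> : cx y = ((y.1)%:C)%C.
  by apply: eq_ReIm; [|rewrite -[LHS]/(y.2) /y shift_snd].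
by rewrite rt_powR// /y shift_fst mulr1 addr_ge0//= ler0n.
Qed.

Lemma continuous_iter_dif f K x : (forall j : nat, {for j%:R *: e0 + x, continuous f}) ->
  iter K (dif e0 1) f @ x --> iter K (dif e0 1) f x.
Proof.
elim: K x => [|K ih] x cf; first by have := cf 0%N; rewrite scale0r add0r.
rewrite iterS; apply: cvgB; last by exact: ih.
apply: (@cvg_comp _ _ _ (fun y => 1 *: e0 + y) (iter K (dif e0 1) f) _ (nbhs (1 *: e0 + x))).
  by apply: cvgD; [exact: cvg_cst|exact: cvg_id].
by apply: ih => j; rewrite addrA -scalerDl natr1; exact: cf.
Qed.

Lemma continuous_Re_rtX k a y : 0 < y.1 ->
  {for y, continuous (fun y => Re (rt k (cx y) ^+ a))}.
Proof.
move=> y0; have [] // : cvgc (nbhs y) (fun y => rt k (cx y) ^+ a) (rt k (cx y) ^+ a).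
apply: cvgcX; apply: cvgc_rt; last exact: cvgc_cx.
  by apply: sect_Re_ge0; exact: ltW.
apply: near_sect; rewrite -[Re _]/(y.1); have := normc_ge0 (cx y); lra.
Qed.

(** The origin of the bump radius [rho]: the K-th difference is nonzero at (1, 0) and continuous
    there, so on a small box it keeps a sign s and stays away from 0. The cap 1/2 keeps the support
    of the bump away from 0. *)
Lemma rtdif_lower k a K : (forall j, a != j * 2 ^ k)%N ->
  exists s rho : R, [/\ s \in [:: 1; -1], 0 < rho, rho <= 2^-1 &
    exists2 m, 0 < m & forall y, `|y - (1, 0)| <= rho -> m <= s * rtdif k a K y].
Proof.
move=> /(rtdif_neq0 K); set v := rtdif _ _ _ (1, 0) => v0.
have cv : rtdif k a K @ ((1, 0) : R * R) --> v.
  apply: continuous_iter_dif => j; apply: continuous_Re_rtX.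
  by rewrite shift_fst /= ltr_wpDl.
have nv : 0 < `|v| / 2 by rewrite divr_gt0 ?normr_gt0.
have /cvgr_dist_le/(_ _ nv) /nbhs_ballP [r /= r0 hr] := cv.
exists (if 0 < v then 1 else -1), (Num.min (r / 2) 2^-1); split.
- by case: ifP => _; rewrite !inE eqxx ?orbT.
- by rewrite lt_min divr_gt0//= invr_gt0.
- by rewrite ge_min lexx orbT.
exists (`|v| / 2) => // y; rewrite le_min => /andP[yr _].
have /hr : ball ((1, 0) : R * R) r y.
  by rewrite -ball_normE /ball_ /= distrC; lra.
rewrite /= ler_norml; case: ifPn => [vp|vn].
  by rewrite mul1r (gtr0_norm vp); lra.
have vn' : v < 0 by rewrite lt_neqAle v0 leNgt.
by rewrite mulN1r (ltr0_norm vn'); lra.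
Qed.
End RootPower.

(** * Lower bound for the second derivatives *)

Section GreenNear.
Context {R : realType}.
Variables (k a : nat).
Hypothesis k0 : (0 < k)%N.
Hypothesis ka : (2 * 2 ^ k <= a)%N.
Implicit Types (x y : R * R) (b z w : R[i]).
Local Notation Phi := (@Phi R k a).
Local Notation e0 := (basis2 R 0).

(** [far] is where G f is tested, [cone] is where f lives. Their sizes ensure that [pole] and
    [pole'] are at most 4 on [far] and |Phi| at most 1/65 on [cone], so that the logarithms can be
    expanded. *)
Definition far : set (R * R) := [set x | `|x - (2^-1, 0)| < 100^-1].
Definition cone : set (R * R) := [set y | `|y.2| < 2 * y.1 /\ y.1 < 200^-1].

Lemma open_far : open far.
Proof.
have -> : far = ball ((2^-1, 0) : R * R) (100^-1).
  by rewrite -ball_normE; apply/seteqP; split => x; rewrite /far /ball_ /= distrC.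
exact: ball_open.
Qed.

Lemma open_cone : open cone.
Proof.
rewrite openE => y [y1 y2]; rewrite /interior /cone.
have c1 : (fun z : R * R => z.1) @ y --> y.1 by exact: cvg_fst.
have c2 : (fun z : R * R => z.2) @ y --> y.2 by exact: cvg_snd.
have c3 : (fun z : R * R => 2 * z.1 - `|z.2|) @ y --> 2 * y.1 - `|y.2|.
  by apply: cvgB; [apply: cvgM => //; exact: cvg_cst|exact: cvg_norm].
have n1 : \forall z \near y, 0 < 2 * z.1 - `|z.2|.
  by apply: (cvgr_gt _ c3); lra.
have n2 : \forall z \near y, z.1 < 200^-1 by exact: (cvgr_lt _ c1).
by apply: filterS2 n1 n2 => z h1 h2; split => //; lra.
Qed.

Lemma cx_cone y : cone y -> [/\ 0 < Re (cx y), normc (cx y) <= 3 * y.1 & normc (cx y) <= 66^-1].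
Proof.
move=> [y1 y2]; have := normr_ge0 y.2 => h.
have := normc_le_ReIm (cx y); rewrite -[Re _]/(y.1) -[Im _]/(y.2) => h1.
have y0 : 0 < y.1 by lra.
by move: h1; rewrite (gtr0_norm y0); split => //; lra.
Qed.

Lemma cx_half : cx (2^-1, 0) = 2^-1 :> R[i].
Proof.
have -> : (2^-1 : R[i]) = ((2^-1)%:C)%C by rewrite fmorphV rmorph_nat.
by [].
Qed.

Lemma normc_half : normc (2^-1 : R[i]) = 2^-1 :> R.
Proof. by rewrite -cx_half normc_real gtr0_norm// invr_gt0. Qed.

Lemma Phi_far x : far x -> [/\ 0 < Re (cx x), normc (cx x) <= 3 &
  normc (Phi (cx x) - 2^-1) <= 30^-1].
Proof.
move=> h; have hn : normc (cx x - 2^-1) <= 50^-1.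
  have h' : `|x - (2^-1, 0)| < 100^-1 by exact: h.
  have := enorm_le_norm (x - (2^-1, 0)); rewrite enormE cxB cx_half.
  by move: h'; move: (`|_|) (normc _) => u v; lra.
have r0 : 0 < Re (cx x).
  have Rh : Re (2^-1 : R[i]) = 2^-1 by rewrite -cx_half.
  by have := Re_ge_dist (cx x) 2^-1; rewrite Rh; lra.
have n1 : normc (cx x) <= 2^-1 + 50^-1.
  have := le_normcD (2^-1) (cx x - 2^-1); rewrite addrC subrK normc_half; lra.
split=> //; first by lra.
have n3 : normc (cx x) <= 3 by lra.
have := Phi_near k0 ka (sect_Re_ge0 (ltW r0)) n3.
have := le_normc_trans (Phi (cx x)) 2^-1 (cx x); lra.
Qed.

Lemma far_dom x : far x -> dom k a x.
Proof.
move=> /Phi_far[x0 x3 h]; split => //; first exact/sect_Re_ge0/ltW.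
have := le_normc_trans (Phi (cx x)) 1 2^-1.
have -> : 2^-1 - 1 = - 2^-1 :> R[i] by field.
by rewrite normcN normc_half; lra.
Qed.

Lemma Phi_cone y : cone y -> normc (Phi (cx y)) <= 65^-1 /\
  normc (Phi (cx y) - cx y) <= 100^-1 * normc (cx y).
Proof.
move=> /cx_cone[y0 y1 y2]; have n3 : normc (cx y) <= 3 by lra.
have h := Phi_near k0 ka (sect_Re_ge0 (ltW y0)) n3; split => //.
have := le_normcD (Phi (cx y) - cx y) (cx y); rewrite subrK; lra.
Qed.

(** On the cone Re y >= |y| / 3, and [Phi] moves y by at most |y| / 100; in |w - 1| ^ 2 = 1 + |w| ^
    2 - 2 Re w, with w = Phi y, the linear term therefore wins. *)
Lemma cone_dom y : cone y -> dom k a y.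
Proof.
move=> ny; have [y0 y1 y2] := cx_cone ny; have [h1 h2] := Phi_cone ny.
split; [exact/sect_Re_ge0/ltW|lra|].
set w := Phi (cx y) in h1 h2 *.
have hw : normc w <= 101 / 100 * normc (cx y).
  by have := le_normcD (w - cx y) (cx y); rewrite subrK; lra.
have hr : 3^-1 * normc (cx y) - 100^-1 * normc (cx y) <= Re w.
  by have := Re_ge_dist w (cx y); move: y1; rewrite -[y.1]/(Re (cx y)); lra.
have nw := normc_ge0 w; have ny0 := normc_ge0 (cx y).
have E : normc (w - 1) ^+ 2 = normc w ^+ 2 - 2 * Re w + 1.
  by rewrite !normc_sqr; case: (w) => s t /=; ring.
have yp : 0 < normc (cx y) by have := Re_le_normc (cx y); rewrite ler_norml; lra.
have : normc (w - 1) ^+ 2 < 1.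
  rewrite E; have : normc w ^+ 2 <= 65^-1 * normc w by rewrite expr2 ler_wpM2r.
  lra.
by rewrite expr_lt1// normc_ge0.
Qed.

(** [pole] and [pole'] are the reciprocals of Phi x and of its reflection in the circle |w - 1| = 1,
    the two logarithmic poles of the kernel in the variable Phi y; their difference is - [kap]. *)
Definition pole x : R[i] := (Phi (cx x))^-1.
Definition pole' x : R[i] := 1 - conjc (pole x).
Definition kap x : R := 1 - 2 * Re (pole x).

Lemma normc_Phi_far x : far x -> 3^-1 <= normc (Phi (cx x)).
Proof.
move=> /Phi_far[_ _ h]; have := le_normcB (2^-1) (2^-1 - Phi (cx x)).
by rewrite subKr normc_half normcB_sym; lra.
Qed.

Lemma normc_pole x : far x -> normc (pole x) <= 3.
Proof.
move=> /normc_Phi_far h; rewrite /pole normcV -[leRHS]invrK lef_pV2 ?posrE//; lra.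
Qed.

Lemma normc_pole' x : far x -> normc (pole' x) <= 4.
Proof.
move=> /normc_pole h; have := le_normcD 1 (- conjc (pole x)).
by rewrite normcN normc_conj normc1 -/(pole' x); lra.
Qed.

Lemma poleB x : pole x - pole' x = - ((kap x)%:C)%C.
Proof. by rewrite /pole' /kap; case: (pole x) => s t; apply: eq_ReIm => /=; ring. Qed.

Definition gker x y : R := ln (normc (1 - pole x * Phi (cx y))) - ln (normc (1 - pole' x * Phi (cx y))).

Lemma pole_small b y : cone y -> normc b <= 4 -> normc (b * Phi (cx y)) <= 16^-1.
Proof.
move=> /Phi_cone[h _] b4; rewrite normcM.
have := ler_pM (normc_ge0 b) (normc_ge0 _) b4 h; lra.
Qed.

Lemma pole_neq0 b y : cone y -> normc b <= 4 -> 15/16 <= normc (1 - b * Phi (cx y)).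
Proof.
move=> ny b4; have := pole_small ny b4.
by have := le_normcB 1 (b * Phi (cx y)); rewrite normc1; lra.
Qed.

(** Factor Phi x out of both logarithms: the terms ln |Phi x| cancel. *)
Lemma green_gker x y : far x -> cone y -> green k a x y = (2 * pi)^-1 * gker x y.
Proof.
move=> fx ny; rewrite /green /gker; congr (_ * _).
have A0 := normc_Phi_far fx.
have A1 : Phi (cx x) != 0 by rewrite -normc_gt0; lra.
have b1 : normc (pole x) <= 4 by have := normc_pole fx; lra.
have h1 := pole_neq0 ny b1; have h2 := pole_neq0 ny (normc_pole' fx).
set A := Phi (cx x) in A0 A1 *; set W := Phi (cx y) in h1 h2 *.
have -> : A - W = A * (1 - pole x * W) by rewrite /pole -/A; field.
have -> : 1 - conjc (W - 1) * (A - 1) = A * conjc (1 - pole' x * W).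
  have -> : conjc (1 - pole' x * W) = 1 - (1 - pole x) * conjc W.
    by rewrite /pole'; case: (pole x) (W) => s t [u v]; apply: eq_ReIm => /=; ring.
  have -> : conjc (W - 1) = conjc W - 1.
    by case: (W) => u v; apply: eq_ReIm => /=; ring.
  by rewrite /pole -/A; field.
rewrite (normcM A) (normcM A) normc_conj !lnM ?posrE; first by ring.
all: lra.
Qed.

Lemma gker_bound x y : far x -> cone y -> `|gker x y| <= 1.
Proof.
move=> fx ny; have h b : normc b <= 4 -> `|ln (normc (1 - b * Phi (cx y)))| <= 2^-1.
  move=> b4; have h := pole_small ny b4.
  have h2 : normc (b * Phi (cx y)) <= 2^-1 by lra.
  have := ln_normc1B h2; have := Re_le_normc (b * Phi (cx y)).
  have := normc_ge0 (b * Phi (cx y)); move: h; move: (normc _) => n.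
  rewrite !ler_norml; nra.
have b1 : normc (pole x) <= 4 by have := normc_pole fx; lra.
have h1 := h _ b1; have h2 := h _ (normc_pole' fx); rewrite /gker.
apply: le_trans (ler_normB _ _) _; lra.
Qed.

Lemma gker_lipschitz x x' y : far x -> far x' -> cone y ->
  `|gker x y - gker x' y| <= 2 * normc (pole x - pole x').
Proof.
move=> fx fx' ny.
have h b b' : normc b <= 4 -> normc b' <= 4 ->
    `|ln (normc (1 - b * Phi (cx y))) - ln (normc (1 - b' * Phi (cx y)))| <= normc (b - b').
  move=> b4 b4'; have h1 := pole_neq0 ny b4; have h2 := pole_neq0 ny b4'.
  set W := Phi (cx y) in h1 h2 *; have [hW _] := Phi_cone ny; rewrite -/W in hW.
  have f0 : 1 - b' * W != 0 by rewrite -normc_gt0; lra.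
  set u := (b - b') * W / (1 - b' * W).
  have E : 1 - b * W = (1 - b' * W) * (1 - u) by rewrite /u; field.
  have db : normc (b - b') <= 8 by have := le_normcD b (- b'); rewrite normcN; lra.
  have n0 := normc_ge0 (b - b').
  have nu : normc u <= 60^-1 * normc (b - b').
    rewrite /u normcM normcV ler_pdivrMr; last by lra.
    rewrite normcM; have := ler_wpM2l n0 hW; nra.
  have u2 : normc u <= 2^-1 by lra.
  have n1 : 0 < normc (1 - u) by have := le_normcB 1 u; rewrite normc1; lra.
  rewrite E normcM lnM ?posrE//; last by lra.
  rewrite addrAC subrr add0r; have := ln_normc1B u2; have := Re_le_normc u.
  have := normc_ge0 u; move: nu u2; move: (normc u) => n.
  rewrite !ler_norml; nra.
have b1 : normc (pole x) <= 4 by have := normc_pole fx; lra.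
have b1' : normc (pole x') <= 4 by have := normc_pole fx'; lra.
have e1 := h _ _ b1 b1'; have := h _ _ (normc_pole' fx) (normc_pole' fx').
have -> : pole' x - pole' x' = - conjc (pole x - pole x').
  by rewrite /pole'; case: (pole x) (pole x') => s t [u v]; apply: eq_ReIm => /=; ring.
rewrite normcN normc_conj; move: e1; rewrite /gker !ler_norml; lra.
Qed.

Lemma cvgc_Phi_pos x : 0 < Re (cx x) -> cvgc (nbhs x) (fun y => Phi (cx y)) (Phi (cx x)).
Proof.
move=> x0; apply: cvgc_Phi; last exact: cvgc_cx.
  by apply: sect_Re_ge0; exact: ltW.
by apply: near_sect; have := normc_ge0 (cx x); lra.
Qed.

Lemma cvgc_pole x : far x -> cvgc (nbhs x) pole (pole x).
Proof.
move=> fx; have A0 := normc_Phi_far fx; have [x0 _ _] := Phi_far fx.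
apply: cvgcV; last exact: cvgc_Phi_pos.
by rewrite -normc_gt0; lra.
Qed.

Lemma continuous_gker x y : far x -> cone y -> {for y, continuous (gker x)}.
Proof.
move=> fx ny; have [y0 _ _] := cx_cone ny.
have h b : normc b <= 4 ->
    (fun y => ln (normc (1 - b * Phi (cx y)))) @ y --> ln (normc (1 - b * Phi (cx y))).
  move=> b4; apply: continuous_ln_normc.
    by have := pole_neq0 ny b4; rewrite -normc_gt0; lra.
  apply: cvgcB; first exact: cvgc_cst.
  by apply: cvgcM; [exact: cvgc_cst|exact: cvgc_Phi_pos].
apply: cvgB; apply: h; last exact: normc_pole'.
by have := normc_pole fx; lra.
Qed.
End GreenNear.

Section Cut.
Context {R : realType}.
Implicit Types (f g : R * R -> R) (x y : R * R).
Local Notation mu := (@mu2 R).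

Lemma patch_in (O : set (R * R)) f x : O x -> (f \_ O) x = f x.
Proof. by move=> Ox; rewrite patchT// inE. Qed.

Lemma patch_out (O : set (R * R)) f x : ~ O x -> (f \_ O) x = 0.
Proof. by move=> Ox; rewrite patchN// notin_setE. Qed.

(** Kernels are extended by 0 outside the open set where they are continuous; integrals then run
    over the whole plane, where translations act. *)
Lemma mfun2_patch (O : set (R * R)) f : open O -> (forall x, O x -> {for x, continuous f}) ->
  mfun2 setT (f \_ O).
Proof.
move=> oO cf; have mO := open_measurable2 oO.
exact: (measurable_restrictT f mO).1 (continuous_mfun2 oO cf).
Qed.

Lemma patch_bound (O : set (R * R)) f M : 0 <= M -> (forall x, O x -> `|f x| <= M) ->
  forall x, `|(f \_ O) x| <= M.
Proof.
move=> M0 fM x; have [Ox|Ox] := pselect (O x); first by rewrite patch_in// fM.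
by rewrite patch_out// normr0.
Qed.

Lemma Rintegral_norm_le f g C : bsup f -> mfun2 setT g -> bsup (fun y => f y * g y) ->
  0 <= C -> (forall y, 0 <= f y) -> (forall y, f y != 0 -> `|g y| <= C) ->
  `|\int[mu]_y (f y * g y)| <= C * \int[mu]_y f y.
Proof.
move=> bf mg bfg C0 f0 h.
have p y : `|f y * g y| <= C * f y.
  have [->|fy] := eqVneq (f y) 0; first by rewrite mul0r mulr0 normr0.
  by rewrite normrM (ger0_norm (f0 y)) mulrC ler_wpM2r// h.
rewrite -(Rintegral_bsupZ C bf) ler_norml; apply/andP; split.
  rewrite -mulN1r -(Rintegral_bsupZ (-1) (bsupZ C bf)); apply: le_Rintegral_bsup => //.
    by apply: bsupZ; exact: bsupZ.
  by move=> y; have := p y; rewrite ler_norml mulN1r => /andP[].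
apply: le_Rintegral_bsup => //; first exact: bsupZ.
by move=> y; have := p y; rewrite ler_norml => /andP[].
Qed.
End Cut.

(** * Green potentials of atoms *)

Section GreenAtom.
Context {R : realType}.
Variables (k a : nat).
Hypothesis k0 : (0 < k)%N.
Hypothesis ka : (2 * 2 ^ k <= a)%N.
Variable phi : R * R -> R.
Hypothesis hphi : mollifier phi.
Variables (K : nat) (rho : R).
Hypothesis rho0 : 0 < rho.
Hypothesis rho2 : rho <= 2^-1.
Hypothesis K0 : (0 < K)%N.
Hypothesis aK : (a < 2 ^ k * K)%N.
Implicit Types (x y : R * R) (d w : R).
Local Notation mu := (@mu2 R).
Local Notation e0 := (basis2 R 0).
Local Notation Phi := (@Phi R k a).
Local Notation gker := (@gker R k a).
Local Notation cone := (@cone R).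
Local Notation f0 d := (dilate phi (rho * d) (d, 0)).

Definition small d : Prop := 0 < d /\ K.+2%:R * d < 200^-1.

Lemma atom_cone d y : small d -> atom phi K rho d y != 0 -> cone y.
Proof.
move=> [d0 d1] /(atom_strip hphi rho0 rho2 d0)[y1 y2 y3]; split; last lra.
by lra.
Qed.

Lemma dilate_cone d y t : small d -> f0 d y != 0 -> 0 <= t <= K%:R * d ->
  cone (t *: e0 + y) /\ normc (cx (t *: e0 + y)) <= 3 * K.+2%:R * d.
Proof.
move=> [d0 d1] hy /andP[t0 t1].
have h : `|y - (d, 0)| <= 2^-1 * d.
  rewrite leNgt; apply/negP => h; move/eqP: hy; apply; apply: dilate_out => //.
    exact: mulr_gt0.
  by apply: le_trans (ltW h); rewrite ler_wpM2r// ltW.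
move: h; rewrite prod_normE ge_max /= subr0 ler_distl => /andP[/andP[z1 z2] z3].
move: d1; rewrite -(addn2 K) natrD mulrDl => d1.
have n : cone (t *: e0 + y) by rewrite /cone /mkset shift_fst shift_snd; split; lra.
split => //; have [_ + _] := cx_cone n; rewrite shift_fst => h.
by apply: le_trans h _; lra.
Qed.

Definition pert y : R[i] := ((ccoef R k a)%:C)%C * rt k (cx y) ^+ a.

Definition jgreen d x : R := \int[mu]_y (atom phi K rho d y * (gker x \_ cone) y).

(** The factor independent of x in the main term: the bump tested against the K-th difference of Re
    (c y ^ alpha). *)
Definition igreen d : R :=
  \int[mu]_y (f0 d y * iter K (dif e0 d) ((fun y => Re (pert y)) \_ cone) y).

Lemma gker_patch x : far x -> mfun2 setT (gker x \_ cone) /\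
  forall y, `|(gker x \_ cone) y| <= 1.
Proof.
move=> fx; split.
  by apply: mfun2_patch; [exact: open_cone|move=> y; exact: (continuous_gker k0 ka fx)].
by apply: patch_bound => // y; exact: (gker_bound k0 ka fx).
Qed.

Lemma pert_patch : mfun2 setT ((fun y => Re (pert y)) \_ cone) /\
  forall y, `|((fun y => Re (pert y)) \_ cone) y| <= 1.
Proof.
split.
  apply: mfun2_patch; first exact: open_cone.
  move=> y /cx_cone[y0 _ _].
  have -> : (fun y => Re (pert y)) = (fun y => ccoef R k a * Re (rt k (cx y) ^+ a)).
    by apply/funext => z; rewrite /pert Re_mulr_real.
  by apply: cvgM; [exact: cvg_cst|exact: continuous_Re_rtX].
apply: patch_bound => // y ny; have [_ _ h2] := cx_cone ny.
have [_ h] := Phi_cone k0 ka ny.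
apply: le_trans (Re_le_normc _) _; move: h; rewrite /Phi addrAC subrr add0r -/(pert y).
lra.
Qed.

Lemma green_op_atom d x : small d -> far x ->
  green_op (dom k a) (green k a) (atom phi K rho d) x = (2 * pi)^-1 * jgreen d x.
Proof.
move=> sd fx; have [d0 _] := sd; have [mg gb] := gker_patch fx.
have bf := atom_bsup hphi K rho0 d0.
rewrite /green_op Rintegral_mkcond -Rintegral_bsupZ; last exact: bsupM gb.
congr Rintegral; apply/funext => y; rewrite patchE.
have [fy|fy] := eqVneq (atom phi K rho d y) 0.
  by rewrite fy !mul0r mulr0; case: ifP => // _; rewrite mulr0.
have ny := atom_cone sd fy.
rewrite mem_set; last exact: (cone_dom k0 ka ny).
by rewrite (green_gker k0 ka fx ny) patch_in//; ring.
Qed.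

Lemma jgreenE d x : small d -> far x ->
  jgreen d x = \int[mu]_y (f0 d y * iter K (dif e0 d) (gker x \_ cone) y).
Proof.
move=> [d0 _] fx; have [mg gb] := gker_patch fx.
rewrite /jgreen /atom (Rintegral_iter_dif _ _ _ _ mg gb) ?opprK//.
by apply: dilate_bsup => //; exact: mulr_gt0.
Qed.

(** The kernel is Lipschitz in [pole x], uniformly in y, and [pole] is continuous. This makes
    [jgreen] measurable once cut to [far]. *)
Lemma continuous_jgreen d x : small d -> far x -> {for x, continuous (jgreen d)}.
Proof.
move=> sd fx; have [d0 _] := sd; have bf := atom_bsup hphi K rho0 d0.
have [mf [b [M [b0 M0 fM fb]]]] := bf.
have L x' : far x' -> `|jgreen d x' - jgreen d x| <=
    (M * 2 * (2 * b) ^+ 2) * normc (pole k a x' - pole k a x).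
  move=> fx'; have [mg gb] := gker_patch fx; have [mg' gb'] := gker_patch fx'.
  rewrite /jgreen -Rintegral_bsupB; [|exact: bsupM gb'|exact: bsupM gb].
  rewrite (_ : _ * normc _ = M * (2 * normc (pole k a x' - pole k a x)) * (2 * b) ^+ 2); last ring.
  apply: (@Rintegral_box_le _ _ 0) => //.
  - by apply: measurable_funB; apply: measurable_funM.
  - by rewrite !mulr_ge0// normc_ge0.
  - move=> y; rewrite -mulrBr normrM; apply: ler_pM => //.
    have [ny|ny] := pselect (cone y).
      by rewrite !patch_in//; exact: (gker_lipschitz k0 ka fx' fx ny).
    by rewrite !patch_out// subrr normr0 mulr_ge0// normc_ge0.
  - by move=> y; rewrite subr0 => /fb ->; rewrite !mul0r subrr.
have c0 : (M * 2 * (2 * b) ^+ 2) * normc (pole k a x' - pole k a x) @[x' --> x] --> 0.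
  rewrite -[X in _ --> X](mulr0 (M * 2 * (2 * b) ^+ 2)); apply: cvgM; first exact: cvg_cst.
  have := cvgc_dist (cvgc_pole k0 ka fx); exact.
apply/cvgrPdist_le => e e0.
have ne : \forall x' \near x, (M * 2 * (2 * b) ^+ 2) * normc (pole k a x' - pole k a x) < e.
  exact: (cvgr_lt _ c0 e e0).
have nf : \forall x' \near x, far x' by apply: open_nbhs_nbhs; split => //; exact: open_far.
apply: filterS2 nf ne => x' fx' h; rewrite distrC; apply: le_trans (L x' fx') _; exact: ltW.
Qed.

(** The constants of [iter_dif_ln_perturbed] for M = 4; the last power comes from |y| ^ (alpha + 1)
    with |y| <= 3 (K + 2) d. *)
Definition jerr : R := 2 * (K.-1`!%:R * (2 * 4) ^+ K) +
  2 ^+ K * (108 * 4 ^+ 2 * (3 * K.+2%:R) ^+ (a + 2 ^ k)).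

Lemma jerr_ge0 : 0 <= jerr.
Proof. by rewrite addr_ge0// !mulr_ge0// ?exprn_ge0// mulr_ge0. Qed.

(** All the points y + j d e0 with j <= K stay in the cone, so the cut is not seen by the
    differences. *)
Lemma cut_dilate_iter d y (g : R * R -> R) : small d -> f0 d y != 0 ->
  iter K (dif e0 d) (g \_ cone) y = iter K (dif e0 d) g y.
Proof.
move=> sd hy; apply: eq_iter_dif => j jK; rewrite patch_in//.
have [d0 _] := sd.
by have [] := @dilate_cone d y (j%:R * d) sd hy; rewrite ?mulr_ge0 ?(ltW d0) ?ler_wpM2r ?ler_nat ?(ltW d0).
Qed.

Lemma normc_rt_le c w z : 1 <= c -> 0 <= w -> normc z <= c * w ^+ (2 ^ k) ->
  normc (rt k z) <= c * w.
Proof.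
move=> c1 w0 h; have c0 : 0 <= c by lra.
rewrite -(@ler_pXn2r _ (2 ^ k)) ?expn_gt0 ?nnegrE ?normc_ge0 ?mulr_ge0//.
rewrite normc_rt exprMn; apply: le_trans h _; rewrite ler_wpM2r ?exprn_ge0//.
by rewrite ler_eXnr ?expn_gt0.
Qed.

(** Both errors are brought down to w ^ (a + 1). The smooth part gives d ^ K = w ^ (2 ^ k K) with a
    < 2 ^ k K; the remainder is bounded by the (a + 2 ^ k)-th power of the root of y, itself of
    order w. *)
Lemma jgreen_pointwise w x y : 0 < w -> w <= 1 -> small (w ^+ (2 ^ k)) -> far x ->
  f0 (w ^+ (2 ^ k)) y != 0 ->
  `|iter K (dif e0 (w ^+ (2 ^ k))) (gker x \_ cone) y -
    kap k a x * iter K (dif e0 (w ^+ (2 ^ k))) ((fun y => Re (pert y)) \_ cone) y| <=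
  jerr * w ^+ a.+1.
Proof.
move=> w0 w1 sd fx hy; set d := w ^+ (2 ^ k) in sd hy *; have [d0 _] := sd.
have w0' := ltW w0.
have n0 : (0 < 2 ^ k)%N by rewrite expn_gt0.
have c1 : 1 <= 3 * K.+2%:R :> R.
  by rewrite -natrM ler1n.
rewrite !cut_dilate_iter//.
have b1 : normc (pole k a x) <= 4 by have := normc_pole k0 ka fx; lra.
have := @iter_dif_ln_perturbed R (pole k a x) (pole' k a x) pert (kap k a x) K y d 4
  ((3 * K.+2%:R) ^+ (a + 2 ^ k) * w ^+ a.+1) K0 (ltW d0) (poleB k a x) b1
  (normc_pole' k0 ka fx) _.
have -> : (fun y => ln (normc (1 - pole k a x * (cx y + pert y))) -
   ln (normc (1 - pole' k a x * (cx y + pert y)))) = gker x by [].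
move=> h; apply: (le_trans (h _)) => {h}.
  move=> t ht; have [nz zd] := dilate_cone sd hy ht; set z := _ + y in nz zd *.
  have [z0 _ z1] := cx_cone nz; have [_ hq] := Phi_cone k0 ka nz.
  move: hq; rewrite /Phi addrAC subrr add0r -/(pert z) => hq.
  have nz0 := normc_ge0 (cx z); split; [lra|lra|].
  have rz := normc_rt_le c1 w0' zd.
  have qr : normc (pert z) <= normc (rt k (cx z)) ^+ a.
    rewrite /pert normcM normc_real normcX (ger0_norm (ltW (ccoef_gt0 R k0 ka))).
    apply: ler_piMl; first by rewrite exprn_ge0// normc_ge0.
    have := @ccoef_le R k a k0 ka 1; rewrite mulr1 => h.
    apply: le_trans (h _) _; last by lra.
    have a1 := a_gt0 k0 ka.
    by rewrite -!natrX -!natrM ler1n !muln_gt0 !expn_gt0 a1.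
  apply: (@le_trans _ _ (normc (rt k (cx z)) ^+ a * normc (cx z))); first exact: ler_wpM2r.
  rewrite -(normc_rt k (cx z)) -exprD.
  apply: (@le_trans _ _ ((3 * K.+2%:R * w) ^+ (a + 2 ^ k))).
    by apply: lerXn2r rz; rewrite nnegrE ?normc_ge0// !mulr_ge0.
  rewrite exprMn; apply: ler_wpM2l; first by rewrite exprn_ge0// mulr_ge0.
  by apply: ler_wiXn2l => //; rewrite -addn1 leq_add2l.
rewrite /jerr [leRHS]mulrDl; apply: lerD; last by rewrite -!mulrA.
rewrite -[leRHS]mulrA; apply: ler_wpM2l => //; apply: ler_wpM2l.
  by rewrite mulr_ge0// exprn_ge0.
by rewrite /d -exprM; apply: ler_wiXn2l.
Qed.

Lemma f0_ge0 d y : 0 <= f0 d y.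
Proof. exact: (mollifier_ge0 hphi). Qed.

Lemma jgreen_expand w x : 0 < w -> w <= 1 -> small (w ^+ (2 ^ k)) -> far x ->
  `|jgreen (w ^+ (2 ^ k)) x - kap k a x * igreen (w ^+ (2 ^ k))| <=
  jerr * w ^+ a.+1 * \int[mu]_y f0 (w ^+ (2 ^ k)) y.
Proof.
move=> w0 w1 sd fx; have [d0 _] := sd; set d := w ^+ (2 ^ k) in sd d0 *.
have bf : bsup (f0 d) by apply: dilate_bsup => //; exact: mulr_gt0.
have bi g : mfun2 setT g -> (forall y, `|g y| <= 1) ->
    mfun2 setT (iter K (dif e0 d) g) /\ (forall y, `|iter K (dif e0 d) g y| <= 2 ^+ K * 1).
  move=> mg gb; split; last by move=> y; apply: iter_dif_sup.
  elim: K => [//|n ih] /=; apply: measurable_funB => //.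
  exact: (measurableT_comp ih (@measurable_shift R (d *: e0))).
have [mg gb] := gker_patch fx; have [mp pb] := pert_patch.
have [mg' gb'] := bi _ mg gb; have [mp' pb'] := bi _ mp pb.
have b1 := bsupM bf mg' gb'; have b2 := bsupM bf mp' pb'.
rewrite jgreenE// /igreen -(Rintegral_bsupZ (kap k a x) b2) -Rintegral_bsupB//; last exact: bsupZ.
have E : (fun y => f0 d y * iter K (dif e0 d) (gker x \_ cone) y -
    kap k a x * (f0 d y * iter K (dif e0 d) ((fun y => Re (pert y)) \_ cone) y)) =
  (fun y => f0 d y * (iter K (dif e0 d) (gker x \_ cone) y -
    kap k a x * iter K (dif e0 d) ((fun y => Re (pert y)) \_ cone) y)).
  by apply/funext => y; ring.
rewrite E; apply: Rintegral_norm_le => //.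
- by apply: measurable_funB => //; apply: measurable_funM => //; exact: measurable_cst.
- by rewrite -E; apply: bsupB => //; exact: bsupZ.
- by rewrite mulr_ge0 ?jerr_ge0// exprn_ge0// ltW.
- exact: f0_ge0.
- by move=> y; exact: jgreen_pointwise.
Qed.

(** Rescaling by d brings the support of the bump to the box of radius rho around (1, 0), where the
    sign and the size of [rtdif] are known. *)
Lemma igreen_lower s m w : 0 < m ->
  (forall y, `|y - (1, 0)| <= rho -> m <= s * rtdif k a K y) ->
  0 < w -> small (w ^+ (2 ^ k)) ->
  ccoef R k a * m * w ^+ a * \int[mu]_y f0 (w ^+ (2 ^ k)) y <= s * igreen (w ^+ (2 ^ k)).
Proof.
move=> m0 hm w0 sd; have [d0 _] := sd.
have sc y : f0 (w ^+ (2 ^ k)) y != 0 ->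
    iter K (dif e0 (w ^+ (2 ^ k))) ((fun y => Re (pert y)) \_ cone) y =
    ccoef R k a * (w ^+ a * rtdif k a K ((w ^+ (2 ^ k))^-1 *: y)).
  move=> hy; rewrite cut_dilate_iter//.
  have -> : (fun y => Re (pert y)) = (fun y => ccoef R k a * Re (rt k (cx y) ^+ a)).
    by apply/funext => z; rewrite /pert Re_mulr_real.
  rewrite iter_difZ -rtdif_scale ?(ltW w0)// scalerA mulfV ?scale1r//.
  exact: lt0r_neq0.
set d := w ^+ (2 ^ k) in sd d0 sc *.
have bf : bsup (f0 d) by apply: dilate_bsup => //; exact: mulr_gt0.
have [mp pb] := pert_patch.
have mp' : mfun2 setT (iter K (dif e0 d) ((fun y => Re (pert y)) \_ cone)).
  elim: K => [//|n ih] /=; apply: measurable_funB => //.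
  exact: (measurableT_comp ih (@measurable_shift R (d *: e0))).
have b2 : bsup (fun y => f0 d y * iter K (dif e0 d) ((fun y => Re (pert y)) \_ cone) y).
  by apply: (bsupM (M := 2 ^+ K * 1)) => // y; apply: iter_dif_sup.
rewrite /igreen -!Rintegral_bsupZ//; apply: le_Rintegral_bsup; [exact: bsupZ|exact: bsupZ|].
move=> y; have [->|hy] := eqVneq (f0 d y) 0; first by rewrite mul0r !mulr0.
rewrite sc//; have c0 := ccoef_gt0 R k0 ka; set r := rtdif _ _ _ _.
rewrite [leLHS](_ : _ = f0 d y * ccoef R k a * w ^+ a * m); last by ring.
rewrite [leRHS](_ : _ = f0 d y * ccoef R k a * w ^+ a * (s * r)); last by ring.
apply: ler_wpM2l.
  by rewrite mulr_ge0 ?exprn_ge0 ?(ltW w0)// mulr_ge0 ?f0_ge0// ltW.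
apply: hm; have -> : d^-1 *: y - (1, 0) = d^-1 *: (y - (d, 0)).
  rewrite scalerBr; congr (_ - _); rewrite -[RHS]/(d^-1 * d, d^-1 * 0) mulr0 mulVf//.
  exact: lt0r_neq0.
rewrite normrZ gtr0_norm ?invr_gt0// mulrC ler_pdivrMr// leNgt; apply/negP => h.
move/eqP: hy; apply; apply: dilate_out => //; [exact: mulr_gt0|exact: ltW].
Qed.
End GreenAtom.

(** * Strict concavity of kappa near 1/2 *)

Section Kappa.
Context {R : realType}.
Variables (k a : nat).
Hypothesis k0 : (0 < k)%N.
Hypothesis ka : (2 * 2 ^ k <= a)%N.
Implicit Types (x y : R * R).
Local Notation mu := (@mu2 R).
Local Notation e0 := (basis2 R 0).
Local Notation Phi := (@Phi R k a).
Local Notation kap := (@kap R k a).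
Local Notation pole := (@pole R k a).
Local Notation far := (@far R).
Local Notation c := (((ccoef R k a)%:C)%C : R[i]).

Lemma cderiv_rtX m x : (2 ^ k <= m)%N -> 0 < Re (cx x) ->
  cderiv (fun y => rt k (cx y) ^+ m) x (m%:R / (2 ^ k)%:R * rt k (cx x) ^+ (m - 2 ^ k)).
Proof.
move=> km x0; have cx0 : cx x != 0 by apply: contraTneq x0 => ->; rewrite /= ltxx.
have d := @cderiv_rt R k x cx0 (sect_Re_ge0 (ltW x0)) _.
have ns : \forall y \near x, sect (cx y).
  by apply: near_sect; have := normc_ge0 (cx x); lra.
have := cderivX m (d ns); set z := rt k (cx x).
have z0 : z != 0 by rewrite rt_eq0.
have n0 : (2 ^ k)%:R != 0 :> R[i] by rewrite pnatr_eq0 expn_eq0.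
suff -> : m%:R * z ^+ m.-1 * ((2 ^ k)%:R * z ^+ (2 ^ k - 1))^-1 =
  m%:R / (2 ^ k)%:R * z ^+ (m - 2 ^ k) by [].
have -> : z ^+ m.-1 = z ^+ (m - 2 ^ k) * z ^+ (2 ^ k - 1).
  by rewrite -exprD; congr (_ ^+ _); have := expn_gt0 2 k; move: km; lia.
by field; rewrite n0 expf_neq0.
Qed.

Definition dPhi x : R[i] := 1 + c * (a%:R / (2 ^ k)%:R * rt k (cx x) ^+ (a - 2 ^ k)).
Definition ddPhi x : R[i] := c * (a%:R / (2 ^ k)%:R *
  ((a - 2 ^ k)%:R / (2 ^ k)%:R * rt k (cx x) ^+ (a - 2 ^ k - 2 ^ k))).

Lemma cderiv_Phi x : far x -> cderiv (fun y => Phi (cx y)) x (dPhi x).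
Proof.
move=> /(Phi_far k0 ka)[x0 _ _]; apply: cderivD; first exact: cderiv_cx.
by apply: cderivZ; apply: cderiv_rtX => //; move: ka; lia.
Qed.

Lemma cderiv_dPhi x : far x -> cderiv dPhi x (ddPhi x).
Proof.
move=> /(Phi_far k0 ka)[x0 _ _]; rewrite -[ddPhi x]add0r.
apply: cderivD; first exact: cderiv_cst.
by apply: cderivZ; apply: cderivZ; apply: cderiv_rtX => //; move: ka; lia.
Qed.

Lemma normc_nat n : normc (n%:R : R[i]) = n%:R.
Proof. by rewrite -(rmorph_nat (@real_complex R)) normc_real ger0_norm. Qed.

Lemma normc_coef m : (m <= a)%N -> normc (m%:R / (2 ^ k)%:R : R[i]) <= a%:R.
Proof.
move=> ma; rewrite normcM normcV !normc_nat ler_pdivrMr ?ltr0n ?expn_gt0//.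
by rewrite -natrM ler_nat; have := expn_gt0 2 k; nia.
Qed.

Lemma dPhi_near x : far x -> normc (dPhi x - 1) <= 100^-1.
Proof.
move=> /(Phi_far k0 ka)[x0 x3 _]; rewrite /dPhi addrAC subrr add0r normcM normc_real.
rewrite (ger0_norm (ltW (ccoef_gt0 R k0 ka))) normcM normcX; apply: ccoef_le => //.
have h1 := normc_coef (leqnn a); have h2 := normc_rtX_le3 k x3 (leq_subr (2 ^ k) a).
apply: (@le_trans _ _ (a%:R * 3 ^+ a)).
  by apply: ler_pM; rewrite ?normc_ge0 ?exprn_ge0 ?normc_ge0.
apply: ler_wpM2r; first exact: exprn_ge0.
rewrite -!natrX -natrM ler_nat expnS expn1.
by have := a_gt0 k0 ka; have := expn_gt0 2 k; nia.
Qed.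

Lemma ddPhi_small x : far x -> normc (ddPhi x) <= 100^-1.
Proof.
move=> /(Phi_far k0 ka)[x0 x3 _]; rewrite /ddPhi normcM normc_real.
rewrite (ger0_norm (ltW (ccoef_gt0 R k0 ka))) !(normcM (_ / _)) normcX; apply: ccoef_le => //.
have h1 := normc_coef (leqnn a); have h3 := normc_coef (leq_subr (2 ^ k) a).
have h2 := normc_rtX_le3 k x3 (leq_trans (leq_subr (2 ^ k) _) (leq_subr (2 ^ k) a)).
apply: (@le_trans _ _ (a%:R * (a%:R * 3 ^+ a))).
  apply: ler_pM => //; rewrite ?normc_ge0 ?mulr_ge0 ?exprn_ge0 ?normc_ge0//.
  by apply: ler_pM; rewrite ?normc_ge0 ?exprn_ge0 ?normc_ge0.
rewrite mulrA -expr2; apply: ler_wpM2r; first exact: exprn_ge0.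
by rewrite ler_peMr// ?sqr_ge0// exprn_ege1// ler1n.
Qed.

Lemma cderiv_pole x : far x -> cderiv pole x (- (dPhi x * pole x ^+ 2)).
Proof.
move=> fx; have A0 := normc_Phi_far k0 ka fx.
have A1 : Phi (cx x) != 0 by rewrite -normc_gt0; lra.
by have := cderivV A1 (cderiv_Phi fx); rewrite mulNr -exprVn.
Qed.

Lemma is_derive_kap x : far x -> is_derive x e0 kap (2 * Re (dPhi x * pole x ^+ 2)).
Proof.
move=> fx; have := cderiv_Re e0 (cderivB (cderiv_cst 1 x) (cderivZ 2 (cderiv_pole fx))).
rewrite cx_e0 mul1r sub0r mulrN opprK.
have E (z : R[i]) : Re (2 * z) = 2 * Re z by case: z => s t /=; ring.
by rewrite E; congr is_derive; apply/funext => y; rewrite cReD cReN E.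
Qed.

Lemma is_derive_dkap x : far x -> is_derive x e0 (fun x => 2 * Re (dPhi x * pole x ^+ 2))
  (2 * Re (ddPhi x * pole x ^+ 2 - 2 * (dPhi x ^+ 2 * pole x ^+ 3))).
Proof.
move=> fx; have := cderiv_Re e0 (cderivZ 2 (cderivM (cderiv_dPhi fx) (cderivX 2 (cderiv_pole fx)))).
have E (z : R[i]) : Re (2 * z) = 2 * Re z by case: z => s t /=; ring.
rewrite cx_e0 mul1r E /=.
have -> : dPhi x * (2%:R * pole x ^+ 1 * - (dPhi x * pole x ^+ 2)) =
  - (2 * (dPhi x ^+ 2 * pole x ^+ 3)) by ring.
by congr is_derive; apply/funext => y; rewrite E.
Qed.

(** With P = 1 / Phi, the second derivative is 2 Re (Phi'' P ^ 2 - 2 Phi' ^ 2 P ^ 3), and Phi' ^ 2 P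
    ^ 3 is within 7 of its model value 8, while the first term is at most 9/100. *)
Lemma ddkap_bound x : far x ->
  - 100 <= 2 * Re (ddPhi x * pole x ^+ 2 - 2 * (dPhi x ^+ 2 * pole x ^+ 3)) <= -1.
Proof.
move=> fx; have P3 := normc_pole k0 ka fx; have d1 := dPhi_near fx; have d2 := ddPhi_small fx.
have [_ _ w1] := Phi_far k0 ka fx; have A0 := normc_Phi_far k0 ka fx.
have A1 : Phi (cx x) != 0 by rewrite -normc_gt0; lra.
have P0 := normc_ge0 (pole x).
have s1 : normc (ddPhi x * pole x ^+ 2) <= 100^-1 * 9.
  rewrite normcM normcX; apply: ler_pM; rewrite ?normc_ge0 ?exprn_ge0//.
  by move: P0 P3; move: (normc _) => n; nra.
have s2 : normc (dPhi x ^+ 2 * pole x ^+ 3 - 8) <= 7.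
  set u := dPhi x - 1 in d1; set v := 2 * (Phi (cx x) - 2^-1).
  have hv : normc v <= 15^-1.
    by rewrite /v normcM (normc_nat 2); lra.
  (* With 1 + u = Phi' and 1 + v = 2 Phi, the number 8 is P ^ 3 (1 + v) ^ 3; the bracket is (1 + u)
     ^ 2 - (1 + v) ^ 3. *)
  have -> : dPhi x ^+ 2 * pole x ^+ 3 - 8 =
      pole x ^+ 3 * ((u * (u + 2)) - v * (3 + v * (3 + v))).
    by rewrite /u /v /pole; field.
  have q1 : normc (u * (u + 2)) <= 100^-1 * 3.
    rewrite normcM; apply: ler_pM; rewrite ?normc_ge0//.
    by have := le_normcD u 2; rewrite (normc_nat 2); lra.
  have q2 : normc (v * (3 + v * (3 + v))) <= 15^-1 * (33/10).
    rewrite normcM; apply: ler_pM; rewrite ?normc_ge0//.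
    have q3 : normc (v * (3 + v)) <= 15^-1 * 4.
      rewrite normcM; apply: ler_pM; rewrite ?normc_ge0//.
      by have := le_normcD 3 v; rewrite (normc_nat 3); lra.
    by have := le_normcD 3 (v * (3 + v)); rewrite (normc_nat 3); lra.
  have q4 := le_normcD (u * (u + 2)) (- (v * (3 + v * (3 + v)))).
  rewrite normcN in q4.
  rewrite normcM normcX; apply: (@le_trans _ _ (3 ^+ 3 * (7/27))).
    apply: ler_pM; rewrite ?exprn_ge0 ?normc_ge0//; last by lra.
    by apply: lerXn2r P3; rewrite nnegrE.
  by rewrite -natrX; lra.
set p := dPhi x ^+ 2 * _ in s2 *; set q := ddPhi x * _ in s1 *.
have E : Re (q - 2 * p) = Re q - 2 * (Re (p - 8) + 8).
  by case: (p) (q) => s t [s' t'] /=; ring.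
rewrite E; have := Re_le_normc q; have := Re_le_normc (p - 8); rewrite !ler_norml; lra.
Qed.

Lemma kap_bound x : far x -> `|kap x| <= 7.
Proof.
move=> fx; have := Re_le_normc (pole x); have := normc_pole k0 ka fx.
by rewrite /kap !ler_norml; lra.
Qed.

Lemma continuous_kap x : far x -> {for x, continuous kap}.
Proof.
move=> fx; have [h _] := cvgc_pole k0 ka fx.
by apply: cvgB; [exact: cvg_cst|apply: cvgM; [exact: cvg_cst|exact: h]].
Qed.

Lemma iter_dif_kap h x : 0 <= h -> `|x - (2^-1, 0)| + 2 * h < 100^-1 ->
  iter 2 (dif e0 h) kap x <= - h ^+ 2.
Proof.
move=> h0 hx.
pose r (j : nat) (y : R * R) : R := match j with 0 => kap y | 1 => 2 * Re (dPhi y * pole y ^+ 2)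
  | _ => 2 * Re (ddPhi y * pole y ^+ 2 - 2 * (dPhi y ^+ 2 * pole y ^+ 3)) end.
have fr t : 0 <= t <= 2%:R * h -> far (t *: e0 + x).
  move=> /andP[t0 t1]; rewrite /far /mkset -addrA.
  apply: le_lt_trans (ler_normD _ _) _; rewrite normrZ (ger0_norm t0).
  have -> : `|e0| = 1 by rewrite prod_normE /= normr1 normr0 max_l.
  move: hx t1; move: (`|_|) => n; lra.
have /andP[_ +] : -100 * h ^+ 2 <= iter 2 (dif e0 h) (r 0) x <= -1 * h ^+ 2.
  apply: iter_dif_bounds => // [j t j2 /fr ft|t /fr ft]; last exact: ddkap_bound.
  by case: j j2 => [|[|//]] _; [exact: is_derive_kap|exact: is_derive_dkap].
by rewrite mulN1r.
Qed.

(** A second difference of step - h at y is the one of step h at y - 2 h, and the three points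
    involved lie in [far]. *)
Lemma iter_dif_kap_patch h y : 0 <= h -> `|y - (2^-1, 0)| + 4 * h < 100^-1 ->
  iter 2 (dif e0 (- h)) (kap \_ far) y <= - h ^+ 2.
Proof.
move=> h0 hy.
have e1 : `|e0| = 1 :> R by rewrite prod_normE /= normr1 normr0 max_l.
have fr t : 0 <= t <= 2 * h -> far (- t *: e0 + y) /\
    `|- t *: e0 + y - (2^-1, 0)| <= t + `|y - (2^-1, 0)|.
  move=> /andP[t0 t1]; have h1 : `|- t *: e0 + y - (2^-1, 0)| <= t + `|y - (2^-1, 0)|.
    rewrite -addrA; apply: le_trans (ler_normD _ _) _.
    by rewrite normrZ normrN (ger0_norm t0) e1 mulr1.
  split=> //; rewrite /far /mkset; apply: le_lt_trans h1 _.
  by move: hy t1; move: (`|_|) => n; lra.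
have [f2 h2] : far (- (2 * h) *: e0 + y) /\
    `|- (2 * h) *: e0 + y - (2^-1, 0)| <= 2 * h + `|y - (2^-1, 0)|.
  by apply: fr; apply/andP; split; lra.
have [f1 _] : far (- h *: e0 + y) /\ `|- h *: e0 + y - (2^-1, 0)| <= h + `|y - (2^-1, 0)|.
  by apply: fr; apply/andP; split; lra.
have [f0 _] : far (- 0 *: e0 + y) /\ `|- 0 *: e0 + y - (2^-1, 0)| <= 0 + `|y - (2^-1, 0)|.
  by apply: fr; apply/andP; split; lra.
rewrite oppr0 scale0r add0r in f0.
have := @iter_dif_kap h (- (2 * h) *: e0 + y) h0.
have E1 : h *: e0 + (- (2 * h) *: e0 + y) = - h *: e0 + y.
  by rewrite addrA -scalerDl; congr (_ *: _ + _); ring.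
have E2 : h *: e0 + (- h *: e0 + y) = y by rewrite addrA -scalerDl subrr scale0r add0r.
have E3 : - h *: e0 + (- h *: e0 + y) = - (2 * h) *: e0 + y.
  by rewrite addrA -scalerDl; congr (_ *: _ + _); ring.
rewrite /= /dif E1 E2 E3 !patch_in// => h3; apply: le_trans (h3 _).
  by lra.
by move: hy h2; move: (`|_|) (`|_|) => n1 n2; lra.
Qed.

Lemma iter_dif_approx psi S h y : smooth psi -> 0 <= h ->
  (forall z, `|pderivs [:: 0; 0; 0] psi z| <= S) ->
  `|iter 2 (dif e0 h) psi y - h ^+ 2 * pderivs [:: 0; 0] psi y| <= 2 * S * h ^+ 3.
Proof.
move=> sp h0 hS; set p2 := pderivs [:: 0; 0] psi.
have dv s z : is_derive z e0 (pderivs s psi) (pderivs (0 :: s) psi z) by exact: smooth_is_derive.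
have b1 t : 0 <= t <= 2%:R * h -> p2 y - 2 * h * S <= p2 (t *: e0 + y) <= p2 y + 2 * h * S.
  move=> /andP[t0 t1].
  have : `|iter 1 (dif e0 t) p2 y| <= S * t ^+ 1.
    by apply: (@iter_dif_le _ _ e0 1 (fun j => pderivs (nseq j.+2 0) psi)) => // j u _ _; exact: dv.
  have S0 : 0 <= S by apply: le_trans (hS y).
  have : S * t <= S * (2 * h) by exact: ler_wpM2l.
  rewrite -[iter 1 _ _ _]/(p2 (t *: e0 + y) - p2 y) expr1 ler_norml.
  move: (p2 _) (p2 _) => u v; lra.
have /andP[] : (p2 y - 2 * h * S) * h ^+ 2 <= iter 2 (dif e0 h) psi y <= (p2 y + 2 * h * S) * h ^+ 2.
  by apply: (@iter_dif_bounds _ _ e0 2 (fun j => pderivs (nseq j 0) psi)).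
rewrite ler_norml; move: (p2 y) (iter _ _ _ _) => u v u1 u2.
apply/andP; split; lra.
Qed.

(* Integration by parts, carried out on second differences: [kap \_ far] is
   not smooth. *)
Lemma kap_integral psi x0 t : smooth psi -> (forall y, 0 <= psi y) -> 0 < t ->
  (forall y, t <= `|y - x0| -> psi y = 0) -> `|x0 - (2^-1, 0)| + t < 200^-1 ->
  \int[mu]_y (pderivs [:: 0; 0] psi y * (kap \_ far) y) <= - \int[mu]_y psi y.
Proof.
move=> sp p0 t0 pt xt.
have tpsi : test_function setT psi.
  by apply: (@test_function_box _ psi x0 t) => // y /ltW; exact: pt.
have [_ [b [S [b0 S0 hS hb]]]] := test_function_bsup [:: 0; 0; 0] tpsi.
have bp2 := test_function_bsup [:: 0; 0] tpsi.
have bp : bsup psi by exact: (test_function_bsup [::] tpsi).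
have mk : mfun2 setT (kap \_ far) by apply: mfun2_patch; [exact: open_far|exact: continuous_kap].
have kb : forall y, `|(kap \_ far) y| <= 7 by apply: patch_bound => // y; exact: kap_bound.
have p2out y : t < `|y - x0| -> pderivs [:: 0; 0] psi y = 0.
  move=> ty; apply: (@pderivs_out _ (box x0 t)).
  - by apply: compact_closed; [exact: norm_hausdorff|exact: compact_box].
  - move=> z; rewrite /box /= => /negP; rewrite -ltNge => /ltW; exact: pt.
  - by rewrite /box /= => h; move: ty; rewrite ltNge h.
set I := \int[mu]_y _; set F := \int[mu]_y psi y.
pose C := 2 * S * 7 * (2 * (t + 1)) ^+ 2.
(* Second differences of [psi] approximate h ^ 2 times its second derivative up to O(h ^ 3); moved
   onto [kap], they are at most - h ^ 2 on the support of [psi]. Dividing by h ^ 2 leaves an error C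
   h, with the box enlarged by 1 to hold the translates. *)
have main h : 0 < h -> h < 800^-1 -> I <= - F + C * h.
  move=> h0 h1; have h0' := ltW h0.
  have bi : bsup (iter 2 (dif e0 h) psi) by exact: bsup_iter_dif.
  have bik := bsupM bi mk kb.
  have e1 : \int[mu]_y (iter 2 (dif e0 h) psi y * (kap \_ far) y) <= - h ^+ 2 * F.
    rewrite (Rintegral_iter_dif _ _ _ bp mk kb) -(Rintegral_bsupZ (- h ^+ 2) bp).
    have mk2 : mfun2 setT (iter 2 (dif e0 (- h)) (kap \_ far)).
      have [m1 b1] := mfun2_dif e0 (- h) mk kb; by have [] := mfun2_dif e0 (- h) m1 b1.
    have kb2 y : `|iter 2 (dif e0 (- h)) (kap \_ far) y| <= 2 ^+ 2 * 7 by apply: iter_dif_sup.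
    apply: le_Rintegral_bsup; [exact: bsupM bp mk2 kb2|exact: bsupZ|].
    move=> y; have [->|py] := eqVneq (psi y) 0; first by rewrite mul0r mulr0.
    rewrite mulrC; apply: ler_wpM2r => //; apply: iter_dif_kap_patch => //.
    have : `|y - x0| < t by rewrite ltNge; apply: contra py => /pt ->.
    have := ler_normD (y - x0) (x0 - (2^-1, 0)); rewrite addrA subrK.
    lra.
  have bp2k := bsupZ (h ^+ 2) (bsupM bp2 mk kb).
  have e2 : `|\int[mu]_y (iter 2 (dif e0 h) psi y * (kap \_ far) y) - h ^+ 2 * I| <= C * h ^+ 3.
    rewrite /I -(Rintegral_bsupZ (h ^+ 2) (bsupM bp2 mk kb)) -(Rintegral_bsupB bik bp2k).
    rewrite (_ : C * h ^+ 3 = 2 * S * h ^+ 3 * 7 * (2 * (t + 1)) ^+ 2); last by rewrite /C; ring.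
    apply: (@Rintegral_box_le _ _ x0).
    - by have [] := bsupB bik bp2k.
    - lra.
    - by rewrite !mulr_ge0// exprn_ge0.
    - move=> y; rewrite mulrA -mulrBl normrM; apply: ler_pM => //.
      exact: iter_dif_approx.
    - move=> y hy; rewrite p2out; last by lra.
      rewrite (_ : iter 2 _ _ _ = 0) ?mul0r ?mulr0 ?subrr//.
      have en : `|e0| = 1 :> R by rewrite prod_normE /= normr1 normr0 max_l.
      have o j : 0 <= j -> j <= 2 * h -> psi (j *: e0 + y) = 0.
        move=> j0 j1; apply: pt; rewrite -addrA.
        have := lerB_normD (y - x0) (j *: e0); rewrite (addrC (y - x0)) normrZ en (ger0_norm j0).
        move: hy; move: (`|y - x0|) (`|_|) => n1 n2; lra.
      have o2 := o (2 * h); have o1 := o h; have o0 := o 0.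
      rewrite /= /dif !addrA -!scalerDl (_ : h + h = 2 * h); last by ring.
      rewrite scale0r add0r in o0; rewrite o2 ?o1 ?o0 ?subrr//; lra.
  have q0 : 0 < h ^+ 2 by rewrite exprn_gt0.
  rewrite -(ler_pM2l q0); move: e2; rewrite ler_norml => /andP[e2 _].
  have : h ^+ 3 = h ^+ 2 * h by rewrite exprSr.
  move=> h3; rewrite h3 in e2; move: e1 e2; move: (\int[mu]_y _) => J; lra.
have C0 : 0 <= C.
  by apply: mulr_ge0; [rewrite !mulr_ge0|exact: sqr_ge0].
apply/ler_addgt0Pl => e e_gt0.
pose h := Num.min (1600^-1) (e / (C + 1)).
have hp : 0 < h by rewrite lt_min invr_gt0 divr_gt0//=; lra.
have hq : h < 800^-1 by rewrite gt_min; apply/orP; left; lra.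
have he : h <= e / (C + 1) by rewrite ge_min lexx orbT.
apply: le_trans (main h hp hq) _; rewrite addrC lerD2r.
rewrite ler_pdivlMr in he; last by lra.
have : C * h <= h * (C + 1) by nra.
lra.
Qed.
End Kappa.

(** * Lower bound for the quasi-norm of the second derivative *)

Section Lower.
Context {R : realType}.
Variables (k a : nat).
Hypothesis k0 : (0 < k)%N.
Hypothesis ka : (2 * 2 ^ k <= a)%N.
Variable phi : R * R -> R.
Hypothesis hphi : mollifier phi.
Variables (K : nat) (rho : R).
Hypothesis rho0 : 0 < rho.
Hypothesis rho2 : rho <= 2^-1.
Hypothesis K0 : (0 < K)%N.
Hypothesis aK : (a < 2 ^ k * K)%N.
Implicit Types (x y : R * R) (d w : R).
Local Notation mu := (@mu2 R).
Local Notation e0 := (basis2 R 0).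
Local Notation kap := (@kap R k a).
Local Notation far := (@far R).
Local Notation dom := (@dom R k a).
Local Notation green := (@green R k a).
Local Notation jg := (jgreen k a phi K rho).
Local Notation ig := (igreen k a phi K rho).

Lemma bump_at_far t x0 y : `|x0 - (2^-1, 0)| + t < 200^-1 -> `|y - x0| <= t -> far y.
Proof.
move=> h yt; rewrite /far /mkset; have := ler_normD (y - x0) (x0 - (2^-1, 0)).
rewrite addrA subrK => h1; apply: le_lt_trans h1 _.
have : (200^-1 : R) < 100^-1 by lra.
lra.
Qed.

Lemma bump_at_test t x0 : 0 < t -> `|x0 - (2^-1, 0)| + t < 200^-1 ->
  test_function dom (bump_at phi t x0).
Proof.
move=> t0 h; apply: (@test_function_box _ _ x0 t); first exact: bump_at_smooth.
  by move=> y yt; apply: (far_dom k0 ka); exact: bump_at_far h yt.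
by move=> y /ltW; exact: bump_at_out.
Qed.

Lemma bump_at_out2 t x0 y : 0 < t -> t < `|y - x0| -> pderivs [:: 0; 0] (bump_at phi t x0) y = 0.
Proof.
move=> t0 ty; apply: (@pderivs_out _ (box x0 t)).
- by apply: compact_closed; [exact: norm_hausdorff|exact: compact_box].
- by move=> z; rewrite /box /= => /negP; rewrite -ltNge => /ltW; exact: bump_at_out.
- by rewrite /box /= => h; move: ty; rewrite ltNge h.
Qed.

Lemma jgreen_patch d : small K d -> mfun2 setT (jg d \_ far) /\
  exists b, forall y, `|(jg d \_ far) y| <= b.
Proof.
move=> sd; have [d0 _] := sd; split.
  apply: mfun2_patch; first exact: open_far.
  by move=> x; exact: (continuous_jgreen k0 ka hphi rho0 sd).
have [mf [b [M [b0 M0 fM fb]]]] := atom_bsup hphi K rho0 d0.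
exists (M * 1 * (2 * b) ^+ 2); apply: patch_bound.
  by apply: mulr_ge0; [rewrite mulr1|exact: sqr_ge0].
move=> x fx; have [mg gb] := gker_patch k0 ka fx.
apply: (@Rintegral_box_le _ _ 0) => //.
- exact: measurable_funM.
- by rewrite mulr1.
- by move=> y; rewrite normrM; apply: ler_pM.
- by move=> y; rewrite subr0 => /fb ->; rewrite mul0r.
Qed.

(** The two signs of the distributional derivatives cancel, and on the support of the bump, which
    lies in [far], the potential is [jgreen] divided by 2 pi. *)
Lemma d2green_bump d t x0 : small K d -> 0 < t -> `|x0 - (2^-1, 0)| + t < 200^-1 ->
  2 * pi * d2green dom green 0 0 (atom phi K rho d) (bump_at phi t x0) =
  \int[mu]_y (pderivs [:: 0; 0] (bump_at phi t x0) y * (jg d \_ far) y).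
Proof.
move=> sd t0 h; rewrite /d2green /ddistr opprK /distr_of Rintegral_mkcond.
have bf := test_function_bsup [:: 0; 0] (bump_at_test t0 h).
have pi0 : 2 * pi != 0 :> R by rewrite mulf_neq0// lt0r_neq0// pi_gt0.
have [mj [b jb]] := jgreen_patch sd.
have bj := bsupM bf mj jb.
have -> : \int[mu]_y ((fun y => green_op dom green (atom phi K rho d) y *
     pderiv 0 (pderiv 0 (bump_at phi t x0)) y) \_ dom) y =
   (2 * pi)^-1 * \int[mu]_y (pderivs [:: 0; 0] (bump_at phi t x0) y * (jg d \_ far) y).
  rewrite -(Rintegral_bsupZ _ bj); congr Rintegral; apply/funext => y.
  rewrite -[pderiv 0 (pderiv 0 _)]/(pderivs [:: 0; 0] (bump_at phi t x0)).
  have [ty|yt] := ltP t `|y - x0|.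
    rewrite [in RHS]bump_at_out2// mul0r mulr0 patchE.
    by rewrite bump_at_out2// mulr0; case: ifP.
  have fy := bump_at_far h yt.
  rewrite !patch_in//; last exact: (far_dom k0 ka fy).
  by rewrite (green_op_atom k0 ka hphi rho0 rho2 sd fy); ring.
by rewrite mulrA mulfV// mul1r.
Qed.

(** Every extension takes the same value on bumps supported in the domain, so one fixed scale t
    bounds all the maximal functions from below on a fixed box around (1/2, 0). That value is
    [igreen] times the integral of the second derivative of a bump against [kap], bounded away from
    0 by concavity, up to one more power of w. *)
Lemma hpr_norm_lower (p : R) s m : 0 < p -> s \in [:: 1; -1] -> 0 < m ->
  (forall y, `|y - (1, 0)| <= rho -> m <= s * rtdif k a K y) ->
  exists c w0 : R, [/\ 0 < c, 0 < w0 & forall w, 0 < w -> w < w0 ->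
    ((c * (w ^+ a * (w ^+ (2 ^ k)) ^+ 2))%:E <=
      hpr_norm phi p dom (d2green dom green 0 0 (atom phi K rho (w ^+ (2 ^ k))))%R)%E].
Proof.
move=> p0 s1 m0 hm.
(* With t < 1/400, a point x0 of the box of radius t has its own bump of radius t within 1/200 of
   (1/2, 0). *)
have [t t0 t1] : exists2 t : R, 0 < t & t < 400^-1 by exists 500^-1; lra.
have t2 : t < 1 by lra.
have [c1 c10 hc1] := mollifier_integral_ge hphi.
have [M M0 hM] := mollifier_bound hphi [:: 0; 0].
pose S := M * t ^- 4 * (2 * t) ^+ 2.
have S0 : 0 <= S by apply: mulr_ge0; [rewrite mulr_ge0// invr_ge0 exprn_ge0// ltW|exact: sqr_ge0].
pose c2 := ccoef R k a * m.
have c20 : 0 < c2 by rewrite mulr_gt0// (ccoef_gt0 R k0 ka).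
have j0 : 0 <= jerr (R := R) k a K by exact: jerr_ge0.
(* The first bound keeps the atom in the cone and w <= 1; the second makes the error at most half of
   the main term. *)
pose w0 := Num.min ((K.+3%:R * 200)^-1) (c2 * c1 / (2 * (jerr (R := R) k a K * S + 1))).
have jS : 0 <= jerr (R := R) k a K * S by exact: mulr_ge0.
have w00 : 0 < w0.
  rewrite lt_min; apply/andP; split; first by rewrite invr_gt0 mulr_gt0.
  by rewrite divr_gt0//; [exact: mulr_gt0|lra].
(* Half of the main constant c2 c1, times the lower bound c1 rho ^ 2 for the mass of the bump of the
   atom divided by d ^ 2, over the 2 pi of Green's function. *)
pose v := c2 * c1 / 2 * (c1 * rho ^+ 2) / (2 * pi).
have pi0 : 0 < 2 * pi :> R by rewrite mulr_gt0// pi_gt0.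
have v0 : 0 < v.
  apply: divr_gt0 => //; apply: mulr_gt0; first by rewrite divr_gt0// mulr_gt0.
  by rewrite mulr_gt0// exprn_gt0.
exists (v * ((2 * t) ^+ 2) `^ p^-1), w0; split => //.
  by rewrite mulr_gt0// powR_gt0// exprn_gt0// mulr_gt0.
move=> w wp ww; have wp' := ltW wp.
have [wa wb] : w < (K.+3%:R * 200)^-1 /\ w < c2 * c1 / (2 * (jerr (R := R) k a K * S + 1)).
  by move: ww; rewrite lt_min => /andP.
have Kw : K.+2%:R * w < 200^-1.
  have h1 : w * (K.+3%:R * 200) < 1.
    by rewrite -ltr_pdivlMr ?mulr_gt0// mul1r.
  have : K.+3%:R = K.+2%:R + 1 :> R by rewrite natr1.
  nra.
have w1 : w <= 1.
  have : 1 <= K.+2%:R :> R by rewrite ler1n.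
  nra.
have n0 : (0 < 2 ^ k)%N by rewrite expn_gt0.
have sd : small K (w ^+ (2 ^ k)).
  split; first exact: exprn_gt0.
  by apply: le_lt_trans Kw; rewrite ler_wpM2l// ler_iXnr.
set d := w ^+ (2 ^ k) in sd *; have [d0 _] := sd.
apply: le_ereal_inf_tmp => _ [E [tE eE] <-].
rewrite mulrAC.
have rt0 : 0 <= t by exact: ltW.
have vp : 0 <= v * (w ^+ a * d ^+ 2).
  by apply: mulr_ge0; [exact: ltW|rewrite mulr_ge0 ?exprn_ge0// ltW].
have := @hp_norm_ge _ phi p E (2^-1, 0) t (v * (w ^+ a * d ^+ 2)) p0 rt0 vp.
apply=> x0 hx0.
have xt : `|x0 - (2^-1, 0)| + t < 200^-1.
  by move: hx0 t1; lra.
apply: ereal_sup_ge; exists (`|mollify phi t E x0|%:E).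
  by exists t => //=; rewrite in_itv /= t0.
rewrite lee_fin /mollify -/(bump_at phi t x0).
rewrite eE; last exact: bump_at_test.
set T := d2green _ _ _ _ _ _.
set psi := bump_at phi t x0 in T *.
set F := \int[mu]_y dilate phi (rho * d) (d, 0) y.
have F1 : c1 * rho ^+ 2 * d ^+ 2 <= F.
  have rd : rho * d != 0 by rewrite mulf_neq0// lt0r_neq0.
  have := hc1 (rho * d)^-1 (- (rho * d)^-1 *: (d, 0)); rewrite invr_neq0// => /(_ isT).
  rewrite exprVn invrK exprMn mulrA => h; apply: le_trans h _.
  rewrite /F dilateE (_ : (fun y => 1 * _) = (fun y => phi ((rho * d)^-1 *: y + - (rho * d)^-1 *: (d, 0))))//.
  by apply/funext => y; rewrite mul1r.
have F0 : 0 <= F.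
  by apply: le_trans F1; apply: mulr_ge0; [rewrite mulr_ge0 ?sqr_ge0// ltW|exact: sqr_ge0].
have P1 : c1 <= \int[mu]_y psi y.
  have ti : - t^-1 != 0 by rewrite oppr_eq0 invr_neq0// lt0r_neq0.
  have := hc1 (- t^-1) (t^-1 *: x0) ti.
  have bp : bsup psi by exact: (test_function_bsup [::] (bump_at_test t0 xt)).
  have -> : (fun y => phi (- t^-1 *: y + t^-1 *: x0)) = (fun y => t ^+ 2 * psi y).
    apply/funext => y; rewrite /psi bump_atE mulrA mulfV ?mul1r//.
    by rewrite expf_neq0// lt0r_neq0.
  rewrite (Rintegral_bsupZ _ bp) sqrrN exprVn invrK mulrC ler_pM2l//.
  exact: exprn_gt0.
have A := d2green_bump sd t0 xt; rewrite -/T -/psi in A.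
have [mj [b jb]] := jgreen_patch sd.
set p2 := pderivs [:: 0; 0] psi in A.
have bp2 : bsup p2 by exact: (test_function_bsup [:: 0; 0] (bump_at_test t0 xt)).
have mk : mfun2 setT (kap \_ far).
  by apply: mfun2_patch; [exact: open_far|move=> y; exact: (continuous_kap k0 ka)].
have kb : forall y, `|(kap \_ far) y| <= 7.
  by apply: patch_bound => // y; exact: (kap_bound k0 ka).
have bpk := bsupM bp2 mk kb; have bpj := bsupM bp2 mj jb.
set I := ig d.
pose e := jerr k a K * w ^+ a.+1 * F.
have e0' : 0 <= e by rewrite !mulr_ge0// exprn_ge0.
have eb y : `|(jg d \_ far) y - I * (kap \_ far) y| <= e.
  have [fy|fy] := pselect (far y); last by rewrite !patch_out// mulr0 subrr normr0.
  by rewrite !patch_in// mulrC; exact: (jgreen_expand k0 ka hphi rho0 rho2 K0 aK wp w1 sd fy).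
have A1 : `|\int[mu]_y (p2 y * (jg d \_ far) y) - I * \int[mu]_y (p2 y * (kap \_ far) y)| <= S * e.
  rewrite -(Rintegral_bsupZ I bpk) -(Rintegral_bsupB bpj (bsupZ I bpk)).
  rewrite (_ : S * e = M * t ^- 4 * e * (2 * t) ^+ 2); last by rewrite /S; ring.
  apply: (@Rintegral_box_le _ _ x0) => //.
  - by have [] := bsupB bpj (bsupZ I bpk).
  - by apply: mulr_ge0 => //; rewrite mulr_ge0// invr_ge0 exprn_ge0.
  - move=> y; rewrite mulrCA -mulrBr normrM; apply: ler_pM => //.
    exact: (pderivs_bump_at hphi x0 t0 hM).
  - by move=> y hy; rewrite /p2 bump_at_out2// !mul0r mulr0 subrr.
have A2 : \int[mu]_y (p2 y * (kap \_ far) y) <= - \int[mu]_y psi y.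
  apply: (kap_integral k0 ka _ _ t0 _ xt).
  - exact: bump_at_smooth.
  - move=> y; rewrite /psi /bump_at mulr_ge0 ?(mollifier_ge0 hphi)//.
    by rewrite invr_ge0 exprn_ge0.
  - by move=> y; exact: bump_at_out.
have A3 : c2 * w ^+ a * F <= s * I.
  by have := igreen_lower k0 ka hphi rho0 rho2 m0 hm wp sd.
have q0 : 0 <= w ^+ a * F by rewrite mulr_ge0// exprn_ge0.
have sI0 : 0 <= s * I by apply: le_trans A3; rewrite -mulrA mulr_ge0// ltW.
have A4 : w ^+ a * F * (c2 * c1 / 2) <= `|2 * pi * T|.
  suff key (X Y Z : R) : `|X - I * Y| <= S * e -> Y <= - Z -> c1 <= Z ->
      w ^+ a * F * (c2 * c1 / 2) <= `|X| by rewrite A; exact: key A1 A2 P1.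
  clear A A1 A2 P1 => A1 A2 P1.
  have B1 : s * I * c1 <= - (s * I * Y).
    by rewrite -mulrN; apply: ler_wpM2l => //; lra.
  have B2 : c2 * w ^+ a * F * c1 <= s * I * c1 by rewrite ler_wpM2r// ltW.
  (* The error carries w ^ (a + 1) against w ^ a, and [w0] was chosen so that the spare factor w
     absorbs the constants. *)
  have B3 : S * e <= w ^+ a * F * (c2 * c1 / 2).
    rewrite (_ : S * e = w ^+ a * F * (jerr k a K * S * w)); last by rewrite /e exprSr; ring.
    apply: ler_wpM2l => //.
    move: wb; rewrite ltr_pdivlMr; last by lra.
    by move: (jerr k a K * S) jS => u u0; nra.
  have B4 : - (s * X) <= `|X|.
    by move: s1; rewrite !inE => /orP[] /eqP ->; rewrite ?mulN1r ?opprK ?mul1r ?ler_norm// -normrN ler_norm.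
  have B5 : `|s * (X - I * Y)| <= S * e.
    rewrite normrM (_ : `|s| = 1) ?mul1r//.
    by move: s1; rewrite !inE => /orP[] /eqP ->; rewrite ?normrN normr1.
  move: B5; rewrite ler_norml => /andP[_ B5].
  rewrite (_ : s * (X - I * Y) = s * X - s * I * Y) in B5; last by ring.
  rewrite (_ : c2 * w ^+ a * F * c1 = w ^+ a * F * (c2 * c1 / 2) + w ^+ a * F * (c2 * c1 / 2)) in B2; last by field.
  lra.
rewrite -(ler_pM2l pi0) -{2}(gtr0_norm pi0) -normrM; apply: le_trans A4.
rewrite (_ : 2 * pi * (v * (w ^+ a * d ^+ 2)) = w ^+ a * (c1 * rho ^+ 2 * d ^+ 2) * (c2 * c1 / 2)).
  apply: ler_wpM2r; first by rewrite divr_ge0// mulr_ge0// ltW.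
  by apply: ler_wpM2l => //; rewrite exprn_ge0.
have pn : pi != 0 :> R by rewrite lt0r_neq0// pi_gt0.
by rewrite /v; move: (pi : R) pn => q qn; field.
Qed.
End Lower.

(** * Choice of the parameters and contradiction *)

Section Final.
Context {R : realType}.
Implicit Types (d w : R).

(** The exponent alpha = N - 2 ^ -k is not an integer, since 2 ^ k does not divide 1 for k > 0: no
    K-th difference of its power vanishes identically. *)
Lemma exponent_not_multiple k N j : (0 < k)%N -> (0 < N)%N -> (N * 2 ^ k - 1 != j * 2 ^ k)%N.
Proof.
move=> k0 N0; apply/eqP => h; have := expn_gt0 2 k => e0.
have : (2 ^ k %| 1)%N.
  rewrite -(@dvdn_addr (j * 2 ^ k)) ?dvdn_mull//.
  by rewrite -h subnK ?dvdn_mull// muln_gt0 N0.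
by rewrite dvdn1 -(expn0 2) eqn_exp2l// => /eqP k1; rewrite k1 in k0.
Qed.

Lemma exponent_lt k N : (0 < N)%N -> (N * 2 ^ k - 1 < 2 ^ k * N.*2.+2)%N.
Proof.
move=> N0; apply: (@leq_trans (N * 2 ^ k)).
  by rewrite subn1 prednK// muln_gt0 N0 expn_gt0.
by rewrite mulnC leq_mul2l; apply/orP; right; rewrite -addnn -addnS -addnS leq_addr.
Qed.

Lemma exponent_succ k N : (0 < N)%N -> (N * 2 ^ k - 1).+1 = (2 ^ k * N)%N.
Proof. by move=> N0; rewrite subn1 prednK 1?mulnC// muln_gt0 N0 expn_gt0. Qed.

Lemma root_exponent_exists (th : R) : th < 1 ->
  exists2 k, (0 < k)%N & 1 <= (2 ^ k)%:R * (1 - th).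
Proof.
move=> th1; have t0 : 0 < 1 - th by lra.
exists (Num.truncn (1 - th)^-1).+1 => //.
have := truncn_itv (ltW (_ : 0 < (1 - th)^-1)); rewrite invr_gt0 => /(_ t0) /andP[_ h].
rewrite -ler_pdivrMr// mul1r; apply: le_trans (ltW h) _.
by rewrite ler_nat ltnW// ltn_expl.
Qed.

Lemma atom_test k a phi K rho d : (0 < k)%N -> (2 * 2 ^ k <= a)%N -> mollifier phi ->
  0 < rho -> rho <= 2^-1 -> small K d -> test_function (dom k a) (atom phi K rho d).
Proof.
move=> k0 ka hphi r0 r2 [d0 d1]; split; first exact: atom_smooth.
exists (`[2^-1 * d, K.+2%:R * d]%classic `*` `[- (2^-1 * d), 2^-1 * d]%classic); split.
- by apply: compact_setX; exact: segment_compact.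
- move=> y [] /=; rewrite !in_itv /= => /andP[y1 y2] /andP[y3 y4].
  apply: (cone_dom k0 ka); split; last by lra.
  by rewrite ltr_norml; apply/andP; split; lra.
- move=> y hy; have [//|/(atom_strip hphi r0 r2 d0)[y1 y2 y3]] := eqVneq (atom phi K rho d y) 0.
  exfalso; apply: hy; split; rewrite /= in_itv /= ?y1//.
  by rewrite -ler_norml.
Qed.

(** The index pair (0, 0) already fails: boundedness would give c w ^ a d ^ 2 <= B w ^ (a + 1) d ^
    2, that is c <= B w, for all small w. *)
Lemma not_bounded k N p phi : mollifier phi -> 0 < p -> p * N.+2%:R = 2 -> (3 <= N)%N -> (0 < k)%N ->
  ~ (forall i j : 'I_2, hpz_hpr_bounded phi p (dom k (N * 2 ^ k - 1))
       (d2green (dom k (N * 2 ^ k - 1)) (@green R k (N * 2 ^ k - 1)) i j)).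
Proof.
move=> hphi p0 pN N3 k0 /(_ 0 0)[C C0 hC].
have N0 : (0 < N)%N by apply: leq_trans N3.
have ka := exponent_ge k0 N3; have aK := exponent_lt k N0; have aS := exponent_succ k N0.
have an := fun j => exponent_not_multiple j k0 N0.
move: ka aK aS an hC; set a := (N * 2 ^ k - 1)%N; clearbody a => ka aK aS an hC.
set K := N.*2.+2 in aK.
have KN : K.+2 = (2 * N.+2)%N by rewrite /K mul2n doubleS.
have [s [rho [s1 r0 r2 [m m0 hm]]]] := rtdif_lower (R := R) K an.
have [C1 C10 hC1] := hp_norm_atom hphi r0 r2 p0 pN KN.
have [c [w0 [c0 w00 hw]]] := hpr_norm_lower k0 ka hphi r0 r2 (ltn0Sn _) aK p0 s1 m0 hm.
pose B := C * C1; have B0 : 0 <= B by exact: mulr_ge0.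
have [w [wp ww Kw w1 wB]] : exists w, [/\ 0 < w, w < w0, K.+2%:R * w < 200^-1, w <= 1 & B * w < c].
  pose w := Num.min (w0 / 2) (Num.min ((K.+2%:R * 400)^-1) (c / (B + 1))).
  have wp : 0 < w.
    by rewrite !lt_min invr_gt0 !divr_gt0 ?mulr_gt0//=; lra.
  have wa : w <= w0 / 2 by rewrite ge_min lexx.
  have wb : w <= (K.+2%:R * 400)^-1 by rewrite !ge_min lexx orbT.
  have wc : w <= c / (B + 1) by rewrite !ge_min lexx !orbT.
  have K1 : 1 <= K.+2%:R :> R by rewrite ler1n.
  have wb' : w * (K.+2%:R * 400) <= 1 by rewrite -ler_pdivlMr ?mulr_gt0// mul1r.
  have wc' : w * (B + 1) <= c by rewrite -ler_pdivlMr//; lra.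
  exists w; split => //; [lra|lra|nra|nra].
have wp' := ltW wp.
have sd : small K (w ^+ (2 ^ k)).
  split; first exact: exprn_gt0.
  by apply: le_lt_trans Kw; rewrite ler_wpM2l// ler_iXnr// expn_gt0.
have [d0 _] := sd.
have tf := atom_test k0 ka hphi r0 r2 sd.
have hz := le_trans (hpz_norm_le phi p tf) (hC1 _ d0).
have := hC _ tf (le_lt_trans hz (ltry _)).
move=> /(le_trans (hw w wp ww)) h.
have : ((c * (w ^+ a * (w ^+ (2 ^ k)) ^+ 2))%:E <= C%:E * (C1 * (w ^+ (2 ^ k)) ^+ N.+2)%:E)%E.
  by apply: le_trans h _; apply: lee_wpmul2l => //; rewrite lee_fin.
(* Since a + 1 = 2 ^ k N, the power d ^ N is w ^ (a + 1). *)
have E : (w ^+ (2 ^ k)) ^+ N.+2 = w ^+ a * w * (w ^+ (2 ^ k)) ^+ 2.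
  by rewrite -(addn2 N) exprD -exprM -aS exprSr.
rewrite -EFinM lee_fin E.
rewrite (_ : C * (C1 * (w ^+ a * w * (w ^+ (2 ^ k)) ^+ 2)) = (B * w) * (w ^+ a * (w ^+ (2 ^ k)) ^+ 2)); last by rewrite /B; ring.
rewrite ler_pM2r; first by lra.
by rewrite mulr_gt0// exprn_gt0// exprn_gt0.
Qed.
End Final.

Theorem proposition6p4 (R : realType) (phi : R * R -> R)
    (hphi : mollifier phi) (p : R) (hp0 : 0 < p) (hp1 : p < 1)
    (hint : 2 * (p^-1 - 1) \is a Num.int) (hgt2 : 2 < 2 * (p^-1 - 1))
    (eps : R) (heps : 0 < eps) (hlambda : 0 < 2 * (p^-1 - 1) - eps) :
  exists D : set (R * R),
    [/\ bounded_domain D,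
        C_boundary (2 * (p^-1 - 1) - eps) D &
        exists G : R * R -> R * R -> R,
          green_function D G /\
          ~ (forall i j : 'I_2, hpz_hpr_bounded phi p D (d2green D G i j))].
Proof.
have [N NE] : exists N : nat, 2 * (p^-1 - 1) = N%:R.
  have /natrP[N NE] : 2 * (p^-1 - 1) \is a Num.nat by rewrite natrEint hint/= ltW//; lra.
  by exists N.
have N3 : (3 <= N)%N by rewrite -(ltr_nat R) -NE.
have pN : p * N.+2%:R = 2.
  rewrite -addn2 natrD -NE; field; exact: lt0r_neq0.
rewrite NE in hlambda *.
set l := N%:R - eps in hlambda *.
have /andP[l1 l2] := truncn_itv (ltW hlambda).
have lN : (Num.truncn l <= N.-1)%N.
  have : (Num.truncn l)%:R < N%:R :> R by apply: le_lt_trans l1 _; rewrite /l; lra.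
  by rewrite ltr_nat; case: (N) N3.
(* The Hoelder exponent must be positive even when lambda is an integer, hence the maximum with 1/2;
   any value in ]0, 1[ above the fractional part serves. *)
pose th := Num.max (l - (Num.truncn l)%:R) (2^-1).
have th0 : 0 < th by rewrite lt_max invr_gt0 ltr0n orbT.
have th1 : th < 1.
  rewrite gt_max; apply/andP; split; last by lra.
  by move: l2; rewrite -natr1; lra.
have lth : l - (Num.truncn l)%:R <= th by rewrite le_max lexx.
have [k k0 kth] := root_exponent_exists th1.
have ka := exponent_ge k0 N3.
exists (dom k (N * 2 ^ k - 1)); split.
- exact: bounded_domain_dom.
- by apply: (C_boundary_dom k0 N3 th0 th1 kth (ltW hlambda)).
exists (green k (N * 2 ^ k - 1)); split; first exact: green_function_dom.
exact: not_bounded.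
Qed.
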